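(* Assume H1 and that at least one of H2, H3 holds. Let $\bar\kappa > 1 \ge \underline{\kappa} > 1/2$. If H2 holds let $\bar\gamma < \min\{(2-1/\underline{\kappa})/L,\ 2/(\mathtt{m}+L)\}$, and if H3 holds let $\bar\gamma < \min\{(2-1/\underline{\kappa})/L,\ \eta/(2ML)\}$. Let $W = W_q$ for some $q\in\mathbb{N}^*$ if H2 holds, and $W = W_\alpha$ for some $\alpha < \min(\underline{\kappa}\eta/4, \eta/8)$ if H3 holds. Then for any $a\in(0,1]$ there exist $A_{2,a}\ge 0$ and $\rho_a\in(0,1)$ such that for any $\theta\in\Theta$, $\kappa\in[\underline{\kappa},\bar\kappa]$ and $\gamma\in(0,\bar\gamma]$, the kernels $R^{\kappa}_{\gamma,\theta}$ and $\bar R^{\kappa}_{\gamma,\theta}$ admit invariant probability measures $\pi_{\gamma,\theta}$ and $\bar\pi_{\gamma,\theta}$ respectively, and for any $x,y\in\mathbb{R}^d$ and $n\in\mathbb{N}$, $$\max\big(\|\delta_x (R^{\kappa}_{\gamma,\theta})^n - \pi_{\gamma,\theta}\|_{W^a},\ \|\delta_x (\bar R^{\kappa}_{\gamma,\theta})^n - \bar\pi_{\gamma,\theta}\|_{W^a}\big) \le A_{2,a}\rho_a^{\gamma n} W^a(x),$$ $$\max\big(\|\delta_x (R^{\kappa}_{\gamma,\theta})^n - \delta_y (R^{\kappa}_{\gamma,\theta})^n\|_{W^a},\ \|\delta_x (\bar R^{\kappa}_{\gamma,\theta})^n - \delta_y (\bar R^{\kappa}_{\gamma,\theta})^n\|_{W^a}\big)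 \le A_{2,a}\rho_a^{\gamma n} \{W^a(x)+W^a(y)\}.$$
   Context: Let $d,d_\Theta\ge1$ and $\Theta\subset\mathbb{R}^{d_\Theta}$ nonempty; $\|\cdot\|$ is the Euclidean norm. For a convex lower semicontinuous $U:\mathbb{R}^d\to\mathbb{R}$ and $\lambda>0$, $\mathrm{prox}^\lambda_U(x)=\arg\min_{\tilde x\in\mathbb{R}^d}\{U(\tilde x)+\|x-\tilde x\|^2/(2\lambda)\}$. A function $V$ is $\mathtt{m}$-convex ($\mathtt{m}\ge0$) if $V(tx+(1-t)y)\le tV(x)+(1-t)V(y)-(\mathtt{m}/2)t(1-t)\|x-y\|^2$ for all $x,y$, $t\in[0,1]$. H1: for every $\theta\in\Theta$ there are convex functions $V_\theta,\bar V_\theta,U_\theta,\bar U_\theta:\mathbb{R}^d\to[0,\infty)$ such that (a) $\pi_\theta(x)\propto\exp[-V_\theta(x)-U_\theta(x)]$, $\bar\pi_\theta(x)\propto\exp[-\bar V_\theta(x)-\bar U_\theta(x)]$ are probability densities and $\min(\inf_\theta\int e^{-V_\theta-U_\theta},\inf_\theta\int e^{-\bar V_\theta-\bar U_\theta})>0$; (b) $V_\theta,\bar V_\theta$ are continuously differentiable and there is $L\ge0$ with $\|\nabla V_\theta(x)-\nabla V_\theta(y)\|\le L\|x-y\|$ and the same for $\bar V_\theta$, for all $\theta,x,y$; moreover there are $R_{V,1},R_{V,2}\ge0$ such that for each $\theta$ there exist minimizers $x^*_\theta$ of $V_\theta$ and $\bar x^*_\theta$ of $\bar V_\theta$ with $\|x^*_\theta\|,\|\bar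 x^*_\theta\|\le R_{V,1}$ and $|V_\theta(x^*_\theta)|,|\bar V_\theta(\bar x^*_\theta)|\le R_{V,2}$; (c) there is $M\ge0$ such that $U_\theta,\bar U_\theta$ are $M$-Lipschitz for all $\theta$, and there are $R_{U,1},R_{U,2}\ge0$ such that for each $\theta$ there exist $x^\sharp_\theta,\bar x^\sharp_\theta$ with norms $\le R_{U,1}$ and $|U_\theta(x^\sharp_\theta)|,|\bar U_\theta(\bar x^\sharp_\theta)|\le R_{U,2}$. H2: there is $\mathtt{m}>0$ such that $V_\theta,\bar V_\theta$ are $\mathtt{m}$-convex for all $\theta$. H3: there are $\eta>0$, $c\ge0$ with $\min(U_\theta(x),\bar U_\theta(x))\ge\eta\|x\|-c$ for all $\theta,x$. MYULA kernels: for $\kappa,\gamma>0$, $\theta\in\Theta$, $R^\kappa_{\gamma,\theta}(x,\cdot)$ is the Gaussian law with mean $x-\gamma\nabla V_\theta(x)-\kappa^{-1}(x-\mathrm{prox}^{\gamma\kappa}_{U_\theta}(x))$ and covariance $2\gamma I_d$ (one step of $X_{k+1}=X_k-\gamma\nabla V_\theta(X_k)-\gamma\nabla U_\theta^{\gamma\kappa}(X_k)+\sqrt{2\gamma}Z_{k+1}$, $U^\lambda$ the Moreau–Yosida envelope); $\bar R^\kappa_{\gamma,\theta}$ is the same with $\bar V_\theta,\bar U_\theta$. Functions: $W_q(x)=1+\|x\|^{2q}$ ($q\in\mathbb{N}^*$), $W_\alpha(x)=\exp[\alpha\sqrt{1+\|x\|^2}]$ ($\alpha>0$). For $W\ge1$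 and a finite signed measure $\xi$, $\|\xi\|_W=\sup\{|\int f\,d\xi|: f \text{ measurable},\ \sup_x|f(x)|/W(x)\le1\}$. $\delta_x K^n$ is the law after $n$ steps of the kernel $K$ started at $x$. *)

(* Defs.v *)
From HB Require Import structures.
From mathcomp Require Import all_boot all_order all_algebra.
From mathcomp Require Import all_classical all_reals all_analysis.
Set Implicit Arguments. Unset Strict Implicit. Unset Printing Implicit Defensive.
Import Order.TTheory GRing.Theory Num.Theory.
Import numFieldNormedType.Exports.
Local Open Scope classical_set_scope.
Local Open Scope ring_scope.

Definition rV_measure_display : measure_display -> measure_display.
Proof. exact. Qed.

Section rV_measurable.
Context {R : realType} (d : nat).
Let coor : 'I_d -> 'rV[R]_d -> R := fun i x => x ord0 i.
Let rV_set0 : g_sigma_preimage coor set0.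
Proof. exact: sigma_algebra0. Qed.
Let rV_setC A : g_sigma_preimage coor A -> g_sigma_preimage coor (~` A).
Proof. exact: sigma_algebraC. Qed.
Let rV_bigcup (F : _^nat) : (forall i, g_sigma_preimage coor (F i)) ->
  g_sigma_preimage coor (\bigcup_i (F i)).
Proof. exact: sigma_algebra_bigcup. Qed.
HB.instance Definition _ := @isMeasurable.Build
  (rV_measure_display default_measure_display) 'rV[R]_d
  (g_sigma_preimage coor) rV_set0 rV_setC rV_bigcup.
End rV_measurable.

Section MYULA_defs.
Context {R : realType}.
Local Open Scope ereal_scope.

Definition enorm {d : nat} (x : 'rV[R]_d) : R :=
  Num.sqrt (\sum_(i < d) x ord0 i ^+ 2)%R.

Definition upd {d : nat} (x : 'rV[R]_d) (i : 'I_d) (t : R) : 'rV[R]_d :=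
  \row_j (if j == i then t else x ord0 j).

(* Lebesgue integral over R^d of a function with values in \bar R, written as
   the iterated integral over the coordinates (Tonelli; used only for
   nonnegative measurable integrands below). *)
Definition lebint {d : nat} (f : 'rV[R]_d -> \bar R) : \bar R :=
  foldr (fun i (F : 'rV[R]_d -> \bar R) =>
           fun x => \int[@lebesgue_measure R]_t F (upd x i t))
        f (enum 'I_d) 0%R.

Definition grad {d : nat} (V : 'rV[R]_d -> R) (x : 'rV[R]_d) : 'rV[R]_d :=
  \row_i ('D_(delta_mx ord0 i) V x).

Definition mconvex {d : nat} (m : R) (V : 'rV[R]_d -> R) : Prop :=
  forall (x y : 'rV[R]_d) (t : R), (0 <= t <= 1)%R ->
    (V (t *: x + (1 - t) *: y) <=
     t * V x + (1 - t) * V y - m / 2 * t * (1 - t) * enorm (x - y) ^+ 2)%R.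

Definition is_prox {d : nat} (U : 'rV[R]_d -> R) (lam : R) (x p : 'rV[R]_d) : Prop :=
  forall z, (U p + enorm (x - p) ^+ 2 / (2 * lam) <=
             U z + enorm (x - z) ^+ 2 / (2 * lam))%R.
Definition prox {d : nat} (U : 'rV[R]_d -> R) (lam : R) (x : 'rV[R]_d) : 'rV[R]_d :=
  xget x [set p | is_prox U lam x p].

Definition myula_mean {d : nat} (V U : 'rV[R]_d -> R) (kappa gamma : R)
    (x : 'rV[R]_d) : 'rV[R]_d :=
  (x - gamma *: grad V x - kappa^-1 *: (x - prox U (gamma * kappa) x))%R.

Definition gauss_density {d : nat} (mu : 'rV[R]_d) (s2 : R) (y : 'rV[R]_d) : R :=
  ((Num.sqrt (2 * pi * s2))^-1 ^+ d * expR (- enorm (y - mu) ^+ 2 / (2 * s2)))%R.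

(* MYULA kernel R^kappa_{gamma}(x, .) = N(myula_mean x, 2 gamma I_d), acting on
   nonnegative functions:  (K g)(x) = \int g(y) R(x, dy) *)
Definition myula_op {d : nat} (V U : 'rV[R]_d -> R) (kappa gamma : R)
    (g : 'rV[R]_d -> \bar R) (x : 'rV[R]_d) : \bar R :=
  lebint (fun y => g y * (gauss_density (myula_mean V U kappa gamma x)
                                        (2 * gamma) y)%:E).

(* \int f d(delta_x K^n) for a real valued f, as  K^n f^+ (x) - K^n f^- (x) *)
Definition myula_iter_int {d : nat} (V U : 'rV[R]_d -> R) (kappa gamma : R)
    (n : nat) (f : 'rV[R]_d -> R) (x : 'rV[R]_d) : \bar R :=
  iter n (myula_op V U kappa gamma) (fun y => (Num.max (f y) 0)%:E) x
  - iter n (myula_op V U kappa gamma) (fun y => (Num.max (- f y) 0)%:E) x.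

Definition myula_invariant {d : nat} (V U : 'rV[R]_d -> R) (kappa gamma : R)
    (P : probability 'rV[R]_d R) : Prop :=
  forall A : set 'rV[R]_d, measurable A ->
    P A = \int[P]_x myula_op V U kappa gamma (fun y => (\1_A y)%:E) x.

(* the W-norm of a finite signed measure xi, given through its integration
   functional f |-> \int f d xi :
   ||xi||_W = sup { |\int f dxi| : f measurable, sup_x |f x|/W x <= 1 } *)
Definition Wnorm {d : nat} (W : 'rV[R]_d -> R)
    (xi : ('rV[R]_d -> R) -> \bar R) : \bar R :=
  ereal_sup [set `| xi f | | f in
     [set f : 'rV[R]_d -> R | measurable_fun setT f /\
                              forall x, (`|f x| <= W x)%R]].

Definition Wq {d : nat} (q : nat) (x : 'rV[R]_d) : R := (1 + enorm x ^+ (2 * q))%R.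
Definition Walpha {d : nat} (alpha : R) (x : 'rV[R]_d) : R :=
  expR (alpha * Num.sqrt (1 + enorm x ^+ 2))%R.

End MYULA_defs.

(* Main.v *)
(** The mean map T of the kernel N(T x, 2 gamma I) is nonexpansive: the gradient
    step is cocoercive (Baillon-Haddad), the proximal step is firmly
    nonexpansive, and gamma L <= 2 - 1/kappa balances the two.  Nonexpansiveness
    gives a dimension-free Harnack inequality (Wang) for the n-step kernel with
    constant exp(|x - y|^2 / (2 gamma n)), hence a minorization on bounded sets
    after about 1/gamma steps that is uniform in theta, kappa and gamma.  Convexity
    bounds the growth of |T x|^2, and a Gaussian computation turns this bound into
    a drift condition for exp(Psi(N + |x|^2)) with Psi concave: Psi r = a q ln r
    under H2 and Psi r = a alpha sqrt r under H3, which is equivalent to W^a in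
    both cases.  Harris' theorem for the (ceil (1/gamma))-step kernel, in the
    quantitative form of Hairer and Mattingly, concludes. *)

Require Import Defs.
From HB Require Import structures.
From mathcomp Require Import all_boot all_order all_algebra.
From mathcomp Require Import all_classical all_reals all_analysis.
From mathcomp Require Import measurable_realfun ring lra zify.
Import Order.TTheory GRing.Theory Num.Theory.
Import numFieldNormedType.Exports.
Local Open Scope classical_set_scope.
Local Open Scope ring_scope.

Set Implicit Arguments. Unset Strict Implicit. Unset Printing Implicit Defensive.

(** * Markov operators as positive functionals *)

Section positive_functionals.
Context {dsp : measure_display} {T : measurableType dsp} {R : realType}.
Local Open Scope ereal_scope.

(** The theorem describes the kernels by iterated coordinate integrals and not by measures.
    Operators are therefore treated as positive, monotone-continuous functionals, and a
    representation theorem turns every law of the chain into a probability measure.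

    The obstacle is uniformity in gamma: one step contracts by 1 - O(gamma), adds O(gamma), and its
    minorization constant degenerates with gamma. The estimates are arranged to depend only on the
    elapsed time (number of steps times gamma), which is kept in [1, 1 + gbar] for one block.

    Concavity of Psi makes the Gaussian average explicit: the tangent line at the mean bounds the
    integrand by a quadratic exponential, and one completes the square. The shift N makes the slope
    of Psi small, so that the integral converges for all steps up to gbar and the noise terms cost
    at most half of the drift. As Psi contains the exponent a, W^a has a drift inequality of its
    own. *)

Definition mnn (f : T -> \bar R) : Prop :=
  measurable_fun setT f /\ forall x, 0 <= f x.

(** The axioms of a Daniell-type integral on nonnegative functions; monotone continuity [pf_lim] is
    what makes the values on sets countably additive. *)
Record posfun (I : (T -> \bar R) -> \bar R) : Prop := {
  pf_ge0 : forall f, (forall x, 0 <= f x) -> 0 <= I f ;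
  pf_le : forall f g, mnn f -> mnn g -> (forall x, f x <= g x) -> I f <= I g ;
  pf_scale : forall (k : R) f, (0 <= k)%R -> mnn f ->
    I (fun x => k%:E * f x) = k%:E * I f ;
  pf_add : forall f g, mnn f -> mnn g -> I (fun x => f x + g x) = I f + I g ;
  pf_lim : forall g : nat -> T -> \bar R, (forall n, mnn (g n)) ->
    (forall x, nondecreasing_seq (g ^~ x)) ->
    I (fun x => limn (g ^~ x)) = limn (fun n => I (g n)) }.

Lemma mnn_cst (k : R) : (0 <= k)%R -> mnn (fun _ => k%:E).
Proof. by move=> k0; split=> [|x]; [exact: measurable_cst|rewrite lee_fin]. Qed.

Lemma mnn_indic (A : set T) : measurable A -> mnn (fun x => (\1_A x)%:E).
Proof.
move=> mA; split=> [|x]; last by rewrite lee_fin.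
exact/measurable_EFinP/measurable_indic.
Qed.

Lemma mnn_scale (k : R) f : (0 <= k)%R -> mnn f -> mnn (fun x => k%:E * f x).
Proof.
move=> k0 [mf f0]; split=> [|x]; first exact: measurable_funeM.
by rewrite mule_ge0// lee_fin.
Qed.

Lemma mnn_add f g : mnn f -> mnn g -> mnn (fun x => f x + g x).
Proof.
move=> [mf f0] [mg g0]; split=> [|x]; first exact: emeasurable_funD.
by rewrite adde_ge0.
Qed.

Lemma mnn_sum (J : Type) (s : seq J) (F : J -> T -> \bar R) :
  (forall j, mnn (F j)) -> mnn (fun x => \sum_(j <- s) F j x).
Proof.
move=> F0; split=> [|x].
  by apply: emeasurable_sum => j; exact: (F0 j).1.
by apply: sume_ge0 => j _; exact: (F0 j).2.
Qed.

Section representation.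
Variables (I : (T -> \bar R) -> \bar R) (hI : posfun I).

Lemma posfun0 : I (fun=> 0) = 0.
Proof.
have := pf_scale hI (lexx 0%R) (mnn_cst ler01).
by rewrite !mul0e.
Qed.

Lemma posfun_sum (J : Type) (s : seq J) (F : J -> T -> \bar R) :
  (forall j, mnn (F j)) ->
  I (fun x => \sum_(j <- s) F j x) = \sum_(j <- s) I (F j).
Proof.
move=> F0; elim: s => [|j s ih].
  by rewrite big_nil -[RHS]posfun0; congr I; apply/funext => x; rewrite big_nil.
rewrite big_cons -ih -pf_add//; last exact: mnn_sum.
by congr I; apply/funext => x; rewrite big_cons.
Qed.

Definition posfun_measure (A : set T) : \bar R := I (fun x => (\1_A x)%:E).

Let pm0 : posfun_measure set0 = 0.
Proof.
by rewrite /posfun_measure -[RHS]posfun0; congr I; apply/funext => x; rewrite indic0.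
Qed.

Let pm_ge0 A : 0 <= posfun_measure A.
Proof. by apply: (pf_ge0 hI) => x; rewrite lee_fin. Qed.

Let pm_sigma : semi_sigma_additive posfun_measure.
Proof.
move=> F mF tF mUF; rewrite /posfun_measure.
pose g n x : \bar R := \sum_(0 <= i < n) (\1_(F i) x)%:E.
have mg n : mnn (g n) by apply: mnn_sum => i; exact: mnn_indic.
have ndg x : nondecreasing_seq (g ^~ x).
  by move=> i j ij; apply: lee_sum_nneg_natr => // k _ _; rewrite lee_fin.
(* By disjointness at most one term is nonzero at each point, so the partial sums are eventually
   constant there. *)
have -> : (fun x => (\1_(\bigcup_n F n) x)%:E) = (fun x => limn (g ^~ x)).
  apply/funext => x; apply/esym/cvg_lim => //.
  rewrite indicE; case: (pselect ((\bigcup_n F n) x)) => [[k _ Fkx]|nF].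
    rewrite mem_set; last by exists k.
    apply: cvg_near_cst; exists k.+1 => //= n /= kn.
    rewrite /g (bigD1_seq k) ?mem_index_iota ?iota_uniq//= indicE mem_set//.
    rewrite big1 ?adde0// => i ik; rewrite indicE memNset// => Fix.
    by move/eqP: ik; apply; apply: tF => //; exists x.
  rewrite memNset//; apply: cvg_near_cst; near=> n.
  rewrite /g big1// => i _; rewrite indicE memNset// => Fix.
  by apply: nF; exists i.
rewrite (pf_lim hI)//.
rewrite [X in X @ _ --> _](_ : _ = fun n => I (g n)); last first.
  by apply/funext => n; rewrite posfun_sum// => i; exact: mnn_indic.
apply: ereal_nondecreasing_is_cvgn => i j ij.
by apply: (pf_le hI) => // x; exact: ndg.
Unshelve. all: by end_near. Qed.

HB.instance Definition _ :=
  isMeasure.Build _ _ _ posfun_measure pm0 pm_ge0 pm_sigma.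

Import HBNNSimple.

Lemma posfun_nnsfun (h : {nnsfun T >-> R}) :
  I (EFin \o h) = sintegral posfun_measure h.
Proof.
(* [posfun_sum] wants every summand nonnegative, also at reals [y] outside the range of [h];
   [Num.max y 0] agrees with [y] on the range. *)
rewrite sintegralE fsbig_finite//= (_ : EFin \o h = fun x =>
   \sum_(y <- finmap.enum_fset (fset_set (range h)))
     (Num.max y 0)%:E * (\1_(h @^-1` [set y]) x)%:E).
  rewrite posfun_sum; last first.
    move=> y; apply: mnn_scale; first by rewrite le_max lexx orbT.
    by apply: mnn_indic; exact: measurable_sfunP.
  apply: eq_big_seq => y; rewrite in_fset_set// inE => -[x _ <-].
  rewrite pf_scale//; last 2 first.
  - by rewrite le_max lexx orbT.
  - by apply: mnn_indic; exact: measurable_sfunP.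
  by congr (_%:E * _); apply/max_idPl.
apply/funext => x /=; rewrite {1}fimfunE fsbig_finite//= -sumEFin.
apply: eq_big_seq => y; rewrite in_fset_set// inE => -[z _ <-].
by rewrite EFinM; congr (_%:E * _); apply/esym/max_idPl.
Qed.

Lemma posfun_integral f : mnn f -> I f = \int[posfun_measure]_x f x.
Proof.
move=> [mf f0].
pose h := nnsfun_approx measurableT mf.
have ndh x : nondecreasing_seq ((fun n => EFin \o h n)^~ x).
  by move=> m n mn; rewrite lee_fin; exact/lefP/nd_nnsfun_approx.
have nnh n : mnn (EFin \o h n).
  by split=> [|x]; [exact/measurable_EFinP|rewrite lee_fin].
have -> : f = fun x => limn ((fun n => EFin \o h n)^~ x).
  by apply/funext => x; apply/esym/cvg_lim => //; exact: cvg_nnsfun_approx.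
rewrite (pf_lim hI)// monotone_convergence//; last 2 first.
- by move=> n; exact: (nnh n).1.
- by move=> n x _; exact: (nnh n).2.
by apply: congr_lim; apply/funext => n; rewrite posfun_nnsfun integralT_nnsfun.
Qed.

Lemma posfun_repr : exists m : {measure set T -> \bar R},
  (forall A, m A = I (fun x => (\1_A x)%:E)) /\
  forall f, mnn f -> I f = \int[m]_x f x.
Proof.
by exists posfun_measure; split=> // f mf; rewrite posfun_integral.
Qed.

Lemma posfun_probability : I (fun=> 1) = 1 ->
  exists P : probability T R, forall f, mnn f -> I f = \int[P]_x f x.
Proof.
move=> I1.
have mT : posfun_measure setT = 1.
  by rewrite /posfun_measure -[RHS]I1; congr I; apply/funext => x; rewrite indicT.
pose h := Measure_isProbability.Build _ _ _ posfun_measure mT.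
pose P : probability T R := HB.pack posfun_measure h.
exists P => f mf; rewrite posfun_integral//.
Qed.

End representation.

Lemma posfun_measure_integral (m : {measure set T -> \bar R}) :
  posfun (fun f => \int[m]_x f x).
Proof.
split=> [f f0|f g [mf f0] [mg g0] fg|k f k0 [mf f0]|f g [mf f0] [mg g0]|g mg ndg].
- exact: integral_ge0.
- exact: ge0_le_integral.
- exact: ge0_integralZl_EFin.
- exact: ge0_integralD.
- apply: monotone_convergence => //.
  + by move=> n; exact: (mg n).1.
  + by move=> n x _; exact: (mg n).2.
Qed.

(** Serves to pass from sets to functions, for the translation invariance of Lebesgue measure and
    for the stationary law. *)
Lemma posfun_integral_ext I (m : {measure set T -> \bar R}) : posfun I ->
  (forall A, measurable A -> I (fun x => (\1_A x)%:E) = m A) ->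
  forall f, mnn f -> I f = \int[m]_x f x.
Proof.
move=> hI Im f mf; rewrite (posfun_integral hI)//.
by apply: eq_measure_integral => A mA _; exact: Im.
Qed.

End positive_functionals.

Section precomposition.
Context {d1 d2 : measure_display} {T1 : measurableType d1}
  {T2 : measurableType d2} {R : realType}.

Lemma mnn_comp (f : T2 -> \bar R) (phi : T1 -> T2) :
  measurable_fun setT phi -> mnn f -> mnn (fun x => f (phi x)).
Proof. by move=> mphi [mf f0]; split=> //; exact: measurableT_comp. Qed.

Lemma posfun_precomp (I : (T1 -> \bar R) -> \bar R) (phi : T1 -> T2) :
  measurable_fun setT phi -> posfun I ->
  posfun (fun f : T2 -> \bar R => I (fun x => f (phi x))).
Proof.
move=> mphi hI; split=> [f f0|f g mf mg fg|k f k0 mf|f g mf mg|g mg ndg].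
- exact: (pf_ge0 hI).
- by apply: (pf_le hI) => //; exact: mnn_comp.
- by rewrite -(pf_scale hI)//; exact: mnn_comp.
- by rewrite -(pf_add hI)//; exact: mnn_comp.
- by rewrite -(pf_lim hI)// => n; exact: mnn_comp.
Qed.

End precomposition.

Section markov_operators.
Context {dsp : measure_display} {T : measurableType dsp} {R : realType}.
Local Open Scope ereal_scope.

Record pos_op (K : (T -> \bar R) -> T -> \bar R) : Prop := {
  po_pos : forall x, posfun (fun f => K f x) ;
  po_meas : forall f, mnn f -> measurable_fun setT (K f) }.

Record markov_op (K : (T -> \bar R) -> T -> \bar R) : Prop := {
  mo_op :> pos_op K ;
  mo_one : forall x, K (fun=> 1) x = 1 }.

Lemma po_mnn K f : pos_op K -> mnn f -> mnn (K f).
Proof.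
move=> hK mf; split=> [|x]; first exact: po_meas.
by apply: (pf_ge0 (po_pos hK x)) => y; exact: mf.2.
Qed.

Lemma posfun_comp I K : posfun I -> pos_op K -> posfun (fun f => I (K f)).
Proof.
move=> hI hK.
split=> [f f0|f g mf mg fg|k f k0 mf|f g mf mg|g mg ndg].
- by apply: (pf_ge0 hI) => y; exact: (pf_ge0 (po_pos hK y)).
- apply: (pf_le hI); [exact: po_mnn|exact: po_mnn|move=> y].
  exact: (pf_le (po_pos hK y)).
- rewrite -(pf_scale hI)//; last exact: po_mnn.
  by congr I; apply/funext => y; exact: (pf_scale (po_pos hK y)).
- rewrite -(pf_add hI); [|exact: po_mnn|exact: po_mnn].
  by congr I; apply/funext => y; exact: (pf_add (po_pos hK y)).
- rewrite -(pf_lim hI).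
  + by congr I; apply/funext => y; exact: (pf_lim (po_pos hK y)).
  + by move=> n'; exact: po_mnn.
  + move=> y i j ij; apply: (pf_le (po_pos hK y)) => // z.
    exact: ndg.
Qed.

Lemma markov_op_iter K n : markov_op K -> markov_op (iter n K).
Proof.
move=> hK; elim: n => [|n ih].
  by split=> //=; split=> //= f [].
split=> [|x] /=; last first.
  rewrite -[RHS](mo_one hK x); congr K; apply/funext => y; exact: (mo_one ih).
split=> [x|f mf].
- exact: posfun_comp (po_pos hK x) ih.
- exact: (po_meas hK (po_mnn ih mf)).
Qed.

(** The laws are picked point by point with choice, so nothing is claimed about measurability in
    [x]; where it matters it is read off from [iter n K f]. *)
Lemma markov_op_kernels K : markov_op K ->
  exists mu : nat -> T -> probability T R,
    forall n x f, mnn f -> iter n K f x = \int[mu n x]_z f z.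
Proof.
move=> hK.
have H n x : exists P : probability T R,
    forall f, mnn f -> iter n K f x = \int[P]_z f z.
  have hn := markov_op_iter n hK.
  exact: (posfun_probability (po_pos hn x) (mo_one hn x)).
have /choice[mu Hmu] : forall nx : nat * T, exists P : probability T R,
    forall f, mnn f -> iter nx.1 K f nx.2 = \int[P]_z f z by move=> [n x]; exact: H.
by exists (fun n x => mu (n, x)) => n x; exact: (Hmu (n, x)).
Qed.

End markov_operators.

(** * Harris' theorem *)

Section expectations.
Context {dsp : measure_display} {T : measurableType dsp} {R : realType}.
Variable W : T -> R.
Hypotheses (mW : measurable_fun setT W) (W1 : forall x, 1 <= W x).

(** The test functions: under a law with [Wfinite] their expectations are finite, so that real
    arithmetic replaces extended arithmetic. *)
Definition dominated (f : T -> R) : Prop :=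
  measurable_fun setT f /\ exists C, forall x, `|f x| <= C * W x.

Let W0 x : 0 <= W x. Proof. exact: le_trans (W1 x). Qed.

Lemma mnn_W : mnn (EFin \o W).
Proof.
by split=> [|x]; [exact/measurable_EFinP|rewrite lee_fin].
Qed.

Lemma dominated_W : dominated W.
Proof. by split=> //; exists 1 => x; rewrite mul1r ger0_norm. Qed.

Lemma dominated_cst c : dominated (fun=> c).
Proof.
split; first exact: measurable_cst.
by exists `|c| => x; rewrite ler_peMr.
Qed.

Lemma dominatedD f g : dominated f -> dominated g ->
  dominated (fun x => f x + g x).
Proof.
move=> [mf [C fC]] [mg [C' gC]]; split; first exact: measurable_funD.
exists (C + C') => x; rewrite mulrDl (le_trans (ler_normD _ _))//.
exact: lerD.
Qed.

Lemma dominatedZ (k : R) f : dominated f -> dominated (fun x => k * f x).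
Proof.
move=> [mf [C fC]]; split; first exact: measurable_funM.
by exists (`|k| * C) => x; rewrite normrM -mulrA ler_wpM2l.
Qed.

Lemma dominatedB f g : dominated f -> dominated g ->
  dominated (fun x => f x - g x).
Proof.
move=> df /(dominatedZ (-1)) dg.
have := dominatedD df dg; congr dominated.
by apply/funext => x; rewrite mulN1r.
Qed.

Lemma dominated_le (f g : T -> R) : measurable_fun setT f -> dominated g ->
  (forall x, `|f x| <= `|g x|) -> dominated f.
Proof.
move=> mf [_ [C gC]] fg; split=> //; exists C => x.
exact: le_trans (gC x).
Qed.

Definition Wfinite (P : probability T R) : Prop :=
  (\int[P]_x (W x)%:E < +oo)%E.

Lemma dominated_integrable (P : probability T R) f :
  Wfinite P -> dominated f -> P.-integrable setT (EFin \o f).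
Proof.
move=> PW [mf [C fC]].
have iW : P.-integrable setT (EFin \o W).
  apply/integrableP; split; first exact/measurable_EFinP.
  by under eq_integral do rewrite /= ger0_norm//.
apply: (@le_integrable _ _ _ P setT measurableT _ (fun x => `|C|%:E * (W x)%:E)%E).
- exact/measurable_EFinP.
- move=> x _ /=; rewrite lee_fin normrM normr_id (ger0_norm (W0 x)).
  by apply: le_trans (fC x) _; rewrite ler_wpM2r// ler_norm.
- exact: integrableZl.
Qed.

Section linear.
Variables (P : probability T R) (PW : Wfinite P).

Lemma expectD f g : dominated f -> dominated g ->
  \int[P]_x (f x + g x) = \int[P]_x f x + \int[P]_x g x.
Proof. by move=> df dg; rewrite RintegralD//; exact: dominated_integrable. Qed.

Lemma expectB f g : dominated f -> dominated g ->
  \int[P]_x (f x - g x) = \int[P]_x f x - \int[P]_x g x.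
Proof. by move=> df dg; rewrite RintegralB//; exact: dominated_integrable. Qed.

Lemma expectZ (k : R) f : dominated f ->
  \int[P]_x (k * f x) = k * \int[P]_x f x.
Proof. by move=> df; rewrite RintegralZl//; exact: dominated_integrable. Qed.

Lemma expect_cst (k : R) : \int[P]_x k = k.
Proof.
by rewrite Rintegral_cst// (_ : _ setT = 1%E) ?mulr1//; exact: (@probability_setT _ _ _ P).
Qed.

Lemma expect_le f g : dominated f -> dominated g -> (forall x, f x <= g x) ->
  \int[P]_x f x <= \int[P]_x g x.
Proof.
by move=> df dg fg; apply: le_Rintegral => //; exact: dominated_integrable.
Qed.

Lemma expect_EFin f : dominated f ->
  (\int[P]_x (f x)%:E = (\int[P]_x f x)%:E)%E.
Proof.
move=> df; rewrite /Rintegral fineK//.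
exact: (integrable_fin_num _ (dominated_integrable PW df)).
Qed.

Lemma expect_norm_le f (C : R) : dominated f -> (forall x, `|f x| <= C * W x) ->
  `|\int[P]_x f x| <= C * \int[P]_x W x.
Proof.
move=> df fC; apply: le_trans (le_normr_Rintegral _ _) _ => //.
  exact: dominated_integrable.
rewrite -expectZ; last exact: dominated_W.
apply: expect_le => //; last exact/dominatedZ/dominated_W.
apply: (dominated_le _ df) => [|x]; last by rewrite normr_id.
by apply: measurableT_comp => //; exact: df.1.
Qed.

End linear.

Lemma Wfinite_le (P : probability T R) (c : R) :
  (\int[P]_x (W x)%:E <= c%:E)%E -> Wfinite P /\ \int[P]_x W x <= c.
Proof.
move=> Pc; have PW : Wfinite P by apply: le_lt_trans Pc _; rewrite ltry.
by split=> //; rewrite -lee_fin -expect_EFin//; exact: dominated_W.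
Qed.

Section tower.
Variables (P Q : probability T R) (k : T -> probability T R).
Hypothesis mk : forall f : T -> \bar R, mnn f ->
  measurable_fun setT (fun z => \int[k z]_x f x)%E.
Hypothesis PkQ : forall f : T -> \bar R, mnn f ->
  (\int[Q]_x f x = \int[P]_z \int[k z]_x f x)%E.
Hypotheses (PW : Wfinite P) (QW : Wfinite Q) (C : R).
Hypothesis kW : forall z, (\int[k z]_x (W x)%:E <= (C * W z)%:E)%E.

Let kWf z : Wfinite (k z). Proof. exact: (Wfinite_le (kW z)).1. Qed.

Lemma expect_kernel_dominated f : dominated f ->
  dominated (fun z => \int[k z]_x f x).
Proof.
move=> df; have [mf [D fD]] := df; split.
  apply: measurableT_comp => //.
  have -> : (fun z => \int[k z]_x (f x)%:E)%E =
      (fun z => \int[k z]_x ((EFin \o f)^\+ x) - \int[k z]_x ((EFin \o f)^\- x))%E.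
    by apply/funext => z; rewrite integralE.
  apply: emeasurable_funB; apply: mk; split=> //.
  - by apply: measurable_funepos; exact/measurable_EFinP.
  - by apply: measurable_funeneg; exact/measurable_EFinP.
exists (`|D| * `|C|) => z; apply: le_trans (expect_norm_le (kWf z) df fD) _.
have h : \int[k z]_x W x <= C * W z := (Wfinite_le (kW z)).2.
have E0 : 0 <= \int[k z]_x W x by apply: Rintegral_ge0 => x _; exact: W0.
apply: (@le_trans _ _ (`|D| * \int[k z]_x W x)).
  by apply: ler_wpM2r => //; exact: ler_norm.
rewrite -mulrA ler_wpM2l//; apply: le_trans h _.
by rewrite ler_wpM2r// ler_norm.
Qed.

Let tower_ge0 (f : T -> R) : dominated f -> (forall x, 0 <= f x) ->
  \int[Q]_x f x = \int[P]_z \int[k z]_x f x.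
Proof.
move=> df f0; rewrite {1}/Rintegral PkQ; last first.
  by split=> [|x]; [exact/measurable_EFinP/df.1|rewrite lee_fin].
congr fine; apply: eq_integral => z _.
by rewrite expect_EFin.
Qed.

Lemma expect_tower (f : T -> R) : dominated f ->
  \int[Q]_x f x = \int[P]_z \int[k z]_x f x.
Proof.
move=> df.
have dp : dominated (fun x => Num.max (f x) 0).
  apply: (dominated_le _ df) => [|x].
    by apply: measurable_maxr; [exact: df.1|exact: measurable_cst].
  rewrite ger0_norm ?le_max ?lexx ?orbT//.
  by rewrite ge_max ler_norm normr_ge0.
have dn : dominated (fun x => Num.max (- f x) 0).
  apply: (dominated_le _ df) => [|x].
    apply: measurable_maxr; last exact: measurable_cst.
    by apply: measurableT_comp => //; exact: df.1.
  rewrite ger0_norm ?le_max ?lexx ?orbT//.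
  by rewrite ge_max -normrN ler_norm normr_ge0.
have -> : f = fun x => Num.max (f x) 0 - Num.max (- f x) 0.
  apply/funext => x; case: (leP 0 (f x)) => h.
    by rewrite max_r ?subr0// oppr_le0.
  by rewrite max_l ?sub0r ?opprK// oppr_ge0 ltW.
rewrite expectB// !tower_ge0//; try by move=> x; rewrite le_max lexx orbT.
rewrite -expectB//; [|exact: expect_kernel_dominated..].
by apply: eq_Rintegral => z _; rewrite expectB.
Qed.

End tower.

Section harris_step.
Variables (lam b beta r eps Rad : R).
Hypotheses (beta0 : 0 <= beta) (r0 : 0 <= r).
Hypothesis large : forall S, Rad <= S ->
  2 + beta * (lam * S + 2 * b) <= r * (2 + beta * S).
Hypothesis small : forall S, 2 <= S ->
  2 * (1 - eps) + beta * (lam * S + 2 * b) <= r * (2 + beta * S).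

(* Hairer--Mattingly: contraction of the oscillation seminorm for the
   distance 2 + beta W(x) + beta W(y). *)
Lemma harris_step (P Q : probability T R) (x y : T) (s : R) (f : T -> R) :
  Wfinite P -> Wfinite Q ->
  \int[P]_z W z <= lam * W x + b -> \int[Q]_z W z <= lam * W y + b ->
  (W x + W y <= Rad -> forall g : T -> R, measurable_fun setT g ->
     (forall z, 0 <= g z <= 1) ->
     \int[P]_z g z <= \int[Q]_z g z + (1 - eps)) ->
  dominated f -> 0 < s ->
  (forall z z', f z - f z' <= s * (2 + beta * (W z + W z'))) ->
  \int[P]_z f z - \int[Q]_z f z <= r * (s * (2 + beta * (W x + W y))).
Proof.
move=> PW QW DP DQ mino df s0 osc.
(* The oscillation bound amounts to a weighted sup bound up to a constant: with [c] the supremum of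
   [A], [f] lies between [c - s (1 + beta W)] and [c + s (1 + beta W)]. *)
pose A := range (fun z => f z - s * (1 + beta * W z)).
have ubA z' : ubound A (f z' + s * (1 + beta * W z')).
  move=> _ [z _ <-]; have := osc z z'; nra.
pose c := sup A.
have cub z : f z - s * (1 + beta * W z) <= c.
  apply: ub_le_sup; last by exists z.
  by exists (f x + s * (1 + beta * W x)); exact: ubA.
have clb z : c <= f z + s * (1 + beta * W z).
  apply: ge_sup; last exact: ubA.
  by exists (f x - s * (1 + beta * W x)); exists x.
(* Truncation at level [s] separates a bounded part, on which the minorization acts, from a
   remainder of size at most [s beta W], on which the drift acts. *)
pose g z := Num.max (- s) (Num.min s (f z - c)).
have g_le z : - s <= g z <= s.
  rewrite /g le_max lexx/= ge_max; apply/andP; split; first by lra.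
  by rewrite ge_min lexx.
have gB z : `|f z - c - g z| <= s * beta * W z.
  have := cub z; have := clb z; have Wz := W0 z.
  have h : 0 <= s * beta * W z by rewrite !mulr_ge0// ltW.
  rewrite ler_norml /g; case: (leP s (f z - c)) => h1.
    by rewrite max_r; [|lra]; move=> *; apply/andP; split; lra.
  by case: (leP (- s) (f z - c)) => h2 *; apply/andP; split; lra.
have mg : measurable_fun setT g.
  apply: measurable_maxr => //; apply: measurable_minr => //.
  by apply: measurable_funB => //; exact: df.1.
have dg : dominated g.
  apply: (dominated_le mg (dominated_cst s)) => z.
  by rewrite (gtr0_norm s0) ler_norml.
have dc := dominated_cst c.
have dh : dominated (fun z => f z - c - g z) by do 2 apply: dominatedB => //.
have fE (M : probability T R) : Wfinite M ->
    \int[M]_z f z = c + \int[M]_z g z + \int[M]_z (f z - c - g z).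
  by move=> MW; rewrite !expectB ?expect_cst//; [ring|exact: dominatedB].
rewrite !fE//.
have hP := expect_norm_le PW dh gB.
have hQ := expect_norm_le QW dh gB.
move: hP hQ; rewrite !ler_norml => /andP[_ hP] /andP[hQ _].
have sb : 0 <= s * beta by rewrite mulr_ge0// ltW.
set S := W x + W y.
have S2 : 2 <= S by rewrite /S; have := W1 x; have := W1 y; lra.
have hPQ : s * beta * \int[P]_z W z + s * beta * \int[Q]_z W z <=
    s * (beta * (lam * S + 2 * b)).
  rewrite -mulrDr -mulrA ler_pM2l// ler_wpM2l// /S; lra.
have gs (M : probability T R) : Wfinite M -> - s <= \int[M]_z g z <= s.
  move=> MW; rewrite -{1}(expect_cst M (- s)) -{2}(expect_cst M s).
  by apply/andP; split; apply: expect_le => //;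
     [exact: dominated_cst|move=> z; have /andP[] := g_le z
     |exact: dominated_cst|move=> z; have /andP[] := g_le z].
case: (leP S Rad) => SR.
- have : \int[P]_z g z - \int[Q]_z g z <= s * (2 * (1 - eps)).
    have := mino SR (fun z => (2 * s)^-1 * (g z + s)).
    have d2 : dominated (fun z => g z + s) by exact: (dominatedD dg (dominated_cst s)).
    rewrite !expectZ// !expectD ?expect_cst//; [|exact: dominated_cst..].
    move=> /(_ _ _)/wrap[].
      by apply: measurable_funM => //; exact: d2.1.
    move=> z; rewrite mulrC; apply/andP; split.
      by apply: divr_ge0; have := g_le z; lra.
    by rewrite ler_pdivrMr; [|lra]; have := g_le z; lra.
    move=> h.
    have s2 : 0 < 2 * s by lra.
    have K X : 2 * s * ((2 * s)^-1 * X) = X by rewrite mulVKf// gt_eqF.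
    by move: h; rewrite -(ler_pM2l s2) K [leRHS]mulrDr K; lra.
  have := ler_wpM2l (ltW s0) (small S2); nra.
- have := gs P PW; have := gs Q QW.
  have := ler_wpM2l (ltW s0) (large (ltW SR)); nra.
Qed.

End harris_step.
End expectations.

(** * Limits of probability measures, uniform over measurable sets *)

Section uniform_limit.
Context {dsp : measure_display} {T : measurableType dsp} {R : realType}.
Variables (mu : nat -> probability T R) (e : nat -> R).
Hypothesis e_small : forall x : R, 0 < x ->
  exists N, forall n, (N <= n)%N -> e n <= x.
Hypothesis mu_cauchy : forall n k A, measurable A ->
  fine (mu n A) - fine (mu k A) <= e n + e k.

(** The limit at [A] is taken as a supremum of lower estimates. By [mu_cauchy] every
    [fine (mu k A) + e k] is an upper bound, so the rate [e n] comes at once, uniformly in [A]. *)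
Let lowers (A : set T) := range (fun n => fine (mu n A) - e n).

(* The absolute value only matters on nonmeasurable sets. *)
Definition unif_lim (A : set T) : \bar R := (`|sup (lowers A)|)%:E.

Let lowers0 A : lowers A !=set0.
Proof. by exists (fine (mu 0 A) - e 0), 0. Qed.

Let unif_limP A n : measurable A ->
  `|fine (mu n A) - sup (lowers A)| <= e n.
Proof.
move=> mA.
have ub k : ubound (lowers A) (fine (mu k A) + e k).
  by move=> _ [i _ <-]; have := mu_cauchy i k mA; lra.
have h1 : fine (mu n A) - e n <= sup (lowers A).
  by apply: ub_le_sup; [exists (fine (mu 0 A) + e 0)|exists n].
have h2 : sup (lowers A) <= fine (mu n A) + e n by apply: ge_sup.
by rewrite ler_norml; apply/andP; split; lra.
Qed.

Let sup_ge0 A : measurable A -> 0 <= sup (lowers A).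
Proof.
move=> mA; apply/ler_addgt0Pr => x x0.
have [N hN] := e_small x0; have := unif_limP N mA; have := hN _ (leqnn N).
have : 0 <= fine (mu N A) by apply: fine_ge0.
by rewrite ler_norml => ? ? /andP[]; lra.
Qed.

Let ulE A : measurable A -> unif_lim A = (sup (lowers A))%:E.
Proof. by move=> mA; rewrite /unif_lim ger0_norm ?sup_ge0. Qed.

Let sup_setU A B : measurable A -> measurable B -> A `&` B = set0 ->
  sup (lowers (A `|` B)) = sup (lowers A) + sup (lowers B).
Proof.
move=> mA mB AB; apply/eqP; rewrite -subr_eq0 -normr_le0.
apply/ler_addgt0Pr => x x0.
have x3 : 0 < x / 3 by lra.
have [N hN] := e_small x3.
have e3 := hN _ (leqnn N).
have hA := unif_limP N mA; have hB := unif_limP N mB.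
have hU := unif_limP N (measurableU _ _ mA mB).
have mU : fine (mu N (A `|` B)) = fine (mu N A) + fine (mu N B).
  by rewrite measureU// fineD//; apply: fin_num_measure.
move: hA hB hU; rewrite mU !ler_norml => /andP[? ?] /andP[? ?] /andP[? ?].
by apply/andP; split; lra.
Qed.

Let tail (F : nat -> set T) k := \bigcup_i F (k + i)%N.

(** Stated for any finitely additive [m]: it is applied to a law [mu n] and, before countable
    additivity is known, to the limit. *)
Let tail_split (m : set T -> R) (F : nat -> set T) k :
  (forall A B, measurable A -> measurable B -> A `&` B = set0 ->
     m (A `|` B) = m A + m B) ->
  (forall i, measurable (F i)) -> trivIset setT F ->
  m (\bigcup_i F i) = \sum_(0 <= i < k) m (F i) + m (tail F k).
Proof.
move=> mD mF tF; elim: k => [|k ih].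
  by rewrite big_geq// add0r /tail.
rewrite ih big_nat_recr//= -addrA; congr +%R.
rewrite -mD//; last 2 first.
- by apply: bigcupT_measurable => i.
- rewrite -subset0 => x [Fkx [i _ Fx]].
  by have := tF _ _ I I (ex_intro _ x (conj Fkx Fx)); lia.
congr m; rewrite /tail; apply/seteqP; split=> x.
  move=> [[|i] _ Fx]; first by left; rewrite addn0 in Fx.
  by right; exists i => //; rewrite addSnnS.
move=> [Fkx|[i _ Fx]]; first by exists 0%N => //; rewrite addn0.
by exists i.+1 => //; rewrite -addSnnS.
Qed.

Let mu_tail n (F : nat -> set T) : (forall i, measurable (F i)) ->
  trivIset setT F -> forall x, 0 < x ->
  exists N, forall k, (N <= k)%N -> fine (mu n (tail F k)) <= x.
Proof.
move=> mF tF x x0.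
have mUF : measurable (\bigcup_i F i) by apply: bigcupT_measurable.
have : (fun k => \sum_(0 <= i < k) mu n (F i))%E @ \oo --> mu n (\bigcup_i F i).
  exact: (@measure_semi_sigma_additive _ _ _ (mu n) F mF tF mUF).
have -> : (fun k => \sum_(0 <= i < k) mu n (F i))%E =
    EFin \o (fun k => \sum_(0 <= i < k) fine (mu n (F i))).
  apply/funext => k /=; rewrite -sumEFin; apply: eq_bigr => i _.
  by rewrite fineK//; apply: fin_num_measure.
rewrite -(fineK (fin_num_measure (mu n) _ mUF)) => /fine_cvgP[_].
move=> /cvgrPdist_le/(_ _ x0)[N _ hN]; exists N => k Nk.
have := hN k Nk; rewrite /= (@tail_split (fun A => fine (mu n A)) F k)//.
  by rewrite addrAC subrr add0r; apply: le_trans; exact: ler_norm.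
move=> A B mA mB AB; rewrite measureU// fineD//; apply: fin_num_measure => //.
Qed.

Let ul0 : unif_lim set0 = 0%E.
Proof.
rewrite /unif_lim; congr EFin; apply/eqP; rewrite normr_eq0.
by have := sup_setU measurable0 measurable0 (setI0 _); rewrite setU0 => /eqP;
  rewrite -subr_eq subrr eq_sym.
Qed.

Let ul_ge0 A : (0 <= unif_lim A)%E. Proof. by rewrite lee_fin. Qed.

Let ul_sigma : semi_sigma_additive unif_lim.
Proof.
move=> F mF tF mUF; rewrite ulE//.
have -> : (fun k => \sum_(0 <= i < k) unif_lim (F i))%E =
    EFin \o (fun k => \sum_(0 <= i < k) sup (lowers (F i))).
  by apply/funext => k /=; rewrite -sumEFin; apply: eq_bigr => i _; rewrite ulE.
apply: cvg_EFin; first exact: nearW.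
apply/cvgrPdist_le => x x0.
have x2 : 0 < x / 2 by lra.
(* The index [n] is fixed first; the tails are then small for this one law, and the limit differs
   from it by at most [e n] on each of them. *)
have [n hn] := e_small x2; have [N hN] := mu_tail n mF tF x2.
exists N => // k /= Nk.
rewrite (@tail_split (fun A => sup (lowers A)) F k)//.
have mt : measurable (tail F k) by apply: bigcupT_measurable.
rewrite addrAC subrr add0r ger0_norm ?sup_ge0//.
have := hn _ (leqnn n); have := hN k Nk; have := unif_limP n mt.
by rewrite ler_norml => /andP[]; lra.
Qed.

HB.instance Definition _ := isMeasure.Build _ _ _ unif_lim ul0 ul_ge0 ul_sigma.

Let ulT : unif_lim setT = 1%E.
Proof.
rewrite ulE//; congr EFin; apply/eqP; rewrite eq_sym -subr_eq0 -normr_le0.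
apply/ler_addgt0Pr => x x0; have [N hN] := e_small x0.
have := hN _ (leqnn N); have := unif_limP N measurableT.
by rewrite probability_setT/=; lra.
Qed.

Lemma uniform_limit_probability : exists P : probability T R,
  forall n A, measurable A -> `|fine (mu n A) - fine (P A)| <= e n.
Proof.
pose h := Measure_isProbability.Build _ _ _ unif_lim ulT.
pose P : probability T R := HB.pack unif_lim h.
exists P => n A mA; have -> : P A = (sup (lowers A))%:E by rewrite -ulE.
exact: unif_limP.
Qed.

End uniform_limit.

Section uniform_limit_integral.
Context {dsp : measure_display} {T : measurableType dsp} {R : realType}.
Variables (mu : nat -> probability T R) (P : probability T R) (e : nat -> R).
Hypothesis e_small : forall x : R, 0 < x ->
  exists N, forall n, (N <= n)%N -> e n <= x.
Hypothesis mu_P : forall n A, measurable A ->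
  `|fine (mu n A) - fine (P A)| <= e n.
Import HBNNSimple.

(** Convergence on sets does not give convergence of integrals of unbounded functions, but bounds on
    simple functions below [g] survive the limit, as in Fatou's lemma. *)
Lemma uniform_limit_integral_le (g : T -> \bar R) (c : R) N : mnn g ->
  (forall n, (N <= n)%N -> \int[mu n]_x g x <= c%:E)%E ->
  (\int[P]_x g x <= c%:E)%E.
Proof.
move=> [mg g0] gc; rewrite ge0_integralTE//.
apply: ge_ereal_sup => _ [h /= hg <-].
have sE (M : probability T R) : sintegral M h =
   (\sum_(y <- finmap.enum_fset (fset_set (range h))) y * fine (M (h @^-1` [set y])))%:E.
  rewrite sintegralE fsbig_finite//= -sumEFin; apply: eq_bigr => y _.
  by rewrite EFinM fineK//; apply: fin_num_measure.
have hn n : (N <= n)%N -> (sintegral (mu n) h <= c%:E)%E.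
  move=> Nn; apply: le_trans (gc n Nn).
  rewrite -integralT_nnsfun; apply: ge0_le_integral => //.
  - by move=> x _; rewrite lee_fin.
  - exact/measurable_EFinP.
set F := finmap.enum_fset (fset_set (range h)) in sE.
(* [mu n] and [P] differ by at most [e n] on each level set, hence by [S e n] on the simple
   function; [S + 1] guards against [S = 0]. *)
pose S := \sum_(y <- F) `|y|.
rewrite sE lee_fin; apply/ler_addgt0Pr => x x0.
have S0 : 0 <= S by apply: sumr_ge0.
have xS : 0 < x / (S + 1) by rewrite divr_gt0//; lra.
have [N' hN'] := e_small xS.
pose n := maxn N N'.
have := hn n (leq_maxl _ _); rewrite sE lee_fin => h1.
have en : e n <= x / (S + 1) by apply: hN'; exact: leq_maxr.
have Se : S * e n <= x.
  apply: (@le_trans _ _ (S * (x / (S + 1)))); first exact: ler_wpM2l.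
  rewrite mulrCA ler_piMr//; first exact: ltW.
  by rewrite ler_pdivrMr; lra.
apply: le_trans (lerD h1 Se).
rewrite /S mulr_suml -big_split/=; apply: ler_sum => y _.
have mh : measurable (h @^-1` [set y]) by exact: measurable_sfunP.
have := mu_P n mh; set u := fine _; set v := fine _ => uv.
rewrite -lerBlDl -mulrBr; apply: le_trans (ler_norm _) _.
by rewrite normrM ler_wpM2l// distrC.
Qed.

End uniform_limit_integral.

(** [beta] is so small that the drift constant [2 b beta] uses up at most half of the gain [2 eps]
    of the minorization. [Rad] is so large that [2 b] is absorbed into [lam S], at the price of
    replacing [lam] by its midpoint with 1. *)
Lemma harris_constants (R : realType) (lam b eps Rad : R) :
  0 <= lam < 1 -> 0 <= b -> 0 < eps <= 1 -> 0 < Rad ->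
  4 * b <= (1 - lam) * Rad ->
  exists beta r : R, [/\ 0 < beta, 0 < r < 1,
    forall S, Rad <= S -> 2 + beta * (lam * S + 2 * b) <= r * (2 + beta * S) &
    forall S, 2 <= S ->
      2 * (1 - eps) + beta * (lam * S + 2 * b) <= r * (2 + beta * S)].
Proof.
move=> /andP[lam0 lam1] b0 /andP[eps0 eps1] Rad0 bRad.
pose beta := eps / (2 * b + 1).
have beta0 : 0 < beta by rewrite divr_gt0//; lra.
have betab : beta * (2 * b) <= eps.
  by rewrite /beta mulrAC ler_pdivrMr; [nra|lra].
pose lam' := (1 + lam) / 2.
(* The quotient [(2 + beta lam' S) / (2 + beta S)] decreases in [S], so its value at [Rad] bounds it
   whenever [Rad <= S]. *)
pose r1 := (2 + beta * lam' * Rad) / (2 + beta * Rad).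
have bR0 : 0 < beta * Rad by rewrite mulr_gt0.
have r1E : r1 * (2 + beta * Rad) = 2 + beta * lam' * Rad.
  by rewrite /r1 divfK// gt_eqF//; lra.
have r1lt : r1 < 1.
  rewrite /r1 ltr_pdivrMr; last by lra.
  have : beta * Rad * lam' < beta * Rad * 1 by rewrite ltr_pM2l// /lam'; lra.
  by nra.
pose r := Num.max r1 (Num.max (1 - eps / 2) lam').
have r_r1 : r1 <= r by rewrite le_max lexx.
have r_eps : 1 - eps / 2 <= r by rewrite !le_max lexx orbT.
have r_lam : lam' <= r by rewrite !le_max lexx !orbT.
exists beta, r; split=> //.
- apply/andP; split; first by apply: lt_le_trans r_eps; lra.
  by rewrite !gt_max r1lt/= /lam'; apply/andP; split; lra.
- move=> S SRad.
  have h1 : beta * (2 * b) <= beta * ((1 - lam) / 2 * S).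
    by rewrite ler_pM2l//; nra.
  have h2 : r1 * (2 + beta * Rad) <= r * (2 + beta * Rad).
    by rewrite ler_wpM2r//; lra.
  have h3 : 0 <= (r - lam') * (beta * (S - Rad)).
    by apply: mulr_ge0; [lra|apply: mulr_ge0; lra].
  rewrite /lam' in r1E h3 *; lra.
- move=> S S2.
  have h0 : 0 <= beta * S by rewrite mulr_ge0//; lra.
  have h1 : lam * (beta * S) <= r * (beta * S).
    by rewrite ler_wpM2r//; apply: le_trans r_lam; rewrite /lam'; lra.
  lra.
Qed.

Section harris.
Context {dsp : measure_display} {T : measurableType dsp} {R : realType}.

(** Convertible with [myula_iter_int] when [K] is [myula_op], as [invariant_prob] is with
    [myula_invariant]; the final proof relies on this. *)
Definition iter_int (K : (T -> \bar R) -> T -> \bar R) n (f : T -> R) x : \bar R :=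
  (iter n K (fun y => (Num.max (f y) 0)%:E) x
   - iter n K (fun y => (Num.max (- f y) 0)%:E) x)%E.

Definition invariant_prob (K : (T -> \bar R) -> T -> \bar R) (P : probability T R) :=
  forall A, measurable A -> P A = (\int[P]_x K (fun y => (\1_A y)%:E) x)%E.

Section one_kernel.
Variables (K : (T -> \bar R) -> T -> \bar R) (hK : markov_op K).
Variables (W : T -> R) (mW : measurable_fun setT W) (W1 : forall x, 1 <= W x).
Variables (lam b eps Rad beta r : R) (m : nat).
Hypotheses (lam01 : 0 <= lam < 1) (b0 : 0 <= b) (beta0 : 0 < beta).
Hypothesis r01 : 0 < r < 1.
Hypothesis large : forall S, Rad <= S ->
  2 + beta * (lam * S + 2 * b) <= r * (2 + beta * S).
Hypothesis small : forall S, 2 <= S ->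
  2 * (1 - eps) + beta * (lam * S + 2 * b) <= r * (2 + beta * S).
Hypothesis m0 : (0 < m)%N.
Hypothesis D1 : forall n x, (iter n K (EFin \o W) x <= (W x + b)%:E)%E.
Hypothesis D2 : forall x, (iter m K (EFin \o W) x <= (lam * W x + b)%:E)%E.
Hypothesis mino : forall x y, W x + W y <= Rad ->
  forall g : T -> R, measurable_fun setT g -> (forall z, 0 <= g z <= 1) ->
  (iter m K (EFin \o g) x <= iter m K (EFin \o g) y + (1 - eps)%:E)%E.
Variable x0 : T.
Variable mu : nat -> T -> probability T R.
Hypothesis muE : forall n x f, mnn f -> iter n K f x = (\int[mu n x]_z f z)%E.

Let W0 x : 0 <= W x. Proof. exact: le_trans (W1 x). Qed.
Let r0 : 0 < r. Proof. by case/andP: r01. Qed.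
Let r1 : r < 1. Proof. by case/andP: r01. Qed.

Let muW n x : Wfinite W (mu n x) /\ \int[mu n x]_z W z <= W x + b.
Proof. by apply: Wfinite_le => //; rewrite -(muE n x (mnn_W mW W1)); exact: D1. Qed.

Let mnn_pos (f : T -> R) : measurable_fun setT f ->
  mnn (fun y => (Num.max (f y) 0)%:E).
Proof.
move=> mf; split=> [|x]; last by rewrite lee_fin le_max lexx orbT.
by apply/measurable_EFinP; exact: measurable_maxr.
Qed.

Let iter_intE n x f : dominated W f ->
  iter_int K n f x = (\int[mu n x]_z f z)%:E.
Proof.
move=> df; rewrite /iter_int !muE; last 2 first.
- by apply: (@mnn_pos (fun y => - f y)); apply: measurableT_comp => //; exact: df.1.
- by apply: mnn_pos; exact: df.1.
rewrite -(expect_EFin mW W1 (muW n x).1 df) [RHS]integralE.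
by congr (_ - _)%E; apply: eq_integral => z _;
  rewrite ?funeposE ?funenegE EFin_max ?EFinN.
Qed.

Let mu0E x f : dominated W f -> \int[mu 0 x]_z f z = f x.
Proof.
move=> df; have := iter_intE 0 x df; rewrite /iter_int/= -EFinB => -[<-].
case: (leP 0 (f x)) => h; first by rewrite max_r ?subr0// oppr_le0.
by rewrite max_l ?sub0r ?opprK// oppr_ge0 ltW.
Qed.

Let mk n (f : T -> \bar R) : mnn f ->
  measurable_fun setT (fun z => \int[mu n z]_x f x)%E.
Proof.
move=> mf; have -> : (fun z => \int[mu n z]_x f x)%E = iter n K f.
  by apply/funext => z; rewrite muE.
exact: (po_meas (markov_op_iter n hK) mf).
Qed.

Let kW n z : (\int[mu n z]_x (W x)%:E <= ((1 + b) * W z)%:E)%E.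
Proof.
rewrite -(muE n z (mnn_W mW W1)); apply: le_trans (D1 n z) _.
by rewrite lee_fin mulrDl mul1r lerD2l ler_peMr.
Qed.

Let mu_dom n f : dominated W f -> dominated W (fun z => \int[mu n z]_x f x).
Proof. by move=> df; apply: (expect_kernel_dominated mW W1 (@mk n) (@kW n)). Qed.

Let mu_tower j n x f : dominated W f ->
  \int[mu (j + n) x]_z f z = \int[mu j x]_z \int[mu n z]_y f y.
Proof.
move=> df; apply: (expect_tower mW W1 (@mk n) _ (muW j x).1 (muW _ x).1 (@kW n)) => //.
move=> g mg; rewrite -muE// iterD muE; last exact: po_mnn (markov_op_iter n hK) mg.
by apply: eq_integral => z _; rewrite muE.
Qed.

(** A Lipschitz bound with constant [s] for the weighted discrete distance
    [2 + beta (W z + W z')]. *)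
Let osc (s : R) (f : T -> R) :=
  forall z z', f z - f z' <= s * (2 + beta * (W z + W z')).

Let osc_step s f : dominated W f -> 0 < s -> osc s f ->
  osc (r * s) (fun x => \int[mu m x]_z f z).
Proof.
move=> df s0 fs x y.
have DE z : \int[mu m z]_z W z <= lam * W z + b.
  by apply: (Wfinite_le mW W1 _).2; rewrite -(muE m z (mnn_W mW W1)); exact: D2.
rewrite -mulrA.
apply: (harris_step mW W1 (ltW beta0) large small (muW m x).1 (muW m y).1 (DE x) (DE y)) => //.
move=> SR g mg g01.
have dg : dominated W g.
  apply: (dominated_le mg (dominated_cst W1 1)) => z.
  by have := g01 z; rewrite normr1 ler_norml; lra.
have mng : mnn (EFin \o g).
  by split=> [|z]; [exact/measurable_EFinP|rewrite lee_fin; case/andP: (g01 z)].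
have := mino SR mg g01.
rewrite !muE// (expect_EFin mW W1 (muW m x).1 dg) (expect_EFin mW W1 (muW m y).1 dg).
by rewrite -EFinD lee_fin.
Qed.

Let osc_iter k s f : dominated W f -> 0 < s -> osc s f ->
  osc (r ^+ k * s) (fun x => \int[mu (k * m)%N x]_z f z).
Proof.
move=> df s0 fs; elim: k => [|k ih].
  by move=> z z'; rewrite mul0n !mu0E// expr0 mul1r.
have -> : (fun x => \int[mu (k.+1 * m)%N x]_z f z) =
    (fun x => \int[mu m x]_z \int[mu (k * m)%N z]_y f y).
  by apply/funext => x; rewrite mulSn mu_tower.
by rewrite exprS -mulrA; apply: osc_step => //; [exact: mu_dom|rewrite mulr_gt0// exprn_gt0].
Qed.

(** A function bounded by [(1 + b) W] has oscillation constant [(1 + b) / beta], and [2 <= S] turns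
    [(2 + beta S) / beta] into at most [(beta^-1 + 1) S]. *)
Let A0 := (1 + b) * (beta^-1 + 1).

Let A00 : 0 <= A0.
Proof. by rewrite mulr_ge0// ?addr_ge0// invr_ge0 ltW. Qed.

Let contraction n x y (f : T -> R) : measurable_fun setT f -> (forall z, `|f z| <= W z) ->
  `|\int[mu n x]_z f z - \int[mu n y]_z f z| <= A0 * r ^+ (n %/ m) * (W x + W y).
Proof.
move=> mf fW; have df : dominated W f by split=> //; exists 1 => z; rewrite mul1r.
have fW1 z : `|f z| <= 1 * W z by rewrite mul1r.
(* The [n %% m] steps that do not fill a block are applied to [f] first; by [D1] they cost only the
   factor [1 + b]. *)
pose g z := \int[mu (n %% m)%N z]_y f y.
have dg : dominated W g by exact: mu_dom.
have gW z : `|g z| <= (1 + b) * W z.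
  apply: le_trans (expect_norm_le mW W1 (muW _ z).1 df fW1) _; rewrite mul1r.
  by apply: le_trans (muW _ z).2 _; rewrite mulrDl mul1r lerD2l ler_peMr.
have s0 : 0 < (1 + b) / beta by rewrite divr_gt0// ltr_pwDl.
have bbE S : (1 + b) / beta * (beta * S) = (1 + b) * S.
  by rewrite mulrA divfK// gt_eqF.
have og : osc ((1 + b) / beta) g.
  move=> z z'; rewrite mulrDr bbE mulrDr; have := gW z; have := gW z'.
  rewrite !ler_norml => /andP[h1 h2] /andP[h3 h4].
  move: s0; set u := (1 + b) / beta; lra.
have H u v : \int[mu n u]_z f z - \int[mu n v]_z f z <=
    A0 * r ^+ (n %/ m) * (W u + W v).
  rewrite {1 2}(divn_eq n m) !mu_tower// -/g.
  apply: le_trans (@osc_iter (n %/ m) _ _ dg s0 og u v) _.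
  rewrite -(mulrA (r ^+ _)) (mulrC A0) -(mulrA _ A0) ler_wpM2l ?exprn_ge0//; first exact: ltW.
  rewrite mulrDr bbE /A0; have := W1 u; have := W1 v => Wv Wu.
  have : (1 + b) / beta * 2 <= (1 + b) / beta * (W u + W v).
    by rewrite ler_wpM2l//; [exact: ltW|lra].
  lra.
by rewrite ler_norml; apply/andP; split; have := H x y; have := H y x; lra.
Qed.

Let mu_indic n x A : measurable A ->
  \int[mu n x]_z (\1_A z) = fine (mu n x A).
Proof. by move=> mA; rewrite /Rintegral integral_indic// setIT. Qed.

Let indic_leW A z : `|\1_A z : R| <= W z.
Proof. by apply: le_trans (W1 z); rewrite indicE ger0_norm// lern1 leq_b1. Qed.

(** Bounds the distance, on sets, of the law after [n] steps from any later one: the latter averages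
    laws after [n] steps from a random point whose mean weight is at most [W x0 + b]. *)
Let e n := A0 * r ^+ (n %/ m) * (2 * W x0 + b).

Let Wb : 0 <= 2 * W x0 + b.
Proof. have := W0 x0; have := b0; lra. Qed.

Let A0r n : 0 <= A0 * r ^+ (n %/ m).
Proof. by rewrite mulr_ge0// exprn_ge0// ltW. Qed.

Let e_ge0 n : 0 <= e n.
Proof. by rewrite /e mulr_ge0. Qed.

Let e_small (x : R) : 0 < x -> exists N, forall n, (N <= n)%N -> e n <= x.
Proof.
move=> x_gt0; pose C := A0 * (2 * W x0 + b) + 1.
have C1 : 0 <= A0 * (2 * W x0 + b) by exact: mulr_ge0.
have C0 : 0 < C by rewrite ltr_wpDl.
have xC : 0 < x / C by rewrite divr_gt0.
have rn : `|r| < 1 by rewrite gtr0_norm.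
have /cvgrPdist_le/(_ _ xC)[k _ hk] := cvg_expr rn.
exists (k * m)%N => n kmn.
have kn : (k <= n %/ m)%N by rewrite leq_divRL.
have := hk _ kn; rewrite /= sub0r normrN ger0_norm ?exprn_ge0 ?(ltW r0)// => h.
rewrite /e mulrAC; apply: (@le_trans _ _ (C * (x / C))).
  by apply: ler_pM => //; [rewrite exprn_ge0// ltW|rewrite /C lerDl].
by rewrite mulrC divfK// gt_eqF.
Qed.

Let mu_cauchy n k A : measurable A ->
  fine (mu n x0 A) - fine (mu k x0 A) <= e n + e k.
Proof.
move=> mA.
have H j l : `|fine (mu l x0 A) - fine (mu (j + l) x0 A)| <= e l.
  have mI : measurable_fun setT (\1_A : T -> R) by exact: measurable_indic.
  have dI : dominated W (\1_A : T -> R).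
    by split=> //; exists 1 => z; rewrite mul1r; exact: indic_leW.
  rewrite -!mu_indic// mu_tower// -(expect_cst (mu j x0) (\int[mu l x0]_z \1_A z)).
  have dE := mu_dom l dI.
  have dc := dominated_cst W1 (\int[mu l x0]_z \1_A z).
  rewrite -(expectB mW W1 (muW j x0).1 dc dE).
  have dB := dominatedB dc dE.
  apply: le_trans (le_normr_Rintegral _ _) _ => //.
    exact: (dominated_integrable mW W1 (muW j x0).1 dB).
  pose h z := A0 * r ^+ (l %/ m) * W x0 + A0 * r ^+ (l %/ m) * W z.
  have dh : dominated W h.
    apply: dominatedD; first exact: dominated_cst.
    by apply: dominatedZ; exact: dominated_W.
  apply: (@le_trans _ _ (\int[mu j x0]_z h z)).
    apply: (expect_le mW W1 (muW j x0).1) => //.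
      apply: (dominated_le _ dB) => [|z]; last by rewrite normr_id.
      by apply: measurableT_comp => //; exact: dB.1.
    by move=> z; rewrite /h -mulrDr; apply: contraction => // y; exact: indic_leW.
  rewrite (expectD mW W1 (muW j x0).1);
    [|exact: dominated_cst|by apply: dominatedZ; exact: dominated_W].
  rewrite expect_cst (expectZ mW W1 (muW j x0).1); last exact: dominated_W.
  rewrite -mulrDr /e ler_wpM2l//.
  by have := (muW j x0).2; lra.
have := e_ge0 n; have := e_ge0 k.
case: (leqP n k) => nk.
  have := H (k - n)%N n; rewrite subnK// ler_norml; lra.
have := H (n - k)%N k; rewrite subnK 1?ltnW// ler_norml; lra.
Qed.

Lemma harris_one_kernel : exists P : probability T R, invariant_prob K P /\
  forall n x y (f : T -> R), measurable_fun setT f -> (forall z, `|f z| <= W z) ->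
  (`|iter_int K n f x - \int[P]_z (f z)%:E| <=
     (A0 * (1 + b / (1 - lam)) * r ^+ (n %/ m) * W x)%:E)%E /\
  (`|iter_int K n f x - iter_int K n f y| <=
     (A0 * (1 + b / (1 - lam)) * r ^+ (n %/ m) * (W x + W y))%:E)%E.
Proof.
have /andP[l0 l1] := lam01; have b0' := b0.
have [P HP] := uniform_limit_probability e_small mu_cauchy.
(* Finiteness comes first: only then can the drift inequality under [P] be solved for the mean of
   [W], in [PW1]. *)
have PW0 : (\int[P]_z (W z)%:E <= (W x0 + b)%:E)%E.
  apply: (uniform_limit_integral_le e_small HP (N := 0)) => [|n _].
    exact: (mnn_W mW W1).
  by rewrite -(muE n x0 (mnn_W mW W1)); exact: D1.
have PW := (Wfinite_le mW W1 PW0).1.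
(* Lower semicontinuity yields one inequality only. Applied to [A] and to its complement, whose
   masses add up to 1 on both sides, it gives equality. *)
have inv_le A : measurable A ->
    (\int[P]_x K (fun y => (\1_A y)%:E) x <= P A)%E.
  move=> mA; apply/lee_addgt0Pr => d d0.
  have mI := mnn_indic mA (R := R).
  have [N hN] := e_small d0.
  rewrite -(fineK (fin_num_measure P A mA)) -EFinD.
  apply: (uniform_limit_integral_le e_small HP (N := N)) => [|n Nn].
    exact: (po_mnn hK mI).
  rewrite -muE; last exact: (po_mnn hK mI).
  rewrite -iterSr muE// integral_indic// setIT.
  have fA : (mu n.+1 x0 A <= (fine (mu n.+1 x0 A))%:E)%E.
    by rewrite fineK//; apply: fin_num_measure.
  apply: le_trans fA _; rewrite lee_fin.
  have := HP n.+1 A mA; have := hN n.+1 (leqW Nn); rewrite ler_norml; lra.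
have invP : invariant_prob K P.
  move=> A mA; apply/eqP; rewrite eq_le inv_le// andbT.
  have mCA := measurableC mA.
  have mI := mnn_indic mA (R := R); have mIC := mnn_indic mCA (R := R).
  have S1 : (\int[P]_x K (fun y => (\1_A y)%:E) x +
             \int[P]_x K (fun y => (\1_(~` A) y)%:E) x = 1)%E.
    have [h1 h2] := po_mnn hK mI; have [h3 h4] := po_mnn hK mIC.
    rewrite -ge0_integralD//.
    under eq_integral => x _.
      rewrite -(pf_add (po_pos hK x) mI mIC).
      rewrite (_ : (fun _ => _) = (fun=> 1%E)); last first.
        apply/funext => y; rewrite -EFinD !indicE in_setC.
        by case: (y \in A); rewrite ?addr0 ?add0r.
      rewrite (mo_one hK). over.
    by rewrite integral_cst// mul1e; exact: (@probability_setT _ _ _ P).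
  have S2 := probability_setC P mA.
  have le2 := inv_le _ mCA; move: le2; rewrite S2.
  have I0 : (0 <= \int[P]_x K (fun y => (\1_A y)%:E) x)%E.
    by apply: integral_ge0 => x _; exact: (po_mnn hK mI).2.
  have I0C : (0 <= \int[P]_x K (fun y => (\1_(~` A) y)%:E) x)%E.
    by apply: integral_ge0 => x _; exact: (po_mnn hK mIC).2.
  rewrite -(fineK (fin_num_measure P A mA)).
  move: S1 I0 I0C; set u := integral _ _ _; set v := integral _ _ _.
  case: u => [u| |]; case: v => [v| |]//.
  by rewrite -!EFinD => -[uv] _ _; rewrite !lee_fin; lra.
have PK n (f : T -> \bar R) : mnn f ->
    (\int[P]_x iter n K f x = \int[P]_x f x)%E.
  move=> mf; elim: n => [//|n ih].
  rewrite -ih /=; have mn : mnn (iter n K f) := po_mnn (markov_op_iter n hK) mf.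
  apply: (@posfun_integral_ext _ _ _ (fun g => \int[P]_x K g x)%E P) => //.
    exact: (posfun_comp (posfun_measure_integral P) hK).
  by move=> A mA /=; rewrite -invP.
have PW1 : \int[P]_z W z <= b / (1 - lam).
  have h : \int[P]_z W z <= lam * \int[P]_z W z + b.
    have dl : dominated W (fun z => lam * W z) by apply: dominatedZ; exact: dominated_W.
    have dlb : dominated W (fun z => lam * W z + b).
      by apply: dominatedD => //; exact: dominated_cst.
    rewrite -(expectZ mW W1 PW); last exact: dominated_W.
    rewrite -[X in _ + X](expect_cst P b) -(expectD mW W1 PW); [|by []|exact: dominated_cst].
    rewrite -lee_fin -(expect_EFin mW W1 PW) -?(expect_EFin mW W1 PW)//; last exact: dominated_W.
    rewrite -(PK m _ (mnn_W mW W1)); apply: ge0_le_integral => //.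
    - by move=> z _; exact: (po_mnn (markov_op_iter m hK) (mnn_W mW W1)).2.
    - exact: (po_mnn (markov_op_iter m hK) (mnn_W mW W1)).1.
    - by apply/measurable_EFinP; exact: dlb.1.
  by rewrite ler_pdivlMr; lra.
have bl : 0 <= b / (1 - lam) by rewrite divr_ge0//; lra.
exists P; split=> // n x y f mf fW.
have df : dominated W f by split=> //; exists 1 => z; rewrite mul1r.
rewrite !iter_intE// (expect_EFin mW W1 PW df) -!EFinB !lee_fin; split; last first.
  apply: le_trans (contraction n x y mf fW) _.
  have -> : A0 * (1 + b / (1 - lam)) * r ^+ (n %/ m) * (W x + W y) =
    (1 + b / (1 - lam)) * (A0 * r ^+ (n %/ m) * (W x + W y)) by ring.
  by rewrite ler_peMl ?lerDl// mulr_ge0// addr_ge0.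
(* By invariance the distance to [P] is an average over [z] of distances between the chains from [x]
   and from [z]; the mean of [W z] produces [1 + b / (1 - lam)]. *)
have -> : \int[P]_z f z = \int[P]_z \int[mu n z]_y f y.
  apply: (expect_tower mW W1 (@mk n) _ PW PW (@kW n)) => // g mg.
  by rewrite -(PK n g mg); apply: eq_integral => z _; rewrite muE.
rewrite -(expect_cst P (\int[mu n x]_z f z)).
have dE := mu_dom n df.
have dc := dominated_cst W1 (\int[mu n x]_z f z).
have dB := dominatedB dc dE.
rewrite -(expectB mW W1 PW dc dE).
apply: le_trans (le_normr_Rintegral _ _) _ => //.
  exact: (dominated_integrable mW W1 PW dB).
pose h z := A0 * r ^+ (n %/ m) * W x + A0 * r ^+ (n %/ m) * W z.
have dh1 : dominated W (fun z => A0 * r ^+ (n %/ m) * W z).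
  by apply: dominatedZ; exact: dominated_W.
have dh : dominated W h by apply: dominatedD => //; exact: dominated_cst.
apply: (@le_trans _ _ (\int[P]_z h z)).
  apply: (expect_le mW W1 PW) => //.
    apply: (dominated_le _ dB) => [|z]; last by rewrite normr_id.
    by apply: measurableT_comp => //; exact: dB.1.
  by move=> z; rewrite /h -mulrDr; exact: contraction.
rewrite (expectD mW W1 PW) ?expect_cst//; last exact: dominated_cst.
rewrite (expectZ mW W1 PW); last exact: dominated_W.
have -> : A0 * (1 + b / (1 - lam)) * r ^+ (n %/ m) * W x =
  A0 * r ^+ (n %/ m) * (W x + b / (1 - lam) * W x) by ring.
rewrite -mulrDr ler_wpM2l// lerD2l; apply: le_trans PW1 _.
by rewrite ler_peMr.
Qed.

End one_kernel.

(** The constants are chosen before the operator, its weight and the block length [m]; this order of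
    quantifiers carries the uniformity in theta, kappa and gamma. *)
Lemma harris (x0 : T) (lam b eps Rad : R) :
  0 <= lam < 1 -> 0 <= b -> 0 < eps <= 1 -> 0 < Rad ->
  4 * b <= (1 - lam) * Rad ->
  exists A r : R, 0 <= A /\ 0 < r < 1 /\
  forall (K : (T -> \bar R) -> T -> \bar R) (W : T -> R) (m : nat),
  markov_op K -> measurable_fun setT W -> (forall x, 1 <= W x) -> (0 < m)%N ->
  (forall n x, iter n K (EFin \o W) x <= (W x + b)%:E)%E ->
  (forall x, iter m K (EFin \o W) x <= (lam * W x + b)%:E)%E ->
  (forall x y, W x + W y <= Rad ->
     forall g : T -> R, measurable_fun setT g -> (forall z, 0 <= g z <= 1) ->
     (iter m K (EFin \o g) x <= iter m K (EFin \o g) y + (1 - eps)%:E)%E) ->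
  exists P : probability T R, invariant_prob K P /\
  forall n x y (f : T -> R), measurable_fun setT f -> (forall z, `|f z| <= W z) ->
  (`|iter_int K n f x - \int[P]_z (f z)%:E| <= (A * r ^+ (n %/ m) * W x)%:E)%E /\
  (`|iter_int K n f x - iter_int K n f y| <=
     (A * r ^+ (n %/ m) * (W x + W y))%:E)%E.
Proof.
move=> lam01 b0 eps01 Rad0 bRad.
have [beta [r [beta0 r01 large small]]] :=
  harris_constants lam01 b0 eps01 Rad0 bRad.
exists ((1 + b) * (beta^-1 + 1) * (1 + b / (1 - lam))), r; split; last split=> //.
  have bl : 0 <= b / (1 - lam) by rewrite divr_ge0//; case/andP: lam01; lra.
  have bi : 0 <= beta^-1 by rewrite invr_ge0 ltW.
  by rewrite !mulr_ge0//; lra.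
move=> K W m hK mW W1 m0 D1 D2 mino.
have [mu muE] := markov_op_kernels hK.
exact: (harris_one_kernel hK mW W1 lam01 b0 beta0 r01 large small m0 D1 D2 mino x0 muE).
Qed.

End harris.

(** * Gaussian kernels with nonexpansive mean *)

Section rV_measurability.
Context {R : realType} {d : nat}.

Lemma measurable_coord (i : 'I_d) :
  measurable_fun setT (fun x : 'rV[R]_d => x ord0 i).
Proof.
move=> _ Y mY; rewrite setTI; apply: sub_sigma_algebra => /=.
rewrite -bigcup_seq/=; exists i => /=; first by rewrite mem_index_enum.
by exists Y => //; rewrite setTI.
Qed.

Lemma measurable_rV {dsp : measure_display} {X : measurableType dsp}
    (f : X -> 'rV[R]_d) :
  (forall i, measurable_fun setT (fun x => f x ord0 i)) ->
  measurable_fun setT f.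
Proof.
move=> mf _ Y mY; rewrite setTI.
suff : g_sigma_preimage (fun i x => (f x) ord0 i) `<=` measurable.
  rewrite (g_sigma_preimage_comp (fun (i : 'I_d) (x : 'rV[R]_d) => x ord0 i) f).
  by apply; exists Y => //; rewrite setTI.
apply: smallest_sub; first exact: sigma_algebra_measurable.
case: d f mf {Y mY} => [|n] f mf; first by rewrite big_ord0.
rewrite -bigcup_mkord_ord; apply: bigcup_sub => i Ii.
by move=> A [B mB <-]; exact: mf.
Qed.

Lemma measurable_upd (i : 'I_d) :
  measurable_fun setT (fun xt : 'rV[R]_d * R => upd xt.1 i xt.2).
Proof.
apply: measurable_rV => j; rewrite /upd.
have [->|ji] := eqVneq j i.
  by under eq_fun do rewrite mxE eqxx; exact: measurable_snd.
under eq_fun do rewrite mxE (negbTE ji).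
exact: (measurableT_comp (measurable_coord j) measurable_fst).
Qed.

Lemma measurable_enorm : measurable_fun setT (@enorm R d).
Proof.
have ms : measurable_fun setT (@Num.sqrt R).
  apply: continuous_measurable_fun. exact: sqrt_continuous.
apply: (measurableT_comp ms); apply: measurable_sum => i.
by apply: measurable_funX; exact: measurable_coord.
Qed.

Lemma measurable_rV_add {dsp : measure_display} {X : measurableType dsp}
    (f g : X -> 'rV[R]_d) : measurable_fun setT f -> measurable_fun setT g ->
  measurable_fun setT (fun x => f x + g x).
Proof.
move=> mf mg; apply: measurable_rV => i; under eq_fun do rewrite mxE.
by apply: measurable_funD; apply: (measurableT_comp (measurable_coord i)).
Qed.

Lemma measurable_rV_opp {dsp : measure_display} {X : measurableType dsp}
    (f : X -> 'rV[R]_d) : measurable_fun setT f ->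
  measurable_fun setT (fun x => - f x).
Proof.
move=> mf; apply: measurable_rV => i; under eq_fun do rewrite mxE.
by apply: measurableT_comp => //; apply: (measurableT_comp (measurable_coord i)).
Qed.

End rV_measurability.

(** * Lebesgue integration coordinate by coordinate *)

Section iterated_integral.
Context {R : realType} {d : nat}.
Local Notation leb := (@lebesgue_measure R).
Local Open Scope ereal_scope.

(** [lebint] with the list of coordinates and the base point left free, for induction on the
    list. *)
Definition lebint_over (s : seq 'I_d) (f : 'rV[R]_d -> \bar R) :=
  foldr (fun i (F : 'rV[R]_d -> \bar R) x => \int[leb]_t F (upd x i t)) f s.

Lemma lebintE f : lebint f = lebint_over (enum 'I_d) f 0%R.
Proof. by []. Qed.

(** Each integration needs joint measurability for Tonelli, hence the parameter inside the
    induction: [X] holds the starting point for Gaussian kernels and is [unit] for plain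
    integrals. *)
Lemma measurable_lebint_over {dsp : measure_display} {X : measurableType dsp}
    (s : seq 'I_d) (h : X * 'rV[R]_d -> \bar R) : mnn h ->
  mnn (fun px : X * 'rV[R]_d => lebint_over s (fun y => h (px.1, y)) px.2).
Proof.
move=> mh; elim: s => [|i s ih] /=.
  by rewrite (_ : (fun _ => _) = h)//; apply/funext => -[].
split=> [|px]; last by apply: integral_ge0 => t _; exact: (ih.2 (px.1, _)).
pose phi (z : (X * 'rV[R]_d) * R) := (z.1.1, upd z.1.2 i z.2).
have mphi : measurable_fun setT phi.
  apply/measurable_fun_pairP; split => /=.
    exact: (measurableT_comp measurable_fst measurable_fst).
  have m2 : measurable_fun setT (fun z : (X * 'rV[R]_d) * R => (z.1.2, z.2)).
    apply/measurable_fun_pairP; split => /=; last exact: measurable_snd.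
    exact: (measurableT_comp measurable_snd measurable_fst).
  exact: (measurableT_comp (measurable_upd i) m2).
have [mG G0] := mnn_comp mphi ih.
exact: (@measurable_fun_fubini_tonelli_F _ _ _ _ R leb _ mG G0).
Qed.

Lemma pos_op_lebint_over s : pos_op (lebint_over s).
Proof.
elim: s => [|i s ih] /=; first by split=> //= f [].
have mu (x : 'rV[R]_d) : measurable_fun setT (fun t : R => upd x i t).
  have : measurable_fun setT (fun t : R => (x, t)) by exact: measurable_pair1.
  exact: (measurableT_comp (measurable_upd i)).
split=> [x|f mf].
  apply: (@posfun_comp _ _ _ (fun g => \int[leb]_t g (upd x i t)) _ _ ih).
  have mux : @measurable_fun _ _ (measurableTypeR R) _ setT (fun t => upd x i t).
    exact: mu.
  exact: (posfun_precomp mux (posfun_measure_integral leb)).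
have mf2 : mnn (fun px : unit * 'rV[R]_d => f px.2).
  by apply: mnn_comp mf; exact: measurable_snd.
have h := measurable_lebint_over (i :: s) mf2.
have mp : measurable_fun setT (fun x : 'rV[R]_d => (tt, x)) by exact: measurable_pair1.
exact: (mnn_comp mp h).1.
Qed.

Lemma posfun_lebint : posfun (@lebint R d).
Proof. exact: (po_pos (pos_op_lebint_over _) 0%R). Qed.

(** The translated functional gives []u, v]] the mass [v - u], so its measure is Lebesgue measure by
    uniqueness. *)
Lemma lebint_shift1 (a : R) (f : R -> \bar R) : mnn f ->
  \int[leb]_t f (t + a)%R = \int[leb]_t f t.
Proof.
move=> mf.
have mf' : @mnn _ (measurableTypeR R) R f by exact: mf.
have ms : @measurable_fun _ _ (measurableTypeR R) (measurableTypeR R) setT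
  (fun t : R => (t + a)%R).
  have ms0 : measurable_fun setT (fun t : R => (t + a)%R) by exact: measurable_funD.
  exact: ms0.
have hI := posfun_precomp ms (posfun_measure_integral leb).
apply: (posfun_integral_ext hI) => // A mA.
have [m [mE _]] := posfun_repr hI; rewrite -mE.
apply/esym; apply: lebesgue_measure_unique mA => _ [[u v]] _ <- /=.
rewrite mE (_ : (fun _ => _) =
    (fun t => (\1_(`]u - a, v - a]%classic) t)%:E)%R); last first.
  apply/funext => t; rewrite !indicE; congr ((_ _)%:R%:E).
  apply/idP/idP; rewrite !inE /= !in_itv /= => /andP[? ?];
    by apply/andP; split; lra.
rewrite integral_indic ?setIT// !lebesgue_measure_itv/= !lte_fin.
rewrite [RHS]lebesgue_measure_itv/= lte_fin ltrD2r; case: ifP => // _.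
by rewrite -!EFinB; congr EFin; ring.
Qed.

Lemma lebint_over_shift s (v : 'rV[R]_d) (f : 'rV[R]_d -> \bar R) x : mnn f ->
  lebint_over s (fun y => f (y + v)%R) x = lebint_over s f (x + v)%R.
Proof.
move=> mf; elim: s x => [//|i s ih] x /=.
have hs := pos_op_lebint_over s.
have mg : mnn (fun t : R => lebint_over s f (upd (x + v)%R i t)).
  apply: mnn_comp (po_mnn hs mf).
  have mp : measurable_fun setT (fun t : R => ((x + v)%R, t)) by exact: measurable_pair1.
  exact: (measurableT_comp (measurable_upd i) mp).
rewrite -(lebint_shift1 (v ord0 i) mg); apply: eq_integral => t _.
rewrite ih; congr lebint_over; apply/rowP => j; rewrite !mxE.
by case: eqP => [->|].
Qed.

(** Needed because a translation of the integrand also moves the base point; over the full list of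
    coordinates the value does not depend on it. *)
Lemma lebint_over_ext s (f : 'rV[R]_d -> \bar R) (x y : 'rV[R]_d) :
  (forall i, i \notin s -> x ord0 i = y ord0 i) ->
  lebint_over s f x = lebint_over s f y.
Proof.
elim: s x y => [|i s ih] x y xy /=.
  by congr f; apply/rowP => i; exact: xy.
apply: eq_integral => t _; apply: ih => j js; rewrite !mxE.
by case: eqP => [//|/eqP ji]; apply: xy; rewrite inE negb_or ji.
Qed.

Lemma lebint_shift (v : 'rV[R]_d) (f : 'rV[R]_d -> \bar R) : mnn f ->
  lebint (fun y => f (y + v)%R) = lebint f.
Proof.
move=> mf; rewrite !lebintE lebint_over_shift//.
by apply: lebint_over_ext => i; rewrite mem_enum.
Qed.

Lemma lebint_over_prod (phi : 'I_d -> R -> R) (s : seq 'I_d) x :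
  (forall i, measurable_fun setT (phi i)) -> (forall i t, 0 <= phi i t)%R ->
  (forall i, \int[leb]_t (phi i t)%:E = 1) -> uniq s ->
  lebint_over s (fun y => (\prod_i phi i (y ord0 i))%:E)%R x =
  (\prod_(i | i \notin s) phi i (x ord0 i))%:E%R.
Proof.
move=> mphi phi0 phi1; elim: s x => [|i s ih] x /=.
  by move=> _; congr (_%:E); apply: eq_bigl.
move=> /andP[nis us].
under eq_integral => t _.
  rewrite ih// (bigD1 i)//= mxE eqxx.
  under eq_bigr => j /andP[_ ji] do rewrite mxE (negbTE ji).
  rewrite mulrC EFinM. over.
rewrite ge0_integralZl_EFin//=.
- rewrite phi1 mule1; congr EFin; apply: eq_bigl => j.
  by rewrite inE; case: (j == i); case: (j \in s).
- by move=> t _; rewrite lee_fin.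
- by apply/measurable_EFinP; exact: mphi.
- by apply: prodr_ge0.
Qed.

Lemma lebint_prod (phi : 'I_d -> R -> R) :
  (forall i, measurable_fun setT (phi i)) -> (forall i t, 0 <= phi i t)%R ->
  (forall i, \int[leb]_t (phi i t)%:E = 1) ->
  lebint (fun y => (\prod_i phi i (y ord0 i))%:E)%R = 1.
Proof.
move=> mphi phi0 phi1; rewrite lebintE lebint_over_prod//; last exact: enum_uniq.
by rewrite big_pred0// => i; rewrite mem_enum.
Qed.

End iterated_integral.

(** * Inner product and Euclidean norm on row vectors *)

Section euclidean.
Context {R : realType} {d : nat}.
Implicit Types x y z : 'rV[R]_d.

Definition dot x y : R := \sum_(i < d) x ord0 i * y ord0 i.

Lemma dotC x y : dot x y = dot y x.
Proof. by apply: eq_bigr => i _; rewrite mulrC. Qed.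

Lemma dotDl x y z : dot (x + y) z = dot x z + dot y z.
Proof. by rewrite -big_split; apply: eq_bigr => i _; rewrite mxE mulrDl. Qed.

Lemma dotDr x y z : dot x (y + z) = dot x y + dot x z.
Proof. by rewrite dotC dotDl !(dotC x). Qed.

Lemma dotZl (k : R) x y : dot (k *: x) y = k * dot x y.
Proof. by rewrite mulr_sumr; apply: eq_bigr => i _; rewrite mxE mulrA. Qed.

Lemma dotZr (k : R) x y : dot x (k *: y) = k * dot x y.
Proof. by rewrite dotC dotZl dotC. Qed.

Lemma dotNl x y : dot (- x) y = - dot x y.
Proof. by rewrite -scaleN1r dotZl mulN1r. Qed.

Lemma dotNr x y : dot x (- y) = - dot x y.
Proof. by rewrite dotC dotNl dotC. Qed.

Definition dotE := (dotDl, dotDr, dotNl, dotNr, dotZl, dotZr).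

Lemma dot_ge0 x : 0 <= dot x x.
Proof. by apply: sumr_ge0 => i _; rewrite -expr2 sqr_ge0. Qed.

Lemma sqr_enorm x : enorm x ^+ 2 = dot x x.
Proof.
rewrite /enorm sqr_sqrtr; first by apply: eq_bigr => i _; rewrite expr2.
by apply: sumr_ge0 => i _; exact: sqr_ge0.
Qed.

Lemma enorm_ge0 x : 0 <= enorm x. Proof. exact: sqrtr_ge0. Qed.

Lemma dot_CS x y : dot x y <= enorm x * enorm y.
Proof.
apply: le_trans (ler_norm _) _.
rewrite -(@ler_pXn2r _ 2)// ?nnegrE ?mulr_ge0 ?enorm_ge0//.
rewrite exprMn !sqr_enorm real_normK ?num_real//.
have h0 := dot_ge0 (dot y y *: x - dot x y *: y).
have h : 0 <= dot y y * (dot x x * dot y y - dot x y ^+ 2).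
  move: h0; rewrite !dotE (dotC y x); congr (0 <= _); ring.
have := dot_ge0 y; rewrite le_eqVlt => /predU1P[y0|y0]; last first.
  by move: h; rewrite pmulr_rge0// subr_ge0.
(* When [y] has norm zero the quadratic is affine in [t]; nonnegativity on the whole line forces its
   slope to vanish. *)
have {}h0 t : 0 <= dot x x - 2 * t * dot x y.
  have := dot_ge0 (x - t *: y); rewrite !dotE -y0 (dotC y x).
  by congr (0 <= _); ring.
rewrite -y0 mulr0; case: (ltrgt0P (dot x y)) => [xy|xy|->]; last by rewrite expr0n.
- have := h0 ((dot x x + 1) / (2 * dot x y)).
  have -> : dot x x - 2 * ((dot x x + 1) / (2 * dot x y)) * dot x y = -1.
    by field; rewrite gt_eqF.
  by rewrite lerNr oppr0 ler10.
- have := h0 ((dot x x + 1) / (2 * dot x y)).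
  have -> : dot x x - 2 * ((dot x x + 1) / (2 * dot x y)) * dot x y = -1.
    by field; rewrite lt_eqF.
  by rewrite lerNr oppr0 ler10.
Qed.

Lemma enormN x : enorm (- x) = enorm x.
Proof. by congr Num.sqrt; apply: eq_bigr => i _; rewrite mxE sqrrN. Qed.

Lemma enorm_subC x y : enorm (x - y) = enorm (y - x).
Proof. by rewrite -enormN opprB. Qed.

Lemma enorm0 : enorm (0 : 'rV[R]_d) = 0.
Proof.
by rewrite /enorm big1 ?sqrtr0// => i _; rewrite mxE expr0n.
Qed.

Lemma enormZ (k : R) x : enorm (k *: x) = `|k| * enorm x.
Proof.
have k0 : 0 <= `|k| * enorm x by rewrite mulr_ge0// enorm_ge0.
apply/eqP; rewrite -(eqrXn2 (n := 2))// ?enorm_ge0//.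
by rewrite exprMn !sqr_enorm !dotE real_normK ?num_real// mulrA expr2.
Qed.

Lemma enormD x y : enorm (x + y) <= enorm x + enorm y.
Proof.
have x0 := enorm_ge0 x; have y0 := enorm_ge0 y.
rewrite -(@ler_pXn2r _ 2)// ?nnegrE ?addr_ge0 ?enorm_ge0//.
rewrite sqrrD !sqr_enorm !dotE (dotC y x).
by have := dot_CS x y; lra.
Qed.

Lemma enormB x y : enorm (x - y) <= enorm x + enorm y.
Proof. by rewrite -(enormN y); exact: enormD. Qed.

Lemma enorm_sqrB x y :
  enorm (x - y) ^+ 2 = enorm x ^+ 2 - 2 * dot x y + enorm y ^+ 2.
Proof. by rewrite !sqr_enorm !dotE (dotC y x); ring. Qed.

End euclidean.

(** * Gaussian transition operators *)

Section gaussian.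
Context {R : realType} {d : nat}.
Local Notation leb := (@lebesgue_measure R).

Lemma gauss_density_gt0 (m : 'rV[R]_d) (s2 : R) y : 0 < s2 -> 0 < gauss_density m s2 y.
Proof.
move=> s20; rewrite /gauss_density mulr_gt0// ?expR_gt0// exprn_gt0// invr_gt0.
by rewrite sqrtr_gt0 !mulr_gt0// pi_gt0.
Qed.

Lemma measurable_gauss_density {dsp : measure_display} {X : measurableType dsp}
    (f g : X -> 'rV[R]_d) (s2 : R) :
  measurable_fun setT f -> measurable_fun setT g ->
  measurable_fun setT (fun z => gauss_density (f z) s2 (g z)).
Proof.
move=> mf mg; apply: measurable_funM => //.
apply: measurableT_comp => //; apply: measurable_funM => //.
apply: measurableT_comp => //; apply: measurable_funX.
apply: (measurableT_comp measurable_enorm).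
by apply: measurable_rV_add => //; exact: measurable_rV_opp.
Qed.

Lemma lebint_gauss (m : 'rV[R]_d) (s2 : R) : 0 < s2 ->
  lebint (fun y => (gauss_density m s2 y)%:E) = 1%E.
Proof.
move=> s20; have ss : Num.sqrt s2 != 0 by rewrite gt_eqF// sqrtr_gt0.
rewrite -[RHS](@lebint_prod R d (fun i => normal_pdf (m ord0 i) (Num.sqrt s2))).
- congr lebint; apply/funext => y; congr EFin.
  rewrite /gauss_density.
  under [RHS]eq_bigr do rewrite normal_pdfE// /normal_peak /normal_fun
    sqr_sqrtr ?(ltW s20)//.
  rewrite big_split/= prodr_const card_ord; congr (_ * _).
    by rewrite mulr2n; congr (_^-1 ^+ _); congr Num.sqrt; ring.
  rewrite -expR_sum; congr expR.
  rewrite sqr_enorm mulNr /dot mulr_suml -sumrN; apply: eq_bigr => i _.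
  by rewrite !mxE expr2 mulNr mulr_natl.
- by move=> i; exact: measurable_normal_pdf.
- by move=> i t; exact: normal_pdf_ge0.
- by move=> i; exact: integral_normal_pdf.
Qed.

Lemma mnn_gauss (m : 'rV[R]_d) (s2 : R) : 0 < s2 ->
  mnn (fun y => (gauss_density m s2 y)%:E).
Proof.
move=> s20; split=> [|y]; last by rewrite lee_fin ltW// gauss_density_gt0.
by apply/measurable_EFinP; apply: measurable_gauss_density.
Qed.

Local Open Scope ereal_scope.

Lemma mnnM {dsp : measure_display} {X : measurableType dsp}
    (f : X -> \bar R) (h : X -> R) : mnn f -> mnn (EFin \o h) ->
  mnn (fun y => f y * (h y)%:E).
Proof.
move=> [mf f0] [mh h0]; split=> [|y]; first exact: emeasurable_funM.
by apply: mule_ge0; [exact: f0|exact: h0].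
Qed.

Lemma posfun_weight {dsp : measure_display} {X : measurableType dsp}
    (I : (X -> \bar R) -> \bar R) (h : X -> R) :
  posfun I -> mnn (EFin \o h) -> posfun (fun f => I (fun y => f y * (h y)%:E)).
Proof.
move=> hI mh; split=> [f f0|f g mf mg fg|k f k0 mf|f g mf mg|g mg ndg].
- by apply: (pf_ge0 hI) => x; rewrite mule_ge0//; exact: mh.2.
- apply: (pf_le hI); [exact: mnnM|exact: mnnM|move=> x].
  by rewrite lee_wpmul2r//; exact: mh.2.
- rewrite -(pf_scale hI)//; last exact: mnnM.
  by congr I; apply/funext => x; rewrite muleA.
- rewrite -(pf_add hI); [|exact: mnnM|exact: mnnM].
  congr I; apply/funext => x; rewrite ge0_muleDl//; [exact: mf.2|exact: mg.2].
- rewrite -(pf_lim hI).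
  + congr I; apply/funext => x; apply/esym/cvg_lim => //.
    apply: cvgeZr => //; exact: (ereal_nondecreasing_is_cvgn (ndg x)).
  + by move=> n; exact: mnnM.
  + by move=> x i j ij; rewrite lee_wpmul2r//; [exact: mh.2|exact: ndg].
Qed.

(** By conversion [myula_op] is the case where [T] is [myula_mean] and [s2] is [2 * gamma]; the
    probabilistic estimates see the potentials only through the mean map. *)
Definition gauss_op (T : 'rV[R]_d -> 'rV[R]_d) (s2 : R)
    (g : 'rV[R]_d -> \bar R) (x : 'rV[R]_d) : \bar R :=
  lebint (fun y => g y * (gauss_density (T x) s2 y)%:E).

Lemma markov_op_gauss T (s2 : R) : measurable_fun setT T -> (0 < s2)%R ->
  markov_op (gauss_op T s2).
Proof.
move=> mT s20; split=> [|x]; last first.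
  rewrite -[RHS](lebint_gauss (T x) s20) /gauss_op; congr lebint.
  by apply/funext => y; rewrite mul1e.
split=> [x|g mg].
  exact: (posfun_weight posfun_lebint (mnn_gauss _ s20)).
pose h (z : 'rV[R]_d * 'rV[R]_d) := g z.2 * (gauss_density (T z.1) s2 z.2)%:E.
have mh : mnn h.
  apply: mnnM; first exact: (mnn_comp measurable_snd mg).
  split=> [|z]; last by rewrite lee_fin ltW// gauss_density_gt0.
  apply/measurable_EFinP; apply: measurable_gauss_density.
    exact: (measurableT_comp mT measurable_fst).
  exact: measurable_snd.
have mp : measurable_fun setT (fun x : 'rV[R]_d => (x, 0%R : 'rV[R]_d)).
  exact: measurable_pair2.
exact: (mnn_comp mp (measurable_lebint_over (enum 'I_d) mh)).1.
Qed.

End gaussian.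

(** * Harnack inequality, minorization and drift for Gaussian steps *)

Section gaussian_harnack.
Context {R : realType} {d : nat}.
Local Notation V := 'rV[R]_d.

Lemma gauss_density_shift (m v y : V) (s2 : R) :
  gauss_density m s2 (y + v) = gauss_density (m - v) s2 y.
Proof.
by rewrite /gauss_density opprB addrA.
Qed.

(** With [a = y - m], [|a|^2 - 2 |a - v|^2 = 2 |v|^2 - |a - 2 v|^2]. Integrated over [y], this is
    the chi-square cost of moving the mean by [v]. *)
Lemma gauss_density_ratio (m v y : V) (s2 : R) : 0 < s2 ->
  gauss_density (m + v) s2 y ^+ 2 / gauss_density m s2 y =
  expR (enorm v ^+ 2 / s2) * gauss_density (m + 2 *: v) s2 y.
Proof.
move=> s20.
have h : gauss_density (m + v) s2 y ^+ 2 =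
  expR (enorm v ^+ 2 / s2) * gauss_density (m + 2 *: v) s2 y * gauss_density m s2 y.
  rewrite /gauss_density !opprD !addrA.
  set a := y - m; set c := (_ ^-1 ^+ _).
  transitivity (c ^+ 2 * (expR (- enorm (a - v) ^+ 2 / (2 * s2)) *
    expR (- enorm (a - v) ^+ 2 / (2 * s2)))); first by ring.
  transitivity (c ^+ 2 * (expR (enorm v ^+ 2 / s2) *
    expR (- enorm (a - 2 *: v) ^+ 2 / (2 * s2)) *
    expR (- enorm a ^+ 2 / (2 * s2)))); last by ring.
  rewrite -!expRD; congr (_ * expR _).
  rewrite !enorm_sqrB dotZr enormZ ger0_norm//.
  by field; rewrite gt_eqF.
have g0 := gauss_density_gt0 m y s20.
by rewrite h mulfK ?lt0r_neq0.
Qed.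

(* Translate the Gaussian centred at [b] to one centred at [a + s (b - a)], moving
   [G] by [(1 - s) (b - a)], and compare the latter with the one centred at [a]
   by Cauchy-Schwarz, in the linearised form [2 u v <= tau u^2 + v^2 / tau]. *)
Lemma gauss_harnack_step (a b : V) (s2 s c : R) (F G : V -> R) :
  0 < s2 -> 0 <= c ->
  mnn (EFin \o F) -> mnn (EFin \o G) ->
  (forall (w : V) (tau : R), 0 < tau ->
     2 * G (w + (1 - s) *: (b - a)) <= tau * F w + c / tau) ->
  forall t, 0 < t ->
  (2%:E * lebint (fun y => (G y)%:E * (gauss_density b s2 y)%:E) <=
   t%:E * lebint (fun y => (F y)%:E * (gauss_density a s2 y)%:E) +
   (c * expR (s ^+ 2 * enorm (b - a) ^+ 2 / s2) / t)%:E)%E.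
Proof.
move=> s20 c0 mF mG FG t t0.
pose v := s *: (b - a).
pose D0 := gauss_density a s2; pose D1 := gauss_density (a + v) s2.
pose D2 := gauss_density (a + 2 *: v) s2.
have D0_gt0 w : 0 < D0 w by exact: gauss_density_gt0.
have D1_gt0 w : 0 < D1 w by exact: gauss_density_gt0.
have D2_gt0 w : 0 < D2 w by exact: gauss_density_gt0.
set E := expR _.
have EE : E = expR (enorm v ^+ 2 / s2).
  by rewrite /E /v enormZ exprMn real_normK ?num_real.
have E0 : 0 < E by exact: expR_gt0.
have mGs : mnn (fun y : V => (G (y + (1 - s) *: (b - a)))%:E).
  by apply: (mnn_comp _ mG); apply: measurable_rV_add.
rewrite -(lebint_shift ((1 - s) *: (b - a))); last first.
  exact: (mnnM mG (mnn_gauss _ s20)).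
have -> : (fun y : V => (G (y + (1 - s) *: (b - a)))%:E *
      (gauss_density b s2 (y + (1 - s) *: (b - a)))%:E)%E =
    (fun y => (G (y + (1 - s) *: (b - a)))%:E * (D1 y)%:E)%E.
  have bE : b - (1 - s) *: (b - a) = a + v.
    by rewrite /v scalerBl scale1r opprB addrCA opprB addrC addrCA subrr addr0 addrC.
  by apply/funext => y; rewrite gauss_density_shift bE.
have hI := @posfun_lebint R d.
have m1 := mnnM mGs (mnn_gauss (a + v) s20).
have m2 := mnnM mF (mnn_gauss a s20).
have m3 : mnn (fun y => (c * E / t)%:E * (D2 y)%:E)%E.
  apply: mnn_scale; last exact: mnn_gauss.
  by rewrite divr_ge0 ?(ltW t0)// mulr_ge0// ltW.
have k0 : 0 <= c * E / t by rewrite divr_ge0 ?(ltW t0)// mulr_ge0// ltW.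
have mg := mnn_gauss (a + 2 *: v) s20.
have e3 := pf_scale hI k0 mg; rewrite lebint_gauss// mule1 in e3.
rewrite -(pf_scale hI (ler0n _ 2) m1) -(pf_scale hI (ltW t0) m2) -e3.
have m4 := mnn_scale (ltW t0) m2.
rewrite -(pf_add hI m4 m3); apply: (pf_le hI).
- exact: (mnn_scale (ler0n _ 2) m1).
- exact: (mnn_add m4 m3).
move=> w; rewrite -!EFinM -EFinD lee_fin.
(* A weight depending on the point: this [tau] turns [tau F D1] into [t F D0] and [c D1 / tau] into
   [c / t] times [D1^2 / D0], whose integral is known. *)
have H := FG w (t * D0 w / D1 w) (divr_gt0 (mulr_gt0 t0 (D0_gt0 w)) (D1_gt0 w)).
rewrite -(ler_pM2r (D1_gt0 w)) in H.
rewrite (mulrA 2) -/(D1 w); apply: le_trans H _.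
have := gauss_density_ratio a v w s20; rewrite -/D0 -/D1 -/D2 -EE => rE.
have -> : (t * D0 w / D1 w * F w + c / (t * D0 w / D1 w)) * D1 w =
   t * (F w * D0 w) + c / t * (D1 w ^+ 2 / D0 w).
  by field; rewrite !lt0r_neq0.
rewrite rE lerD2l le_eqVlt; apply/orP; left; apply/eqP; ring.
Qed.

Section nonexpansive.
Variables (T : V -> V) (s2 : R).
Hypotheses (mT : measurable_fun setT T) (s20 : 0 < s2).
Hypothesis T_nexp : forall x y, enorm (T x - T y) <= enorm (x - y).

Let hK : markov_op (gauss_op T s2) := markov_op_gauss mT s20.

Variable f : V -> R.
Hypotheses (mf : measurable_fun setT f) (f01 : forall z, 0 <= f z <= 1).

Let mnf : mnn (EFin \o f).
Proof.
split=> [|x]; first exact/measurable_EFinP.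
by rewrite lee_fin; case/andP: (f01 x).
Qed.

Let u n x := fine (iter n (gauss_op T s2) (EFin \o f) x).

Let uE n x : iter n (gauss_op T s2) (EFin \o f) x = (u n x)%:E.
Proof.
have hn := markov_op_iter n hK; have [_ n0] := po_mnn hn mnf.
rewrite /u fineK// ge0_fin_numE//; apply: le_lt_trans (ltry 1).
rewrite -(mo_one hn x); apply: (pf_le (po_pos hn x) mnf (mnn_cst ler01)) => y.
by rewrite lee_fin; case/andP: (f01 y).
Qed.

Let mnu n : mnn (EFin \o u n).
Proof.
have := po_mnn (markov_op_iter n hK) mnf; congr mnn.
by apply/funext => x; rewrite uE.
Qed.

Let u_next n x : (u n.+1 x)%:E =
  lebint (fun y => (u n y)%:E * (gauss_density (T x) s2 y)%:E)%E.
Proof.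
rewrite -uE iterS /gauss_op; congr lebint; apply/funext => y.
by rewrite uE.
Qed.

(* Linearised form of Wang's Harnack inequality
   (K^n f)(y)^2 <= (K^n f)(x) exp(|x-y|^2/(s2 n)); the junk value x / 0 = 0
   makes the case n = 0 (where x = y) uniform with the others. *)
Lemma gauss_harnack n x y t : (n = 0%N -> x = y) -> 0 < t ->
  2 * u n y <= t * u n x + expR (enorm (y - x) ^+ 2 / (s2 * n%:R)) / t.
Proof.
elim: n x y t => [|n ih] x y t xy t0.
  rewrite xy// subrr enorm0 mulr0 invr0 mulr0 expR0.
  have /andP[u0 u1] : 0 <= u 0 y <= 1 by exact: f01.
  (* Divided by [t] the left side is [t u - 2 u + 1 / t], for [u = u 0 y]. *)
  have h : (u 0 y * t - 1) ^+ 2 + t ^+ 2 * (u 0 y * (1 - u 0 y)) >= 0.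
    by rewrite addr_ge0// ?sqr_ge0// !mulr_ge0 ?sqr_ge0//; lra.
  rewrite -subr_ge0; have := divr_ge0 h (ltW t0); congr (0 <= _).
  by field; rewrite lt0r_neq0.
(* Equal shares: the current step covers one part in [n + 1] of the displacement, the other [n]
   steps the rest. This choice minimises the total cost; for [n = 0] nothing is left, as the
   induction hypothesis requires. *)
pose s : R := n.+1%:R^-1.
have n1 : n.+1%:R != 0 :> R by rewrite pnatr_eq0.
have := @gauss_harnack_step (T x) (T y) s2 s
  (expR ((1 - s) ^+ 2 * enorm (T y - T x) ^+ 2 / (s2 * n%:R))) (u n) (u n)
  s20 (expR_ge0 _) (mnu n) (mnu n).
move=> /(_ _ t t0)/wrap[].
  move=> w tau tau0.
  have -> : (1 - s) ^+ 2 * enorm (T y - T x) ^+ 2 =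
      enorm (w + (1 - s) *: (T y - T x) - w) ^+ 2.
    by rewrite addrAC subrr add0r enormZ exprMn real_normK ?num_real.
  apply: ih => // n0; rewrite /s n0 invr1 subrr scale0r addr0//.
rewrite -[X in (2%:E * X <= _)%E]u_next -[X in (_ <= t%:E * X + _)%E]u_next.
rewrite -!EFinM -EFinD lee_fin => /le_trans; apply.
rewrite lerD2l ler_pM2r ?invr_gt0// -expRD ler_expR.
set D := enorm (T y - T x) ^+ 2.
have DE : D <= enorm (y - x) ^+ 2.
  by rewrite ler_pXn2r ?nnegrE ?enorm_ge0.
have -> : (1 - s) ^+ 2 * D / (s2 * n%:R) + s ^+ 2 * D / s2 = D / (s2 * n.+1%:R).
  rewrite /s -natr1; rewrite -natr1 in n1; have s2n : s2 != 0 by rewrite gt_eqF.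
  have [->|n0] := eqVneq (n%:R : R) 0.
    by rewrite add0r mulr0 invr0 mulr0 add0r invr1 expr1n mul1r mulr1.
  by field; rewrite n1 n0 s2n.
by rewrite ler_pM2r// invr_gt0 mulr_gt0// ltr0n.
Qed.

(** If [u n x] exceeds 1/2, Harnack with [t = 2 exp D] gives [u n y >= 1 / (4 exp D)]; otherwise
    there is room to spare. As [f] is arbitrary, the total variation distance of the two laws stays
    away from 1. *)
Lemma gauss_minorization n x y (D : R) : (0 < n)%N ->
  enorm (x - y) ^+ 2 / (s2 * n%:R) <= D ->
  (iter n (gauss_op T s2) (EFin \o f) x <=
   iter n (gauss_op T s2) (EFin \o f) y + (1 - (4 * expR D)^-1)%:E)%E.
Proof.
move=> n0 xyD; rewrite !uE -EFinD lee_fin.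
pose C := expR D.
have D0 : 0 <= D.
  apply: le_trans xyD; apply: divr_ge0; first exact: sqr_ge0.
  by rewrite mulr_ge0// ltW.
have C1 : 1 <= C by rewrite -expR0 ler_expR.
have CV : (4 * C)^-1 <= 4^-1 by rewrite lef_pV2 ?posrE; lra.
have u01 z : 0 <= u n z by rewrite -lee_fin -uE; exact: (po_mnn (markov_op_iter n hK) mnf).2.
rewrite -/C; case: (leP (u n x) 2^-1) => ux.
  have := u01 y; lra.
have t0 : 0 < 2 * C by lra.
have := @gauss_harnack n y x (2 * C) _ t0 => /(_ _)/wrap[].
  by move=> nn; move: n0; rewrite nn.
move=> H; have {}H : 2 * u n x <= 2 * C * u n y + 2^-1.
  apply: le_trans H _; rewrite lerD2l ler_pdivrMr//.
  by rewrite mulrA mulVf// mul1r ler_expR.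
suff : (4 * C)^-1 <= u n y.
  have : u n x <= 1.
    rewrite -lee_fin -uE -(mo_one (markov_op_iter n hK) x).
    apply: (pf_le (po_pos (markov_op_iter n hK) x) mnf (mnn_cst ler01)) => z.
    by rewrite lee_fin; case/andP: (f01 z).
  lra.
by rewrite -div1r ler_pdivrMr; lra.
Qed.

End nonexpansive.

(** By the tangent bound the integrand is at most a multiple of [exp (P |y|^2)] times a Gaussian
    density, which is again a multiple of one: with [q = 1 - 4 P gam] the variance is divided by [q]
    and the mean moves from [a] to [a / q]. The multiples are controlled through [1 / q <= 2]. *)
Lemma gauss_drift (a : V) (Psi : R -> R) (N2 P gam : R) :
  0 < gam -> 0 <= P -> 4 * P * gam <= 2^-1 ->
  (forall y : V, Psi (N2 + enorm y ^+ 2) <=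
     Psi (N2 + enorm a ^+ 2) + P * (enorm y ^+ 2 - enorm a ^+ 2)) ->
  measurable_fun setT (fun y : V => expR (Psi (N2 + enorm y ^+ 2))) ->
  (lebint (fun y : V => (expR (Psi (N2 + enorm y ^+ 2)))%:E *
      (gauss_density a (2 * gam) y)%:E) <=
   (expR (Psi (N2 + enorm a ^+ 2) +
      (8 * P ^+ 2 * enorm a ^+ 2 + 4 * P * d%:R) * gam))%:E)%E.
Proof.
move=> gam0 P0 Pgam tangent mPsi.
pose e := 4 * P * gam; pose q := 1 - e.
have e0 : 0 <= e by rewrite !mulr_ge0// ltW.
have q0 : 2^-1 <= q by rewrite /q /e; lra.
have q_gt0 : 0 < q by lra.
pose v := (4 * P * gam / q) *: a.
pose s2 := 2 * gam / q.
have s20 : 0 < s2 by rewrite divr_gt0// mulr_gt0.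
set B := expR _.
have hI := @posfun_lebint R d.
have mg : mnn (fun y : V => (gauss_density (a + v) s2 y)%:E) by exact: mnn_gauss.
apply: (@le_trans _ _ (lebint (fun y : V => B%:E * (gauss_density (a + v) s2 y)%:E)%E)); last first.
  by rewrite (pf_scale hI) ?expR_ge0// lebint_gauss// mule1.
apply: (pf_le hI).
- apply: mnnM; last by apply: mnn_gauss; lra.
  by split=> [|y]; [exact/measurable_EFinP|rewrite lee_fin expR_ge0].
- by apply: mnn_scale => //; exact: expR_ge0.
move=> y; rewrite -!EFinM lee_fin.
(* [1 / q <= 1 + 2 e <= exp (2 e)], the first because [(1 - e) (1 + 2 e) = 1 + e (1 - 2 e)]. The
   [d]-th power gives the dimension term of the statement. *)
have qV : Num.sqrt q^-1 <= expR e.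
  have qe : q^-1 <= expR e ^+ 2.
    rewrite -expRM_natl; apply: le_trans (expR_ge1Dx _).
    rewrite -div1r ler_pdivrMr// /q.
    have : 0 <= e * (1 - 2 * e) by rewrite mulr_ge0// /e; lra.
    by lra.
  rewrite -(@ler_pXn2r _ 2)// ?nnegrE ?sqrtr_ge0 ?expR_ge0// sqr_sqrtr//.
  by rewrite invr_ge0 ltW.
rewrite /gauss_density.
have -> : (Num.sqrt (2 * pi * (2 * gam)))^-1 =
    (Num.sqrt (2 * pi * s2))^-1 * Num.sqrt q^-1.
  have p0 : 0 <= 2 * pi * (2 * gam) :> R.
    by rewrite !mulr_ge0// ?pi_ge0// ltW.
  have -> : 2 * pi * s2 = (2 * pi * (2 * gam)) * q^-1 by rewrite /s2; ring.
  rewrite (sqrtrM _ p0) invfM mulfVK//.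
  by rewrite lt0r_neq0// sqrtr_gt0 invr_gt0.
have hd : Num.sqrt q^-1 ^+ d <= expR (4 * P * d%:R * gam).
  have -> : 4 * P * d%:R * gam = d%:R * e by rewrite /e; ring.
  by rewrite expRM_natl lerXn2r ?nnegrE ?sqrtr_ge0 ?expR_ge0.
rewrite exprMn.
set c := (_ ^-1 ^+ d).
have c0 : 0 <= c by rewrite exprn_ge0// invr_ge0 sqrtr_ge0.
set A := enorm a ^+ 2 in tangent B *.
have A0 : 0 <= A by exact: sqr_ge0.
pose h := enorm (y - a) ^+ 2.
have key : Psi (N2 + enorm y ^+ 2) + - h / (2 * (2 * gam)) <=
    Psi (N2 + A) + 8 * P ^+ 2 * A * gam + - enorm (y - (a + v)) ^+ 2 / (2 * s2).
  apply: (@le_trans _ _ (Psi (N2 + A) + P * (enorm y ^+ 2 - A) + - h / (2 * (2 * gam)))).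
    by rewrite lerD2r.
  rewrite -!addrA lerD2l.
  have -> : y - (a + v) = (y - a) - v by rewrite opprD addrA.
  have -> : enorm y ^+ 2 - A = h + 2 * dot (y - a) a.
    by rewrite /h /A !sqr_enorm !dotE (dotC a y); ring.
  rewrite enorm_sqrB -/h /v dotZr enormZ exprMn real_normK ?num_real// -/A /s2.
  set D := dot (y - a) a.
  have qn : q != 0 by rewrite gt_eqF.
  have gn : gam != 0 by rewrite gt_eqF.
  have -> : P * (h + 2 * D) + - h / (2 * (2 * gam)) =
     4 * P ^+ 2 * A * gam / q + - (h - 2 * (4 * P * gam / q * D) + (4 * P * gam / q) ^+ 2 * A) /
     (2 * (2 * gam / q)).
    transitivity (2 * P * D - q * h / (4 * gam)); last by field; rewrite qn gn.
    by rewrite /q /e; field.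
  rewrite lerD2r ler_pdivrMr//.
  have : 0 <= P ^+ 2 * A * gam * (2 * q - 1).
    apply: mulr_ge0; last by lra.
    by apply: mulr_ge0 (ltW gam0); apply: mulr_ge0 A0; exact: sqr_ge0.
  by lra.
rewrite mulrCA -expRD.
apply: (@le_trans _ _ (c * Num.sqrt q^-1 ^+ d *
    expR (Psi (N2 + A) + 8 * P ^+ 2 * A * gam + - enorm (y - (a + v)) ^+ 2 / (2 * s2)))).
  by rewrite ler_wpM2l ?ler_expR// mulr_ge0// exprn_ge0// sqrtr_ge0.
rewrite expRD; set X := expR (_ + _); set Z := expR _.
have -> : B = expR (4 * P * d%:R * gam) * X.
  by rewrite /B /X -expRD; congr expR; ring.
have -> : expR (4 * P * d%:R * gam) * X * (c * Z) =
  c * expR (4 * P * d%:R * gam) * (X * Z) by ring.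
rewrite ler_wpM2r ?mulr_ge0 ?expR_ge0//.
by rewrite ler_wpM2l.
Qed.

End gaussian_harnack.

(** * The Euclidean norm, topology and measurability *)

Section enorm_topology.
Context {R : realType} {d : nat}.
Local Notation E := 'rV[R]_d.

Lemma coord_le_enorm (x : E) i : `|x ord0 i| <= enorm x.
Proof.
rewrite -(@ler_pXn2r _ 2)// ?nnegrE ?enorm_ge0// real_normK ?num_real//.
rewrite sqr_enorm /dot (bigD1 i)//= -expr2 lerDl.
by apply: sumr_ge0 => j _; rewrite -expr2 sqr_ge0.
Qed.

Lemma enorm_le_sum (x : E) : enorm x <= \sum_i `|x ord0 i|.
Proof.
have S0 : 0 <= \sum_i `|x ord0 i| by apply: sumr_ge0.
rewrite -(@ler_pXn2r _ 2)// ?nnegrE ?enorm_ge0// sqr_enorm /dot.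
rewrite [leRHS]expr2 mulr_suml; apply: ler_sum => i _.
apply: le_trans (ler_norm _) _; rewrite normrM ler_wpM2l// (bigD1 i)//= lerDl.
exact: sumr_ge0.
Qed.

Lemma enorm_eq0 (x : E) : enorm x = 0 -> x = 0.
Proof.
move=> x0; apply/rowP => i; rewrite mxE; apply/eqP.
by rewrite -normr_le0 -x0; exact: coord_le_enorm.
Qed.

Lemma coord_le_norm (x : E) i : `|x ord0 i| <= `|x|.
Proof.
have /mapP[j Hj ->] : `|x ord0 i| \in [seq `|x k.1 k.2| | k : 'I_1 * 'I_d].
  by apply/mapP; exists (ord0, i) => //=; rewrite mem_enum.
by rewrite [leRHS]/Num.norm /= mx_normrE; apply/bigmax_geP; right => /=; exists j.
Qed.

Lemma norm_le_enorm (x : E) : `|x| <= enorm x.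
Proof.
rewrite [leLHS]/Num.norm /= mx_normrE; apply/bigmax_leP; split; first exact: enorm_ge0.
by move=> [i j] _ /=; rewrite (ord1 i) coord_le_enorm.
Qed.

Lemma Lipschitz_continuous (f : E -> R) (M : R) : 0 <= M ->
  (forall x y, `|f x - f y| <= M * enorm (x - y)) -> continuous f.
Proof.
move=> M0 fM x; have FF := nbhs_filter x.
apply/(@cvgrPdist_le _ _ _ _ FF) => e e0.
(* The topology is that of the maximum norm, which [enorm] exceeds by a factor of at most [d];
   adding 1 keeps [C] positive. *)
pose C := M * d%:R + 1.
have C0 : 0 < C by rewrite ltr_wpDl// mulr_ge0.
apply/nbhs_ballP; exists (e / C); first by rewrite /= divr_gt0.
move=> y /= xy; apply: le_trans (fM x y) _.
apply: (@le_trans _ _ (C * (e / C))); last by rewrite mulrC divfK// lt0r_neq0.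
apply: (@le_trans _ _ (M * (d%:R * (e / C)))).
  rewrite ler_wpM2l//; apply: le_trans (enorm_le_sum _) _.
  have -> : d%:R * (e / C) = \sum_(i < d) (e / C) by rewrite sumr_const card_ord mulr_natl.
  apply: ler_sum => i _; apply: le_trans (coord_le_norm _ _) _.
  by move: xy; rewrite mx_norm_ball => /ltW.
by rewrite (mulrA M) ler_wpM2r ?lerDl// ltW// divr_gt0.
Qed.

Lemma enorm_Lipschitz (x y : E) : `|enorm x - enorm y| <= enorm (x - y).
Proof.
have h1 := enormD (x - y) y; have h2 := enormD (y - x) x.
rewrite subrK in h1; rewrite subrK enorm_subC in h2.
by rewrite ler_norml; apply/andP; split; lra.
Qed.

Lemma rat_dense_enorm (x : E) (e : R) : 0 < e ->
  exists q : 'rV[rat]_d, enorm (x - map_mx ratr q) < e.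
Proof.
move=> e0.
pose e' := e / d.+1%:R.
have e'0 : 0 < e' by rewrite divr_gt0.
have /choice[q hq] : forall i : 'I_d, exists r : rat, `|x ord0 i - ratr r| < e'.
  move=> i; have xe : x ord0 i - e' < x ord0 i + e' by lra.
  have [r] := rat_in_itvoo xe; rewrite in_itv/= => /andP[r1 r2]; exists r.
  by rewrite ltr_norml; apply/andP; split; lra.
exists (\row_i q i); apply: le_lt_trans (enorm_le_sum _) _.
apply: (@le_lt_trans _ _ (\sum_(i < d) e')).
  by apply: ler_sum => i _; rewrite !mxE ltW.
rewrite sumr_const card_ord -mulr_natl /e' mulrCA gtr_pMr//.
by rewrite ltr_pdivrMr// mul1r ltr_nat.
Qed.

(** Measurable sets are generated by the coordinates, and [enorm] balls are measurable. The set
    where [f < c] is the union of the balls around rational points [q] of radius [c - f q], a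
    countable union. *)
Lemma Lipschitz_measurable (f : E -> R) :
  (forall x y, `|f x - f y| <= enorm (x - y)) -> measurable_fun setT f.
Proof.
move=> f1; apply: (measurability _ (RGenInftyO.measurableE R)) => //.
move=> _ [_ [c ->] <-]; rewrite setTI.
have -> : f @^-1` `]-oo, c[%classic = \bigcup_(q : 'rV[rat]_d)
    [set x | enorm (x - map_mx ratr q) < c - f (map_mx ratr q)].
  apply/seteqP; split=> x /=; rewrite in_itv/=.
    move=> fc; have [|q hq] := @rat_dense_enorm x ((c - f x) / 2); first by lra.
    by exists q => //=; have := f1 (map_mx ratr q) x; rewrite enorm_subC ler_norml => /andP[]; lra.
  move=> [q _ /= hq]; have := f1 x (map_mx ratr q); rewrite ler_norml => /andP[]; lra.
apply: countable_bigcupT_measurable; first exact: countableP.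
move=> q.
have mq : measurable_fun setT (fun x : E => enorm (x - map_mx ratr q)).
  by apply: (measurableT_comp measurable_enorm); apply: measurable_rV_add.
have := mq measurableT _ (measurable_itv `]-oo, (c - f (map_mx ratr q))[).
rewrite setTI; congr measurable; apply/seteqP; split=> x /=; by rewrite in_itv.
Qed.

Lemma nonexpansive_measurable (T : E -> E) :
  (forall x y, enorm (T x - T y) <= enorm (x - y)) -> measurable_fun setT T.
Proof.
move=> T1; apply: measurable_rV => i; apply: Lipschitz_measurable => x y.
apply: le_trans (T1 x y); have := coord_le_enorm (T x - T y) i.
by rewrite !mxE.
Qed.

End enorm_topology.

(** The limit [t -> 0] in elementary form; the first-order conditions below end with it. *)
Lemma ge0_of_small_slope (R : realType) (a k : R) :
  (forall t, 0 < t <= 1 -> 0 <= a + t * k) -> 0 <= a.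
Proof.
move=> H; apply/ler_addgt0Pr => e e0.
pose t := Num.min 1 (e / (`|k| + 1)).
have k0 : 0 < `|k| + 1 by rewrite ltr_wpDl.
have ek : 0 < e / (`|k| + 1) by rewrite divr_gt0.
have t01 : 0 < t <= 1 by rewrite /t lt_min ltr01 ek/= ge_min lexx.
apply: le_trans (H t t01) _; rewrite lerD2l.
apply: le_trans (ler_norm _) _; rewrite normrM gtr0_norm; last by case/andP: t01.
apply: (@le_trans _ _ (e / (`|k| + 1) * (`|k| + 1))); last first.
  by rewrite divfK// lt0r_neq0.
apply: ler_pM => //; first by case/andP: t01 => /ltW.
  by rewrite /t ge_min lexx orbT.
by rewrite lerDl.
Qed.

(** * Gradients of smooth convex functions *)

Section smooth_convex.
Context {R : realType} {d : nat}.
Local Notation E := 'rV[R]_d.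
Variables (V : E -> R) (dV : forall x, differentiable V x).

Lemma derive_grad (x v : E) : 'D_v V x = dot (grad V x) v.
Proof.
rewrite deriveE// {1}(row_sum_delta v) linear_sum /dot/=; apply: eq_bigr => i _.
by rewrite linearZ/= /grad mxE deriveE// mulrC.
Qed.

Lemma is_derive_line (x v : E) (t : R) :
  is_derive t 1 (fun s : R => V (x + s *: v)) (dot (grad V (x + t *: v)) v).
Proof.
have h : derivable V (x + t *: v) v by exact: diff_derivable.
have e : (fun s : R => s^-1 *: (((fun s : R => V (x + s *: v)) \o shift t) (s *: 1)
     - V (x + t *: v))) =
   (fun s : R => s^-1 *: ((V \o shift (x + t *: v)) (s *: v) - V (x + t *: v))).
  apply/funext => s /=; congr (_ *: (V _ - _)).
  have -> : s *: (1 : R) = s by rewrite /GRing.scale/= mulr1.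
  by rewrite scalerDl addrCA.
split; first by rewrite /derivable e.
by rewrite -derive_grad /derive e.
Qed.

Lemma convex_grad_ineq (m : R) (x z : E) : 0 <= m -> mconvex m V ->
  V x + dot (grad V x) (z - x) + m / 2 * enorm (z - x) ^+ 2 <= V z.
Proof.
move=> m0 cV; set N := enorm (z - x) ^+ 2; set v := z - x.
have H t : 0 < t <= 1 -> 0 <= V z - V x - dot (grad V x) v - m / 2 * N + t * (m / 2 * N).
  move=> /andP[t0 t1]; apply/ler_addgt0Pr => e e0.
  have dl : derivable V x v by exact: diff_derivable.
  have /cvgrPdist_le/(_ e e0)[r /= r0 Hr] := dl.
  (* Small enough for the difference quotient to be within [e] of the derivative, and at most [t] so
     that the error term in [t] covers the one in [h]. *)
  pose h := Num.min t (r / 2).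
  have r2 : 0 < r / 2 by rewrite divr_gt0.
  have h0 : 0 < h by rewrite lt_min t0 r2.
  have ht : h <= t by rewrite ge_min lexx.
  have hr : h <= r / 2 by rewrite ge_min lexx orbT.
  have := Hr h; rewrite /ball /= sub0r normrN gtr0_norm// => /(_ _ _)/wrap[].
  - by lra.
  - exact: lt0r_neq0.
  rewrite -/('D_v V x) derive_grad ler_norml => /andP[_ +].
  rewrite /GRing.scale/= => h1.
  have := cV z x h; rewrite (ltW h0) (le_trans ht t1) => /(_ isT).
  have -> : h *: z + (1 - h) *: x = h *: v + x.
    by rewrite scalerBl scale1r /v scalerBr addrCA addrC -addrA.
  rewrite -/N => h2.
  move: h1; set q := h^-1 * _ => h1.
  have qE : h * q = V (h *: v + x) - V x by rewrite /q mulVKf// lt0r_neq0.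
  have : h * q <= h * (V z - V x - m / 2 * (1 - h) * N) by rewrite qE; lra.
  rewrite ler_pM2l// => h3.
  have mN : 0 <= (t - h) * (m / 2 * N).
    by apply: mulr_ge0; [lra|apply: mulr_ge0; [lra|exact: sqr_ge0]].
  lra.
have := ge0_of_small_slope H; lra.
Qed.

Hypothesis cV : mconvex 0 V.
Variables (L : R) (L0 : 0 <= L).
Hypothesis LV : forall x y, enorm (grad V x - grad V y) <= L * enorm (x - y).

Lemma descent_lemma (x z : E) :
  V z <= V x + dot (grad V x) (z - x) + L / 2 * enorm (z - x) ^+ 2.
Proof.
set v := z - x; set N := enorm v ^+ 2; set D := dot (grad V x) v.
(* The quadratic makes the derivative nonpositive for [t > 0]; the mean value theorem then compares
   [h 1] with [h 0]. *)
pose h (t : R) := V (x + t *: v) - (t * D + L / 2 * N * t ^+ 2).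
have dh (t : R) : is_derive t (1 : R) h (dot (grad V (x + t *: v)) v - (D + L * N * t)).
  apply: is_deriveB; first exact: is_derive_line.
  apply: is_derive_eq.
  by rewrite /GRing.scale/=; field.
have hc : {within `[(0 : R), 1], continuous h}.
  by apply: derivable_within_continuous => t _; have [] := dh t.
have [t] := MVT ltr01 (fun t _ => dh t) hc.
rewrite in_itv/= => /andP[t0 t1].
rewrite /h scale0r addr0 scale1r subr0 mulr1 => hE.
have xz : x + v = z by rewrite addrC subrK.
rewrite xz in hE.
have h1 : dot (grad V (x + t *: v) - grad V x) v <= L * N * t.
  apply: le_trans (dot_CS _ _) _.
  have := LV (x + t *: v) x; rewrite addrAC subrr add0r enormZ (gtr0_norm t0) => h2.
  rewrite /N expr2; have := ler_wpM2r (enorm_ge0 v) h2; lra.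
rewrite dotDl dotNl -/D in h1; lra.
Qed.

Lemma grad_cocoercive (x y : E) :
  enorm (grad V x - grad V y) ^+ 2 <= L * dot (grad V x - grad V y) (x - y).
Proof.
move: L0; rewrite le_eqVlt => /predU1P[L_eq0|L_gt0].
  have := LV x y; rewrite -L_eq0 !mul0r => h; have := enorm_ge0 (grad V x - grad V y).
  move=> h'; have -> : enorm (grad V x - grad V y) = 0 by lra.
  by rewrite expr0n/= lexx.
(* From [w], take a gradient step of length [1 / L] for [V] minus its tangent at [u]: convexity
   bounds [V z] from below, the descent lemma from above. Adding the cases [(x, y)] and [(y, x)]
   gives cocoercivity. *)
have H (u w : E) : V u + dot (grad V u) (w - u) +
    (2 * L)^-1 * enorm (grad V w - grad V u) ^+ 2 <= V w.
  set g := grad V w - grad V u; pose z := w - L^-1 *: g.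
  have h1 := convex_grad_ineq u z (lexx 0) cV.
  have h2 := descent_lemma w z.
  have zw : z - w = - (L^-1 *: g) by rewrite /z addrAC subrr add0r.
  have zu : z - u = (w - u) - L^-1 *: g by rewrite /z addrAC.
  move: h1 h2; rewrite zw zu enormN enormZ exprMn real_normK ?num_real//.
  rewrite !mul0r addr0 dotDr !dotNr !dotZr => h1 h2.
  have gg : dot (grad V w) g - dot (grad V u) g = enorm g ^+ 2.
    by rewrite sqr_enorm -dotNl -dotDl.
  move: h1 h2; rewrite -gg; set A := dot (grad V w) g; set B := dot (grad V u) g.
  have -> : L / 2 * (L^-1 ^+ 2 * (A - B)) = (2 * L)^-1 * (A - B) by field; rewrite lt0r_neq0.
  have -> : L^-1 * A = 2 * ((2 * L)^-1 * A) by field; rewrite lt0r_neq0.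
  have -> : L^-1 * B = 2 * ((2 * L)^-1 * B) by field; rewrite lt0r_neq0.
  lra.
move: (H x y) (H y x); rewrite (enorm_subC (grad V y)).
move: (grad V x) (grad V y) => a b; rewrite -ler_pdivrMl//.
rewrite !dotDr !dotDl !dotNr !dotNl.
move: (dot a x) (dot a y) (dot b x) (dot b y) (V x) (V y) (enorm _ ^+ 2).
move=> axx axy bxx bxy vx vy G h1 h2.
have -> : L^-1 * G = (2 * L)^-1 * G + (2 * L)^-1 * G by field; rewrite lt0r_neq0.
lra.
Qed.

End smooth_convex.

(** * Proximal maps of Lipschitz convex functions *)

Section proximal.
Context {R : realType} {d : nat}.
Local Notation E := 'rV[R]_d.
Variables (U : E -> R) (M lam : R).
Hypotheses (cU : mconvex 0 U) (M0 : 0 <= M) (lam0 : 0 < lam).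
Hypothesis LU : forall x y, `|U x - U y| <= M * enorm (x - y).

Lemma prox_exists (x : E) : exists p, is_prox U lam x p.
Proof.
pose F (z : E) := U z + enorm (x - z) ^+ 2 / (2 * lam).
(* Beyond this radius [|x - z|^2 / (2 lam)] exceeds [M |x - z|], the most that [U] can gain, so a
   minimiser on the ball is global. *)
pose r := 2 * lam * M.
have r0 : 0 <= r by rewrite !mulr_ge0// ltW.
pose A := [set z : E | enorm (x - z) <= r].
have xz_cont : continuous (fun z : E => enorm (x - z)).
  apply: (@Lipschitz_continuous _ _ _ 1) => // y z; rewrite mul1r.
  apply: le_trans (enorm_Lipschitz _ _) _.
  by rewrite opprB addrC addrA subrK enorm_subC lexx.
have Ax : A x by rewrite /A/= subrr enorm0.
have cA : compact A.
  apply: bounded_closed_compact.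
    exists (r + enorm x); split; first exact: num_real.
    move=> K rK z Az; have zr : enorm (x - z) <= r := Az; apply: le_trans (norm_le_enorm z) _.
    have := enormB x (x - z); rewrite opprB addrCA subrr addr0; lra.
  rewrite (_ : A = (fun z : E => enorm (x - z)) @^-1` [set t | t <= r])//.
  by apply: closed_comp => [z _|]; [exact: xz_cont|exact: closed_le].
have cF : {within A, continuous F}.
  have cU' : continuous U := Lipschitz_continuous M0 LU.
  have c2 : continuous (fun z : E => enorm (x - z) ^+ 2 / (2 * lam)).
    move=> z; apply: (@continuous_comp _ _ _ (fun z : E => enorm (x - z))
      (fun t : R => t ^+ 2 / (2 * lam))); first exact: xz_cont.
    by apply: cvgM; [exact: exprn_continuous|exact: cvg_cst].
  by apply: continuous_subspaceT => z; exact: (cvgD (cU' z) (c2 z)).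
have [p pA pmin] := compact_EVT_min (ex_intro _ x Ax) cA cF.
exists p => z.
have [zA|zA] := pselect (A z); first by apply: pmin; rewrite inE.
have px : F p <= F x by apply: pmin; rewrite inE.
apply: (le_trans px); rewrite /F subrr enorm0 expr0n/= mul0r addr0.
have {zA} zr : r < enorm (x - z) by rewrite ltNge; apply/negP.
have := LU x z; rewrite ler_norml => /andP[_ h].
have -> : enorm (x - z) ^+ 2 / (2 * lam) = enorm (x - z) / (2 * lam) * enorm (x - z).
  by rewrite expr2 mulrAC.
have h2 : M <= enorm (x - z) / (2 * lam).
  by rewrite ler_pdivlMr ?mulr_gt0//; rewrite /r in zr; lra.
have := ler_wpM2r (enorm_ge0 (x - z)) h2; lra.
Qed.

Lemma prox_is_prox (x : E) : is_prox U lam x (prox U lam x).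
Proof. exact: (xgetPex _ (prox_exists x)). Qed.

Local Notation p := (prox U lam).

(** First-order optimality along the segment from [p x] to [z]: [(x - p x) / lam] is a subgradient
    of [U] at [p x]. *)
Lemma prox_subgradient (x z : E) :
  lam * U (p x) + dot (x - p x) (z - p x) <= lam * U z.
Proof.
set q := p x; set v := z - q.
have H t : 0 < t <= 1 -> 0 <= lam * U z - lam * U q - dot (x - q) v + t * (enorm v ^+ 2 / 2).
  move=> /andP[t0 t1]; have := prox_is_prox x (q + t *: v); rewrite -/q => h1.
  have := cU z q (t := t); rewrite (ltW t0) t1 => /(_ isT).
  have -> : t *: z + (1 - t) *: q = q + t *: v.
    by rewrite scalerBl scale1r /v scalerBr addrCA addrC -addrA.
  rewrite !mul0r subr0 => h2.
  move: h1; have -> : x - (q + t *: v) = (x - q) - t *: v by rewrite opprD addrA.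
  rewrite (enorm_sqrB (x - q)) dotZr enormZ exprMn real_normK ?num_real//.
  set a := enorm (x - q) ^+ 2; set b := enorm v ^+ 2; set D := dot _ _ => h1.
  have l2 : 0 < 2 * lam by rewrite mulr_gt0.
  have h3 : 2 * lam * U q + a <= 2 * lam * U (q + t *: v) + (a - 2 * (t * D) + t ^+ 2 * b).
    have := ler_wpM2l (ltW l2) h1; rewrite !mulrDr.
    by rewrite ![2 * lam * (_ / (2 * lam))]mulrC !divfK// lt0r_neq0.
  have h4 := ler_wpM2l (ltW l2) h2.
  rewrite -(pmulr_rge0 _ t0); lra.
have := ge0_of_small_slope H; lra.
Qed.

(** Sum of the subgradient inequalities at [p x] and [p y], each tested at the other point; the
    values of [U] cancel. *)
Lemma prox_firm (x y : E) :
  enorm ((x - p x) - (y - p y)) ^+ 2 <= dot ((x - p x) - (y - p y)) (x - y).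
Proof.
move: (prox_subgradient x (p y)) (prox_subgradient y (p x)); rewrite sqr_enorm.
move: (p x) (p y) => q r; rewrite !dotE !(dotC _ x) !(dotC _ y) !(dotC _ r) (dotC y x).
move: (dot _ _) (dot _ _) (dot _ _) (dot _ _) (dot _ _) (dot _ _) (dot _ _).
by move=> *; lra.
Qed.

Lemma prox_shift_le (x : E) : enorm (x - p x) <= lam * M.
Proof.
set g := x - p x.
have h1 := prox_subgradient x (p x + g); rewrite -/g addrAC subrr add0r -sqr_enorm in h1.
have := LU (p x + g) (p x); rewrite addrAC subrr add0r ler_norml => /andP[_ h2].
have h3 := ler_wpM2l (ltW lam0) h2.
have h4 : enorm g * enorm g <= lam * M * enorm g by rewrite -expr2; lra.
have := enorm_ge0 g; rewrite le_eqVlt => /predU1P[<-|g0].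
  by rewrite mulr_ge0// ltW.
by rewrite ler_pM2r in h4.
Qed.

End proximal.

(** * The MYULA kernel *)

Section myula_map.
Context {R : realType} {d : nat}.
Local Notation E := 'rV[R]_d.
Variables (V U : E -> R) (L M kappa gam : R).
Hypotheses (dV : forall x, differentiable V x) (cV : mconvex 0 V) (cU : mconvex 0 U).
Hypotheses (L0 : 0 <= L) (M0 : 0 <= M) (kappa0 : 0 < kappa) (gam0 : 0 < gam).
Hypothesis LV : forall x y, enorm (grad V x - grad V y) <= L * enorm (x - y).
Hypothesis LU : forall x y, `|U x - U y| <= M * enorm (x - y).

Local Notation T := (myula_mean V U kappa gam).
Local Notation p := (prox U (gam * kappa)).
Let lam0 : 0 < gam * kappa. Proof. exact: mulr_gt0. Qed.

(** The gradient of the Moreau-Yosida envelope at [x], and at the same time a subgradient of [U] at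
    [p x]. *)
Definition myula_subgrad (x : E) : E := (gam * kappa)^-1 *: (x - p x).
Local Notation g := myula_subgrad.

Lemma myula_meanE (x : E) : T x = x - gam *: grad V x - gam *: g x.
Proof.
rewrite /myula_mean /g scalerA; congr (_ - _ *: _).
by rewrite invfM mulrA mulfV ?mul1r// lt0r_neq0.
Qed.

Lemma myula_subgrad_le (x : E) : enorm (g x) <= M.
Proof.
rewrite /g enormZ ger0_norm ?invr_ge0 ?(ltW lam0)// ler_pdivrMl//.
exact: prox_shift_le.
Qed.

Lemma myula_subgrad_firm (x y : E) :
  gam * kappa * enorm (g x - g y) ^+ 2 <= dot (x - y) (g x - g y).
Proof.
have := prox_firm cU M0 lam0 LU x y; rewrite /g -scalerBr.
set v := _ - _ - _; rewrite enormZ exprMn dotZr real_normK ?num_real// dotC => h.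
have := ler_wpM2l (_ : 0 <= (gam * kappa)^-1) h; rewrite invr_ge0 => /(_ (ltW lam0)).
by rewrite expr2 !mulrA mulfV ?mul1r// lt0r_neq0.
Qed.

(** [A] distributes the admissible total 2: the gradient increment satisfies [|a|^2 <= A <w, a>],
    the proximal one the same with [2 - A], and together [|a + b|^2 <= 2 <w, a + b>]. *)
Lemma myula_mean_nonexpansive (A : R) (x y : E) :
  0 < A < 2 -> gam * L <= A -> kappa^-1 <= 2 - A ->
  enorm (T x - T y) <= enorm (x - y).
Proof.
move=> /andP[A0 A2] gL kA; rewrite -(@ler_pXn2r _ 2)// ?nnegrE ?enorm_ge0//.
pose w := x - y; pose a := gam *: (grad V x - grad V y); pose b := gam *: (g x - g y).
have -> : T x - T y = w - (a + b).
  by rewrite !myula_meanE /w /a /b !scalerBr; apply/rowP => i; rewrite !mxE; ring.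
rewrite enorm_sqrB; have ha : enorm a ^+ 2 <= A * dot w a.
  rewrite /a enormZ exprMn real_normK ?num_real// dotZr.
  have h1 := grad_cocoercive dV cV L0 LV x y; rewrite (dotC _ (x - y)) -/w in h1.
  set D := dot _ _ in h1 *; set Q := enorm _ ^+ 2 in h1 *.
  have Q0 : 0 <= Q by exact: sqr_ge0.
  have D0 : 0 <= D.
    have := convex_grad_ineq dV x y (lexx 0) cV.
    have := convex_grad_ineq dV y x (lexx 0) cV.
    by rewrite /D /w !mul0r !addr0 !dotE !(dotC x) !(dotC y); lra.
  rewrite expr2 -mulrA [leRHS]mulrCA ler_wpM2l ?(ltW gam0)//.
  apply: (@le_trans _ _ (gam * (L * D))); first by rewrite ler_wpM2l// ltW.
  by rewrite mulrA ler_wpM2r.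
have hb : enorm b ^+ 2 <= (2 - A) * dot w b.
  rewrite /b enormZ exprMn real_normK ?num_real// dotZr.
  have h1 := myula_subgrad_firm x y; rewrite -/w in h1.
  set D := dot _ _ in h1 *; set Q := enorm _ ^+ 2 in h1 *.
  have Q0 : 0 <= Q by exact: sqr_ge0.
  have D0 : 0 <= D by apply: le_trans h1; rewrite mulr_ge0// ltW.
  rewrite expr2 -mulrA [leRHS]mulrCA ler_wpM2l ?(ltW gam0)//.
  apply: (@le_trans _ _ (kappa^-1 * D)); last by rewrite ler_wpM2r.
  by rewrite ler_pdivlMl// mulrA (mulrC kappa).
clearbody a b.
(* Convexity of the square with weights [A / 2] and [1 - A / 2]; the gap is
   [|(2 - A) a - A b|^2]. *)
have hab : A * (2 - A) * enorm (a + b) ^+ 2 <=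
    2 * (2 - A) * enorm a ^+ 2 + 2 * A * enorm b ^+ 2.
  have := dot_ge0 ((2 - A) *: a - A *: b).
  rewrite !sqr_enorm !dotE (dotC b a); lra.
have A2A : 0 < A * (2 - A) by rewrite mulr_gt0//; lra.
rewrite dotDr.
suff : enorm (a + b) ^+ 2 <= 2 * (dot w a + dot w b) by lra.
rewrite -(ler_pM2l A2A); apply: le_trans hab _.
have h1 := ler_wpM2l (_ : 0 <= 2 * (2 - A)) ha.
have h2 := ler_wpM2l (_ : 0 <= 2 * A) hb.
have {}h1 := h1 ltac:(lra); have {}h2 := h2 ltac:(lra); lra.
Qed.

Section growth.
Variables (RV : R) (xs : E).
Hypotheses (xs_min : forall z, V xs <= V z) (xs_RV : enorm xs <= RV).
Hypothesis gL1 : gam * L <= 1.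

Lemma grad_minimizer : grad V xs = 0.
Proof.
apply: enorm_eq0; apply/eqP; rewrite -sqrf_eq0 -normr_le0 ger0_norm ?sqr_ge0//.
set G := enorm _ ^+ 2.
suff : 0 <= - G by lra.
apply: (@ge0_of_small_slope _ _ (L / 2 * G)) => t /andP[t0 t1].
have h1 := xs_min (xs - t *: grad V xs).
have h2 := descent_lemma dV LV xs (xs - t *: grad V xs).
have e : xs - t *: grad V xs - xs = - (t *: grad V xs) by rewrite addrAC subrr add0r.
move: h2; rewrite e enormN enormZ exprMn real_normK ?num_real// dotNr dotZr -sqr_enorm -/G => h2.
rewrite -(pmulr_rge0 _ t0); lra.
Qed.

(** Of the inward term [2 gam <x - xs, grad V x>] one half pays for [gam^2 |grad V x|^2], through
    cocoercivity and [gam L <= 1]; the other half is kept against the errors linear in the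
    gradient. *)
Lemma myula_mean_growth (x : E) :
  enorm (T x) ^+ 2 <= enorm x ^+ 2 - gam * dot (x - xs) (grad V x)
    + 2 * gam * (RV + gam * M) * enorm (grad V x) + gam ^+ 2 * M ^+ 2
    - 2 * gam * dot x (g x).
Proof.
set n := enorm (grad V x); set P := dot (x - xs) _.
have n0 : 0 <= n by exact: enorm_ge0.
have nP : n ^+ 2 <= L * P.
  have := grad_cocoercive dV cV L0 LV x xs.
  by rewrite grad_minimizer subr0 dotC.
have P0 : 0 <= P.
  have := convex_grad_ineq dV x xs (lexx 0) cV; rewrite !mul0r addr0.
  by have := xs_min x; rewrite /P !dotE !(dotC (grad V x)); lra.
have hx : dot xs (grad V x) >= - (RV * n).
  have := dot_CS (- xs) (grad V x); rewrite dotNl enormN.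
  have := ler_wpM2r n0 xs_RV; rewrite -/n; lra.
have hn : gam ^+ 2 * n ^+ 2 <= gam * P.
  rewrite expr2 -mulrA ler_wpM2l ?(ltW gam0)//.
  apply: (@le_trans _ _ (gam * (L * P))); first by rewrite ler_wpM2l// ltW.
  by rewrite mulrA -[leRHS]mul1r ler_wpM2r.
have gM := myula_subgrad_le x; have g0 := enorm_ge0 (g x).
have hg : enorm (grad V x + g x) ^+ 2 <= n ^+ 2 + 2 * n * M + M ^+ 2.
  have h := enormD (grad V x) (g x).
  have : enorm (grad V x + g x) <= n + M by rewrite /n; lra.
  rewrite -(@ler_pXn2r _ 2)// ?nnegrE ?enorm_ge0 ?addr_ge0//.
  by move=> h'; apply: le_trans h' _; rewrite sqrrD; lra.
have -> : T x = x - gam *: (grad V x + g x).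
  by rewrite myula_meanE scalerDr opprD addrA.
rewrite enorm_sqrB dotZr dotDr enormZ exprMn real_normK ?num_real//.
have := ler_wpM2l (sqr_ge0 gam) hg.
have -> : dot x (grad V x) = P + dot xs (grad V x).
  by rewrite /P dotDl dotNl subrK.
have := ler_wpM2l (ltW gam0) hx.
lra.
Qed.

(** The inward pull comes from [U]: [g x] is a subgradient at [p x], which lies within [gam kappa M]
    of [x], and [U] grows at rate [eta]. The kept part of the [V] term cancels the errors linear in
    the gradient. *)
Lemma myula_mean_growth_coercive (gbar eta c ku U0 : R) (x : E) :
  gam <= gbar -> kappa <= ku -> 0 <= eta -> 0 <= RV ->
  U 0 <= U0 -> (forall y, eta * enorm y - c <= U y) ->
  enorm (T x) ^+ 2 <= enorm x ^+ 2 - 2 * gam * eta * enorm x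
    + gam * (L * (RV + gbar * M) ^+ 2 + gbar * M ^+ 2
             + 2 * (eta * (gbar * ku * M) + c + U0)).
Proof.
move=> gG kK eta0 RV0 hU0 Ueta.
apply: le_trans (myula_mean_growth x) _.
set n := enorm (grad V x); set P := dot (x - xs) _.
have n0 : 0 <= n by exact: enorm_ge0.
have nP : n ^+ 2 <= L * P.
  have := grad_cocoercive dV cV L0 LV x xs.
  by rewrite grad_minimizer subr0 dotC.
have P0 : 0 <= P.
  have := convex_grad_ineq dV x xs (lexx 0) cV; rewrite !mul0r addr0.
  by have := xs_min x; rewrite /P !dotE !(dotC (grad V x)); lra.
set s := RV + gam * M.
have gM0 : 0 <= gam * M by rewrite mulr_ge0// ltW.
have s0 : 0 <= s by rewrite addr_ge0.
have sG : s <= RV + gbar * M by rewrite lerD2l ler_wpM2r.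
(* Arithmetic-geometric mean for [P] and [L s^2] with [n^2 <= L P]; comparing squares avoids roots
   and a division by [L]. *)
have h1 : 2 * s * n <= P + L * s ^+ 2.
  have Ls : 0 <= L * s ^+ 2 by rewrite mulr_ge0// sqr_ge0.
  rewrite -(@ler_pXn2r _ 2)// ?nnegrE ?addr_ge0 ?mulr_ge0//.
  have h2 := ler_wpM2l (sqr_ge0 s) nP.
  have h3 := sqr_ge0 (P - L * s ^+ 2).
  have -> : (2 * s * n) ^+ 2 = 4 * (s ^+ 2 * n ^+ 2) by ring.
  have -> : (P + L * s ^+ 2) ^+ 2 = (P - L * s ^+ 2) ^+ 2 + 4 * (s ^+ 2 * (L * P)) by ring.
  lra.
have h2 : L * s ^+ 2 <= L * (RV + gbar * M) ^+ 2.
  by rewrite ler_wpM2l// ler_pXn2r// nnegrE// (le_trans s0).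
have h3 : gam * M ^+ 2 <= gbar * M ^+ 2 by rewrite ler_wpM2r// sqr_ge0.
have h4 : eta * enorm x - (eta * (gbar * ku * M) + c + U0) <= dot x (g x).
  have h := prox_subgradient cU M0 lam0 LU x 0.
  have e : dot x (g x) = dot (p x) (g x) + (gam * kappa)^-1 * enorm (x - p x) ^+ 2.
    by rewrite sqr_enorm -dotZr -/(g x) dotDl dotNl addrCA subrr addr0.
  have eb : 0 <= (gam * kappa)^-1 * enorm (x - p x) ^+ 2.
    by rewrite mulr_ge0 ?sqr_ge0// invr_ge0 ltW.
  have e2 : U (p x) - U 0 <= dot (p x) (g x).
    rewrite /g dotZr ler_pdivlMl// dotC.
    by move: h; rewrite sub0r dotNr; lra.
  have hp : enorm x <= enorm (p x) + gbar * ku * M.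
    have hb := prox_shift_le cU M0 lam0 LU x.
    have := enormD (x - p x) (p x); rewrite subrK => hh.
    have : gam * kappa * M <= gbar * ku * M.
      by rewrite ler_wpM2r// ler_pM// ltW.
    lra.
  have := ler_wpM2l eta0 hp; have := Ueta (p x); lra.
have h1' := ler_wpM2l (ltW gam0) h1.
have h2' := ler_wpM2l (ltW gam0) h2.
have h3' := ler_wpM2l (ltW gam0) h3.
have h4' := ler_wpM2l (ltW gam0) h4.
rewrite -/s in h1' *.
lra.
Qed.

(** Strong convexity gives [P >= m/2 |x - xs|^2 >= m/4 |x|^2 - m/2 RV^2]; half of [m/4] absorbs the
    terms linear in [|x|], which leaves [m/8]. *)
Lemma myula_mean_growth_strong (gbar m : R) (x : E) :
  gam <= gbar -> 0 < m -> mconvex m V -> 0 <= RV ->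
  enorm (T x) ^+ 2 <= enorm x ^+ 2 - gam * (m / 8) * enorm x ^+ 2
    + gam * (m / 2 * RV ^+ 2 + 2 * (RV + gbar * M) * L * RV + gbar * M ^+ 2
             + 2 / m * (2 * (RV + gbar * M) * L + 2 * M) ^+ 2).
Proof.
move=> gG m0 sV RV0.
apply: le_trans (myula_mean_growth x) _.
set n := enorm (grad V x); set P := dot (x - xs) _; set e := enorm (x - xs).
set X := enorm x.
have X0 : 0 <= X by exact: enorm_ge0.
have e0 : 0 <= e by exact: enorm_ge0.
have n0 : 0 <= n by exact: enorm_ge0.
have nL : n <= L * e by have := LV x xs; rewrite grad_minimizer subr0.
have Pm : m / 2 * e ^+ 2 <= P.
  have := convex_grad_ineq dV x xs (ltW m0) sV; rewrite enorm_subC -/e.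
  by have := xs_min x; rewrite /P !dotE !(dotC (grad V x)); lra.
have eX : e <= X + RV by apply: le_trans (enormB _ _) _; rewrite lerD2l.
have Xe : X <= e + RV.
  by have := enormD (x - xs) xs; rewrite subrK -/e -/X; have := xs_RV; lra.
set S := RV + gbar * M.
have sS : RV + gam * M <= S by rewrite lerD2l ler_wpM2r.
have gM0 : 0 <= gam * M by rewrite mulr_ge0// ltW.
have S0 : 0 <= S by apply: le_trans sS; rewrite addr_ge0.
have h1 : 2 * (RV + gam * M) * n <= 2 * S * L * (X + RV).
  have : (RV + gam * M) * n <= S * (L * (X + RV)).
    apply: ler_pM => //; first exact: addr_ge0.
    by apply: le_trans nL _; rewrite ler_wpM2l.
  lra.
have gxM : - (M * X) <= dot x (g x).
  have := dot_CS (- x) (g x); rewrite dotNl enormN -/X.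
  by have := ler_wpM2l X0 (myula_subgrad_le x); lra.
have X2 : X ^+ 2 <= 2 * e ^+ 2 + 2 * RV ^+ 2.
  have : X ^+ 2 <= (e + RV) ^+ 2 by rewrite ler_pXn2r ?nnegrE ?addr_ge0.
  by have := sqr_ge0 (e - RV); rewrite sqrrB sqrrD; lra.
have h3 : gam * M ^+ 2 <= gbar * M ^+ 2 by rewrite ler_wpM2r// sqr_ge0.
set K := 2 * S * L + 2 * M.
have KX : K * X <= m / 8 * X ^+ 2 + 2 / m * K ^+ 2.
  have h := sqr_ge0 (m * X - 4 * K).
  have m8 : 0 < 8 * m by lra.
  rewrite -(ler_pM2l m8).
  have -> : 8 * m * (m / 8 * X ^+ 2 + 2 / m * K ^+ 2) = m ^+ 2 * X ^+ 2 + 16 * K ^+ 2.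
    by field; rewrite lt0r_neq0.
  have -> : 8 * m * (K * X) = m ^+ 2 * X ^+ 2 + 16 * K ^+ 2 - (m * X - 4 * K) ^+ 2 by ring.
  lra.
have mX : m / 4 * X ^+ 2 - m / 2 * RV ^+ 2 <= m / 2 * e ^+ 2.
  have := ler_wpM2l (_ : 0 <= m / 4) X2; have m4 : 0 <= m / 4 by lra.
  by move=> /(_ m4); lra.
have main : - P + 2 * (RV + gam * M) * n + gam * M ^+ 2 - 2 * dot x (g x) <=
  - (m / 8 * X ^+ 2) + (m / 2 * RV ^+ 2 + 2 * S * L * RV + gbar * M ^+ 2 + 2 / m * K ^+ 2).
  by move: KX h1; rewrite {1}/K; lra.
have := ler_wpM2l (ltW gam0) main.
lra.
Qed.

End growth.

End myula_map.

(** As gamma tends to 0 both [1 - th] and [b] vanish; bounding their ratio keeps the additive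
    constant [B] independent of gamma and of [n]. *)
Lemma markov_drift_iter {dsp : measure_display} {T : measurableType dsp}
    {R : realType} (K : (T -> \bar R) -> T -> \bar R) (W : T -> R) (th b B : R) n x :
  markov_op K -> mnn (EFin \o W) -> 0 <= th <= 1 -> 0 <= B ->
  b <= (1 - th) * B ->
  (forall y, K (EFin \o W) y <= (th * W y + b)%:E)%E ->
  (iter n K (EFin \o W) x <= (th ^+ n * W x + B)%:E)%E.
Proof.
move=> hK mW /andP[th0 th1] B0 bB KW.
have thn k : 0 <= th ^+ k by exact: exprn_ge0.
have thn1 k : th ^+ k <= 1 by rewrite exprn_ile1.
suff : (iter n K (EFin \o W) x <= (th ^+ n * W x + (1 - th ^+ n) * B)%:E)%E.
  move=> /le_trans; apply; rewrite lee_fin lerD2l ler_piMl//.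
  by have := thn n; lra.
elim: n x => [|n ih] x /=; first by rewrite lee_fin expr0 mul1r subrr mul0r addr0.
pose c := (1 - th ^+ n) * B.
have c0 : 0 <= c by rewrite mulr_ge0// subr_ge0.
have m1 := mnn_scale (thn n) mW.
have mc : mnn (fun _ : T => c%:E * 1)%E by apply: mnn_scale => //; exact: (mnn_cst ler01).
have m2 := mnn_add m1 mc.
apply: le_trans (pf_le (po_pos hK x) (po_mnn (markov_op_iter n hK) mW) m2 _) _.
  by move=> y /=; apply: le_trans (ih y) _; rewrite EFinD EFinM mule1.
rewrite (pf_add (po_pos hK x) m1 mc) (pf_scale (po_pos hK x) (thn n) mW).
rewrite (pf_scale (po_pos hK x) c0 (mnn_cst ler01)) (mo_one hK) mule1.
apply: le_trans (leeD2r _ (lee_wpmul2l _ (KW x))) _; first by rewrite lee_fin.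
rewrite -EFinM -EFinD lee_fin exprS /c.
have := ler_wpM2l (thn n) bB; lra.
Qed.

(** The conclusion for one kernel, with the test function still quantified; the suprema in [Wnorm]
    are taken only at the end. *)
Definition ergodic_bounds {R : realType} {d : nat} (A rho gam : R)
    (W : 'rV[R]_d -> R) (K : ('rV[R]_d -> \bar R) -> 'rV[R]_d -> \bar R) :=
  exists P : probability 'rV[R]_d R, invariant_prob K P /\
  forall n x y (f : 'rV[R]_d -> R), measurable_fun setT f ->
  (forall z, `|f z| <= W z) ->
  (`|iter_int K n f x - \int[P]_z (f z)%:E| <=
     (A * rho `^ (gam * n%:R) * W x)%:E)%E /\
  (`|iter_int K n f x - iter_int K n f y| <=
     (A * rho `^ (gam * n%:R) * (W x + W y))%:E)%E.

Lemma ergodic_bounds_equiv {R : realType} {d : nat} (A rho gam c : R)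
    (W W' : 'rV[R]_d -> R) (K : ('rV[R]_d -> \bar R) -> 'rV[R]_d -> \bar R) :
  0 <= A -> (forall x, W x <= W' x) -> (forall x, W' x <= c * W x) ->
  ergodic_bounds A rho gam W' K -> ergodic_bounds (A * c) rho gam W K.
Proof.
move=> A0 WW' W'W [P [invP H]]; exists P; split=> // n x y f mf fW.
have [|h1 h2] := H n x y f mf; first by move=> z; exact: le_trans (WW' z).
have r0 : 0 <= A * rho `^ (gam * n%:R) by rewrite mulr_ge0// powR_ge0.
split.
  apply: le_trans h1 _; rewrite lee_fin.
  have := ler_wpM2l r0 (W'W x); lra.
apply: le_trans h2 _; rewrite lee_fin.
have := ler_wpM2l r0 (W'W x); have := ler_wpM2l r0 (W'W y); lra.
Qed.

(** * Uniform ergodicity of Gaussian steps from a concave Lyapunov exponent *)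

Section gauss_ergodic.
Context {R : realType} {d : nat}.
Local Notation E := 'rV[R]_d.
Variables (Psi p : R -> R) (N2 e0 R1 C gbar : R).
Hypotheses (N2_ge1 : 1 <= N2) (e0_gt0 : 0 < e0) (C0 : 0 <= C) (gbar0 : 0 < gbar).
Hypothesis R1_ge0 : 0 <= R1.
Hypothesis mPsi : measurable_fun setT Psi.
Hypothesis Psi0 : forall r, N2 <= r -> 0 <= Psi r.
Hypothesis p0 : forall r, N2 <= r -> 0 <= p r.
Hypothesis pgbar : forall r, N2 <= r -> 4 * p r * gbar <= 2^-1.
Hypothesis pe0 : forall r, N2 <= r -> 8 * p r ^+ 2 * (r - N2) + 4 * p r * d%:R <= e0.
Hypothesis tangent : forall r r', N2 <= r -> N2 <= r' ->
  Psi r' <= Psi r + p r * (r' - r).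
Hypothesis coercive : forall B, exists D, forall r, N2 <= r -> Psi r <= B -> r <= D.

Let rad (x : E) := N2 + enorm x ^+ 2.
Let W (x : E) := expR (Psi (rad x)).

Let radN x : N2 <= rad x. Proof. by rewrite lerDl sqr_ge0. Qed.

Let mW : measurable_fun setT W.
Proof.
apply: measurableT_comp => //; apply: (measurableT_comp mPsi).
apply: measurable_funD => //; apply: measurable_funX; exact: measurable_enorm.
Qed.

Let W1 x : 1 <= W x.
Proof. by rewrite -expR0 ler_expR; exact/Psi0/radN. Qed.

(** Concavity enters twice: the tangent at [T x] for the Gaussian average, the tangent at [x] to
    compare [T x] with [x]. *)
Let drift_step (T : E -> E) (gam : R) x (k : R) :
  0 < gam -> gam <= gbar -> p (rad x) * (enorm (T x) ^+ 2 - enorm x ^+ 2) <= k ->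
  (gauss_op T (2 * gam) (EFin \o W) x <= (expR (k + e0 * gam) * W x)%:E)%E.
Proof.
move=> g0 gG hk.
have P0 := p0 (radN (T x)).
have h := @gauss_drift R d (T x) Psi N2 (p (rad (T x))) gam g0 P0.
apply: le_trans (h _ _ mW) _.
- apply: le_trans (pgbar (radN (T x))); apply: ler_wpM2l => //.
  exact: mulr_ge0.
- move=> y; have := tangent (radN (T x)) (radN y).
  by rewrite /rad opprD addrACA subrr add0r.
rewrite lee_fin -expRD ler_expR.
have h1 : 8 * p (rad (T x)) ^+ 2 * enorm (T x) ^+ 2 + 4 * p (rad (T x)) * d%:R <= e0.
  by have := pe0 (radN (T x)); rewrite {2}/rad addrAC subrr add0r.
have h2 := tangent (radN x) (radN (T x)).
have h3 : rad (T x) - rad x = enorm (T x) ^+ 2 - enorm x ^+ 2.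
  by rewrite /rad opprD addrACA subrr add0r.
rewrite h3 in h2; rewrite -/(rad (T x)).
have := ler_wpM2r (ltW g0) h1; lra.
Qed.

(** [Wm] bounds the weight on the ball of radius [R1]. There [exp u - exp v <= (u - v) exp u] makes
    the excess over the contracted weight at most [b1 gam], and [1 - exp (- t) >= t / (1 + t)] at
    [t = e0 gam] turns [b1] into [B]. *)
Let Wm := expR (Psi N2 + p N2 * R1 ^+ 2).
Let b1 := (C + 2 * e0) * expR ((C + e0) * gbar) * Wm.
Let B := b1 * (1 + e0 * gbar) / e0.

Let b1_ge0 : 0 <= b1.
Proof.
have := C0; have := e0_gt0 => ? ?.
by rewrite /b1 mulr_ge0 ?expR_ge0// mulr_ge0 ?expR_ge0//; lra.
Qed.

Let B_ge0 : 0 <= B.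
Proof.
rewrite /B divr_ge0 ?(ltW e0_gt0)// mulr_ge0// addr_ge0// mulr_ge0//; exact: ltW.
Qed.

Let drift (T : E -> E) (gam : R) x :
  0 < gam -> gam <= gbar ->
  (forall x, p (rad x) * (enorm (T x) ^+ 2 - enorm x ^+ 2) <= gam * C) ->
  (forall x, R1 <= enorm x ->
     p (rad x) * (enorm (T x) ^+ 2 - enorm x ^+ 2) <= - (2 * e0) * gam) ->
  (gauss_op T (2 * gam) (EFin \o W) x <= (expR (- (e0 * gam)) * W x + b1 * gam)%:E)%E.
Proof.
move=> g0 gG hC hR.
case: (leP R1 (enorm x)) => xR.
  apply: le_trans (drift_step g0 gG (hR x xR)) _; rewrite lee_fin.
  have -> : - (2 * e0) * gam + e0 * gam = - (e0 * gam) by ring.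
  by rewrite lerDl mulr_ge0// ltW.
apply: le_trans (drift_step g0 gG (hC x)) _; rewrite lee_fin.
have C0' := C0; have e0' := e0_gt0.
have Wx : W x <= Wm.
  rewrite ler_expR; apply: le_trans (tangent (lexx N2) (radN x)) _.
  rewrite lerD2l /rad addrAC subrr add0r ler_wpM2l ?p0//.
  by rewrite ler_pXn2r ?nnegrE ?enorm_ge0// ltW.
set u := gam * C + e0 * gam; set v := - (e0 * gam).
have uv : expR u - expR v <= (C + 2 * e0) * gam * expR ((C + e0) * gbar).
  have h1 : expR u - expR v <= (u - v) * expR u.
    have := expR_ge1Dx (v - u); rewrite expRD expRN => h.
    have := ler_wpM2r (expR_ge0 u) h; rewrite divfK ?gt_eqF ?expR_gt0//; lra.
  apply: le_trans h1 _.
  have -> : u - v = (C + 2 * e0) * gam by rewrite /u /v; ring.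
  rewrite ler_wpM2l//; first by rewrite mulr_ge0 ?(ltW g0)//; lra.
  rewrite ler_expR /u.
  have -> : gam * C + e0 * gam = (C + e0) * gam by ring.
  by rewrite ler_wpM2l//; lra.
have W0 : 0 <= W x by exact: expR_ge0.
have h1 := ler_wpM2r W0 uv.
have K0 : 0 <= (C + 2 * e0) * gam * expR ((C + e0) * gbar).
  by rewrite mulr_ge0 ?expR_ge0// mulr_ge0 ?(ltW g0)//; lra.
have h2 := ler_wpM2l K0 Wx.
rewrite /b1; lra.
Qed.

Let lam := expR (- e0).

Let lam01 : 0 <= lam < 1.
Proof. by rewrite expR_ge0/= /lam -expR0 ltr_expR oppr_lt0. Qed.

Lemma gauss_ergodic : exists A rho : R, [/\ 0 <= A, 0 < rho < 1 &
  forall (T : E -> E) (gam : R),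
  (forall x y, enorm (T x - T y) <= enorm (x - y)) ->
  0 < gam <= gbar ->
  (forall x, p (N2 + enorm x ^+ 2) * (enorm (T x) ^+ 2 - enorm x ^+ 2) <= gam * C) ->
  (forall x, R1 <= enorm x ->
     p (N2 + enorm x ^+ 2) * (enorm (T x) ^+ 2 - enorm x ^+ 2) <= - (2 * e0) * gam) ->
  ergodic_bounds A rho gam (fun x => expR (Psi (N2 + enorm x ^+ 2)))
    (gauss_op T (2 * gam))].
Proof.
have /andP[lam0 lam1] := lam01.
pose Rad := 4 * B / (1 - lam) + 1.
have B0 := B_ge0.
have Rad0 : 0 < Rad by rewrite ltr_wpDl// divr_ge0//; lra.
have bRad : 4 * B <= (1 - lam) * Rad.
  have -> : (1 - lam) * Rad = 4 * B + (1 - lam).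
    by rewrite /Rad; field; rewrite lt0r_neq0// subr_gt0.
  lra.
have [D HD] := coercive (ln Rad).
(* Small weights confine both points to [|z|^2 <= |D|], so [|x - y|^2 <= 4 |D|]; the total variance
   [2 gam m] is at least 2, which leaves [2 |D|] in the exponent. *)
pose eps := (4 * expR (2 * `|D|))^-1.
have eps01 : 0 < eps <= 1.
  have h1 : 1 <= expR (2 * `|D|) by rewrite -expR0 ler_expR mulr_ge0.
  by rewrite /eps invr_gt0 mulr_gt0 ?expR_gt0//= invf_le1//; lra.
have [A [r [A0 [r01 H]]]] := @harris _ E R 0 lam B eps Rad lam01 B_ge0 eps01 Rad0 bRad.
have /andP[r0 r1] := r01.
pose G := 1 + gbar.
have G0 : 0 < G by have := gbar0; rewrite /G; lra.
(* A block of [m] steps lasts at most time [G], so [gam n <= (n %/ m + 1) G]; the extra unit in the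
   exponent is paid for by [1 / r]. *)
exists (A / r), (r `^ G^-1); split.
- by rewrite divr_ge0// ltW.
- rewrite powR_gt0//=.
  have := @gt0_ltr_powR R G^-1 (_ : 0 < G^-1) r 1; rewrite !nnegrE powR1.
  by rewrite invr_gt0 => /(_ G0); apply => //; exact: ltW.
move=> T gam Tn /andP[g0 gG] hC hR.
have s20 : 0 < 2 * gam by rewrite mulr_gt0.
have mT := nonexpansive_measurable Tn.
have hK := markov_op_gauss mT s20.
(* Gives [1 <= gam m <= 1 + gbar], the time needed to contract and to minorize. *)
pose m := (Num.truncn gam^-1).+1.
have gi0 : 0 <= gam^-1 by rewrite invr_ge0 ltW.
have gm1 : 1 <= m%:R * gam.
  by rewrite -ler_pdivrMr// div1r ltW// truncnS_gt.
have gmG : m%:R * gam <= G.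
  rewrite /m -natr1 mulrDl mul1r /G lerD//.
    have h : (Num.truncn gam^-1)%:R <= gam^-1 :> R by rewrite truncn_le.
    by have := ler_wpM2r (ltW g0) h; rewrite mulVf ?lt0r_neq0.
have thE n : expR (- (e0 * gam)) ^+ n = expR (- (e0 * (n%:R * gam))).
  by rewrite -expRM_natl; congr expR; ring.
have mnW : mnn (EFin \o W) by exact: (mnn_W mW W1).
have th01 : 0 <= expR (- (e0 * gam)) <= 1.
  by rewrite expR_ge0/= -expR0 ler_expR oppr_le0 mulr_ge0// ltW.
have bB : b1 * gam <= (1 - expR (- (e0 * gam))) * B.
  have eg0 : 0 < e0 * gam by rewrite mulr_gt0.
  have h1 : e0 * gam / (1 + e0 * gam) <= 1 - expR (- (e0 * gam)).
    have h2 : expR (- (e0 * gam)) <= (1 + e0 * gam)^-1.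
      by rewrite expRN lef_pV2 ?posrE ?expR_gt0 ?expR_ge1Dx//; lra.
    have -> : e0 * gam / (1 + e0 * gam) = 1 - (1 + e0 * gam)^-1.
      by field; rewrite gt_eqF//; lra.
    by rewrite lerD2l lerN2.
  apply: le_trans (ler_wpM2r B_ge0 h1).
  have -> : e0 * gam / (1 + e0 * gam) * B =
      b1 * gam * ((1 + e0 * gbar) / (1 + e0 * gam)).
    by rewrite /B; field; rewrite !gt_eqF//; have := e0_gt0; lra.
  have h2 : 1 <= (1 + e0 * gbar) / (1 + e0 * gam).
    rewrite ler_pdivlMr ?mul1r; last by lra.
    by rewrite lerD2l ler_wpM2l// ltW.
  by rewrite ler_peMr// mulr_ge0// ltW.
have iterW n x : (iter n (gauss_op T (2 * gam)) (EFin \o W) x <=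
    (expR (- (e0 * gam)) ^+ n * W x + B)%:E)%E.
  apply: (markov_drift_iter (b := b1 * gam)) => // y.
  exact: (drift y g0 gG hC hR).
have [||x y SR f mf f01|P [invP HP]] := H (gauss_op T (2 * gam)) W m hK mW W1 (ltn0Sn _).
- move=> n x; apply: le_trans (iterW n x) _; rewrite lee_fin lerD2r.
  have W0 : 0 <= W x by exact: expR_ge0.
  by rewrite ler_piMl// thE -expR0 ler_expR oppr_le0 !mulr_ge0// ltW.
- move=> x; apply: le_trans (iterW m x) _; rewrite lee_fin lerD2r ler_wpM2r ?expR_ge0//.
  by rewrite thE /lam ler_expR lerN2 ler_peMr// ltW.
- apply: (gauss_minorization mT s20 Tn mf f01 (ltn0Sn _)).
  have bd z z' : W z + W z' <= Rad -> enorm z ^+ 2 <= `|D|.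
    move=> h; apply: le_trans (ler_norm D); apply: le_trans (HD (rad z) (radN z) _).
      by rewrite /rad lerDr; have := N2_ge1; lra.
    rewrite -ler_expR lnK ?posrE// -/(W z).
    by have := W1 z'; lra.
  have hx := bd x y SR; have hy : enorm y ^+ 2 <= `|D| by apply: (bd y x); rewrite addrC.
  have hxy : enorm (x - y) ^+ 2 <= 4 * `|D|.
    have := dot_ge0 (x + y); rewrite enorm_sqrB !dotE -!sqr_enorm (dotC y x); lra.
  have gm2 : 2 <= 2 * gam * m%:R by lra.
  rewrite -/m ler_pdivrMr; last by lra.
  apply: le_trans hxy _.
  have := ler_wpM2l (normr_ge0 D) gm2; lra.
exists P; split=> // n x y f mf fW.
have [h1 h2] := HP n x y f mf fW.
have key : A * r ^+ (n %/ m) <= A / r * (r `^ G^-1) `^ (gam * n%:R).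
  rewrite -mulrA ler_wpM2l// ler_pdivlMl// -exprS -powRrM -powR_mulrn ?(ltW r0)//.
  apply: ger_powR; first by rewrite r0/= ltW.
  rewrite mulrC ler_pdivrMr//.
  have hn : (n%:R : R) <= (n %/ m).+1%:R * m%:R.
    by rewrite -natrM ler_nat ltnW// ltn_ceil.
  have := ler_wpM2l (ltW g0) hn.
  have := ler_wpM2l (ler0n R (n %/ m).+1) gmG.
  lra.
have W0 z : 0 <= W z by exact: expR_ge0.
split.
  apply: le_trans h1 _; rewrite lee_fin ler_wpM2r//.
apply: le_trans h2 _; rewrite lee_fin ler_wpM2r// addr_ge0//.
Qed.

End gauss_ergodic.

(** * The exponential and the polynomial Lyapunov function *)

Section lyapunov_functions.
Context {R : realType} {d : nat}.
Local Notation E := 'rV[R]_d.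

Lemma sqrt_tangent (r r' : R) : 0 < r -> 0 <= r' ->
  Num.sqrt r' <= Num.sqrt r + (2 * Num.sqrt r)^-1 * (r' - r).
Proof.
move=> r0 r'0; have s0 : 0 < Num.sqrt r by rewrite sqrtr_gt0.
have e1 := sqr_sqrtr (ltW r0); have e2 := sqr_sqrtr r'0.
rewrite -[X in X - r]e2 -[X in _ - X]e1.
set s := Num.sqrt r in s0 *; set s' := Num.sqrt r'.
rewrite -subr_ge0.
have -> : s + (2 * s)^-1 * (s' ^+ 2 - s ^+ 2) - s' = (2 * s)^-1 * (s - s') ^+ 2.
  by field; rewrite lt0r_neq0.
by rewrite mulr_ge0 ?sqr_ge0// invr_ge0 mulr_ge0// ltW.
Qed.

Lemma ln_tangent (r r' : R) : 0 < r -> 0 < r' -> ln r' <= ln r + r^-1 * (r' - r).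
Proof.
move=> r0 r'0; have q0 : 0 < r' / r by rewrite divr_gt0.
have := le_ln1Dx (_ : -1 < r' / r - 1).
rewrite [1 + _]addrC subrK => /(_ ltac:(lra)).
rewrite ln_div ?posrE// => h.
have -> : r^-1 * (r' - r) = r' / r - 1 by field; rewrite lt0r_neq0.
lra.
Qed.

Lemma gauss_ergodic_exp (al eta C3 gbar : R) :
  0 < al -> 0 < eta -> al < eta / 8 -> 0 <= C3 -> 0 < gbar ->
  exists A rho : R, [/\ 0 <= A, 0 < rho < 1 &
  forall (T : E -> E) (gam : R),
  (forall x y, enorm (T x - T y) <= enorm (x - y)) ->
  0 < gam <= gbar ->
  (forall x, enorm (T x) ^+ 2 <=
     enorm x ^+ 2 - 2 * gam * eta * enorm x + gam * C3) ->
  ergodic_bounds A rho gam (fun x => expR (al * Num.sqrt (1 + enorm x ^+ 2)))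
    (gauss_op T (2 * gam))].
Proof.
move=> al0 eta0 al_eta C30 gbar0.
(* [4 al gbar] secures [pgbar], and [16 d / eta] makes the dimension term at most [al eta / 8]. The
   existential keeps [N] opaque until [NE] is rewritten. *)
have [N NE] : exists N, N = 1 + 16 * d%:R / eta + 4 * al * gbar
  by exists (1 + 16 * d%:R / eta + 4 * al * gbar).
have d0 : 0 <= (d%:R : R) by exact: ler0n.
have ag0 : 0 <= al * gbar by rewrite mulr_ge0// ltW.
have de0 : 0 <= d%:R / eta by rewrite divr_ge0// ltW.
have N1 : 1 <= N by rewrite NE; lra.
have N0 : 0 < N by lra.
have Nsq : Num.sqrt (N ^+ 2) = N by rewrite sqrtr_sqr ger0_norm// ltW.
have N2_1 : 1 <= N ^+ 2 by rewrite exprn_ege1.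
have sqN r : N ^+ 2 <= r -> N <= Num.sqrt r.
  by move=> h; rewrite -{1}Nsq ler_wsqrtr.
pose p (r : R) := al / (2 * Num.sqrt r).
(* Beyond it [2 eta |x| - C3 >= 3/2 eta sqrt r], because [sqrt r <= N + |x|]. *)
pose R1 := 2 * C3 / eta + 3 * N.
have Ce0 : 0 <= C3 / eta by rewrite divr_ge0// ltW.
have R10 : 0 <= R1 by rewrite /R1; lra.
(* Noise: [2 al^2 <= al eta / 4], where [al < eta / 8] enters, plus [al eta / 8] from the dimension.
   Drift: the slope [al / (2 sqrt r)] times [3/2 eta sqrt r] is exactly [2 e0]. *)
pose e0 := 3 / 8 * (al * eta).
have ae0 : 0 < al * eta by rewrite mulr_gt0.
have e00 : 0 < e0 by rewrite /e0; lra.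
have sr0 r : N ^+ 2 <= r -> 0 < Num.sqrt r by move=> /sqN; lra.
have r_gt0 r : N ^+ 2 <= r -> 0 < r by lra.
have p0 r : N ^+ 2 <= r -> 0 <= p r.
  by move=> /sr0 h; rewrite /p divr_ge0 ?(ltW al0)// mulr_ge0// ltW.
have pN r : N ^+ 2 <= r -> p r <= al / (2 * N).
  move=> h; rewrite /p ler_wpM2l ?(ltW al0)// lef_pV2 ?posrE ?mulr_gt0 ?sr0//.
  by rewrite ler_pM2l ?sqN.
have [||||||||A [rho [A0 rho01 H]]] := @gauss_ergodic R d (fun r => al * Num.sqrt r) p
    (N ^+ 2) e0 R1 (al * C3) gbar N2_1 e00 _ gbar0 R10.
- by rewrite mulr_ge0// ltW.
- apply: measurable_funM => //; apply: continuous_measurable_fun.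
  exact: sqrt_continuous.
- by move=> r _; rewrite mulr_ge0 ?sqrtr_ge0// ltW.
- exact: p0.
- move=> r h; have h1 := pN r h.
  have h2 : 4 * (al / (2 * N)) * gbar <= 2^-1.
    have -> : 4 * (al / (2 * N)) * gbar = 2 * (al * gbar) / N by field; rewrite lt0r_neq0.
    by rewrite ler_pdivrMr// NE; lra.
  apply: le_trans h2; rewrite ler_wpM2r ?(ltW gbar0)//; lra.
- move=> r h.
  have h1 : 8 * p r ^+ 2 * (r - N ^+ 2) <= 2 * al ^+ 2.
    have s0 := sr0 r h.
    have -> : 2 * al ^+ 2 = 8 * p r ^+ 2 * r.
      rewrite -[X in _ = _ * X](sqr_sqrtr (ltW (r_gt0 r h))) /p.
      by field; rewrite lt0r_neq0.
    rewrite ler_wpM2l//; first by rewrite mulr_ge0// sqr_ge0.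
    by rewrite lerBlDr lerDl sqr_ge0.
  have h2 : 4 * p r * d%:R <= 2 * al * (d%:R / N).
    have h3 := ler_wpM2r d0 (pN r h).
    have e : al / (2 * N) * d%:R = 2^-1 * (al * (d%:R / N)) by field; rewrite lt0r_neq0.
    rewrite e in h3; lra.
  have h4 : d%:R / N <= eta / 16.
    rewrite ler_pdivrMr// NE.
    have e : eta / 16 * (1 + 16 * d%:R / eta + 4 * al * gbar) =
       d%:R + eta / 16 * (1 + 4 * (al * gbar)) by field; rewrite lt0r_neq0.
    by rewrite e lerDl mulr_ge0//; lra.
  have h5 := ler_wpM2l (ltW al0) h4.
  have h6 := ler_wpM2l (ltW al0) (ltW al_eta).
  rewrite /e0 expr2 in h1 *; lra.
- move=> r r' h h'; rewrite -mulrA ?mulrDr.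
  have := ler_wpM2l (ltW al0) (sqrt_tangent (r_gt0 r h) (ltW (r_gt0 r' h'))).
  by rewrite /p; lra.
- move=> B; exists ((B / al) ^+ 2) => r h hB.
  have s0 := sr0 r h.
  have sB : Num.sqrt r <= B / al by rewrite ler_pdivlMr// mulrC.
  rewrite -[r](sqr_sqrtr (ltW (r_gt0 r h))).
  by rewrite ler_pXn2r// nnegrE ?(ltW s0)// (le_trans (ltW s0)).
have A1 : 0 <= A * expR (al * N) by rewrite mulr_ge0// expR_ge0.
exists (A * expR (al * N)), rho; split=> // T gam Tn g01 TC.
have /andP[g0 gG] := g01.
apply: (ergodic_bounds_equiv (W' := fun x => expR (al * Num.sqrt (N ^+ 2 + enorm x ^+ 2)))) => //.
- move=> x; rewrite ler_expR ler_wpM2l ?(ltW al0)// ler_wsqrtr//.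
  by rewrite lerD2r.
- move=> x; rewrite -expRD ler_expR -mulrDr ler_wpM2l ?(ltW al0)//.
  have x2 := sqr_ge0 (enorm x).
  set s := Num.sqrt (1 + _); have s0 : 0 <= s by exact: sqrtr_ge0.
  have sE : s ^+ 2 = 1 + enorm x ^+ 2 by rewrite sqr_sqrtr//; lra.
  rewrite -(@ler_pXn2r _ 2)// ?nnegrE ?sqrtr_ge0 ?addr_ge0 ?(ltW N0)//.
  rewrite sqr_sqrtr; last by lra.
  rewrite [leRHS]sqrrD sE.
  have : 0 <= N * s by rewrite mulr_ge0// ltW.
  lra.
have rN (x : E) : N ^+ 2 <= N ^+ 2 + enorm x ^+ 2 by rewrite lerDl sqr_ge0.
apply: H => // x.
- have h1 : enorm (T x) ^+ 2 - enorm x ^+ 2 <= gam * C3.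
    have : 0 <= 2 * gam * eta * enorm x.
      by rewrite !mulr_ge0 ?enorm_ge0// ltW.
    by have := TC x; lra.
  apply: le_trans (ler_wpM2l (p0 _ (rN x)) h1) _.
  have gC : 0 <= gam * C3 by rewrite mulr_ge0// ltW.
  rewrite mulrCA ler_wpM2l ?(ltW g0)// ler_wpM2r//.
  apply: le_trans (pN _ (rN x)) _.
  by rewrite ler_pdivrMr ?mulr_gt0// ler_peMr ?(ltW al0)//; lra.
move=> xR.
set r := N ^+ 2 + enorm x ^+ 2; have s0 := sr0 _ (rN x); rewrite -/r in s0.
have X0 := enorm_ge0 x.
have sX : Num.sqrt r <= N + enorm x.
  rewrite -(@ler_pXn2r _ 2)// ?nnegrE ?sqrtr_ge0 ?addr_ge0 ?(ltW N0)//.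
  rewrite sqr_sqrtr ?(ltW (r_gt0 _ (rN x)))// /r [leRHS]sqrrD.
  have : 0 <= N * enorm x by rewrite mulr_ge0// ltW.
  lra.
have hX : 3 / 2 * eta * Num.sqrt r <= 2 * eta * enorm x - C3.
  have h1 := ler_wpM2l (ltW eta0) sX; have h2 := ler_wpM2l (ltW eta0) xR.
  have e : eta * R1 = 2 * C3 + 3 * (eta * N) by rewrite /R1; field; rewrite lt0r_neq0.
  rewrite e in h2; lra.
have h1 : enorm (T x) ^+ 2 - enorm x ^+ 2 <= - (gam * (3 / 2 * eta * Num.sqrt r)).
  by have := TC x; have := ler_wpM2l (ltW g0) hX; lra.
apply: le_trans (ler_wpM2l (p0 _ (rN x)) h1) _; rewrite -/r.
have -> : p r * - (gam * (3 / 2 * eta * Num.sqrt r)) = - (2 * e0) * gam.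
  by rewrite /p /e0; field; rewrite lt0r_neq0.
exact: lexx.
Qed.

Lemma gauss_ergodic_poly (q c' C2 gbar : R) :
  0 < q -> 0 < c' -> 0 <= C2 -> 0 < gbar ->
  exists N2 A rho : R, [/\ 1 <= N2, 0 <= A, 0 < rho < 1 &
  forall (T : E -> E) (gam : R),
  (forall x y, enorm (T x - T y) <= enorm (x - y)) ->
  0 < gam <= gbar ->
  (forall x, enorm (T x) ^+ 2 <=
     enorm x ^+ 2 - gam * c' * enorm x ^+ 2 + gam * C2) ->
  ergodic_bounds A rho gam (fun x => (N2 + enorm x ^+ 2) `^ q)
    (gauss_op T (2 * gam))].
Proof.
move=> q0 c0 C20 gbar0.
have d0 : 0 <= (d%:R : R) by exact: ler0n.
(* [8 q gbar] secures [pgbar]; the last term brings the noise, at most [(8 q + 4 d) q / N], below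
   [q c' / 4]. *)
have [N NE] : exists N, N = 1 + 8 * q * gbar + 4 * (8 * q + 4 * d%:R) / c'
  by exists (1 + 8 * q * gbar + 4 * (8 * q + 4 * d%:R) / c').
have qg0 : 0 <= q * gbar by rewrite mulr_ge0// ltW.
have dc0 : 0 <= (8 * q + 4 * d%:R) / c' by rewrite divr_ge0 ?(ltW c0)//; lra.
have N1 : 1 <= N by rewrite NE; lra.
have N0 : 0 < N by lra.
pose p (r : R) := q / r.
(* Beyond it [c' |x|^2 - C2 >= c' / 2 (N + |x|^2)]; it is at least 1 so that [|x| <= |x|^2]. *)
pose R1 := 2 * C2 / c' + N + 1.
have Cc0 : 0 <= C2 / c' by rewrite divr_ge0// ltW.
have R11 : 1 <= R1 by rewrite /R1; lra.
have R10 : 0 <= R1 by lra.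
pose e0 := q * c' / 4.
have qc0 : 0 < q * c' by rewrite mulr_gt0.
have e00 : 0 < e0 by rewrite /e0; lra.
have r_gt0 r : N <= r -> 0 < r by lra.
have p0 r : N <= r -> 0 <= p r.
  by move=> h; rewrite /p divr_ge0 ?(ltW q0)// ltW// r_gt0.
have pN r : N <= r -> p r <= q / N.
  by move=> h; rewrite /p ler_wpM2l ?(ltW q0)// lef_pV2 ?posrE// r_gt0.
have expE r : N <= r -> expR (q * ln r) = r `^ q.
  by move=> h; rewrite /powR gt_eqF// r_gt0.
have [||||||||A [rho [A0 rho01 H]]] := @gauss_ergodic R d (fun r => q * ln r) p
    N e0 R1 (q * C2) gbar N1 e00 _ gbar0 R10.
- by rewrite mulr_ge0// ltW.
- by apply: measurable_funM => //; exact: measurable_ln.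
- by move=> r h; rewrite mulr_ge0 ?(ltW q0)// ln_ge0//; lra.
- exact: p0.
- move=> r h; have h1 := pN r h.
  have h2 : 4 * (q / N) * gbar <= 2^-1.
    have -> : 4 * (q / N) * gbar = 4 * (q * gbar) / N by field; rewrite lt0r_neq0.
    by rewrite ler_pdivrMr// NE; lra.
  apply: le_trans h2; rewrite ler_wpM2r ?(ltW gbar0)//; lra.
- move=> r h; have rp := r_gt0 r h.
  have h1 : 8 * p r ^+ 2 * (r - N) <= 8 * q * (q / N).
    apply: (@le_trans _ _ (8 * p r ^+ 2 * r)).
      rewrite ler_wpM2l//; first by rewrite mulr_ge0// sqr_ge0.
      by lra.
    have -> : 8 * p r ^+ 2 * r = 8 * q * p r by rewrite /p; field; rewrite lt0r_neq0.
    by rewrite ler_wpM2l ?pN//; lra.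
  have h2 := ler_wpM2r d0 (pN r h).
  have h3 : (8 * q + 4 * d%:R) * (q / N) <= e0.
    have -> : (8 * q + 4 * d%:R) * (q / N) = q * ((8 * q + 4 * d%:R) / N).
      by field; rewrite lt0r_neq0.
    rewrite /e0 -mulrA ler_wpM2l ?(ltW q0)// ler_pdivrMr// NE.
    have -> : c' / 4 * (1 + 8 * q * gbar + 4 * (8 * q + 4 * d%:R) / c') =
      (8 * q + 4 * d%:R) + c' / 4 * (1 + 8 * (q * gbar)) by field; rewrite lt0r_neq0.
    by rewrite lerDl mulr_ge0//; lra.
  lra.
- move=> r r' h h'.
  have := ler_wpM2l (ltW q0) (ln_tangent (r_gt0 r h) (r_gt0 r' h')).
  by rewrite /p; lra.
- move=> B; exists (expR (B / q)) => r h hB.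
  rewrite -[r]lnK ?posrE ?r_gt0// ler_expR ler_pdivlMr// mulrC//.
exists N, A, rho; split=> // T gam Tn g01 TC.
have /andP[g0 gG] := g01.
have rN (x : E) : N <= N + enorm x ^+ 2 by rewrite lerDl sqr_ge0.
have -> : (fun x : E => (N + enorm x ^+ 2) `^ q) =
    (fun x => expR (q * ln (N + enorm x ^+ 2))).
  by apply/funext => x; rewrite expE.
apply: H => // x.
- have h1 : enorm (T x) ^+ 2 - enorm x ^+ 2 <= gam * C2.
    have : 0 <= gam * c' * enorm x ^+ 2.
      by rewrite mulr_ge0 ?sqr_ge0// mulr_ge0// ltW.
    by have := TC x; lra.
  apply: le_trans (ler_wpM2l (p0 _ (rN x)) h1) _.
  rewrite mulrCA ler_wpM2l ?(ltW g0)// ler_wpM2r//.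
  apply: le_trans (pN _ (rN x)) _.
  by rewrite ler_pdivrMr// ler_peMr ?(ltW q0).
move=> xR.
set r := N + enorm x ^+ 2; have rp := r_gt0 _ (rN x); rewrite -/r in rp.
have X1 : enorm x <= enorm x ^+ 2.
  by rewrite expr2 ler_peMr ?enorm_ge0//; lra.
have hX : c' / 2 * r <= c' * enorm x ^+ 2 - C2.
  have h2 := ler_wpM2l (ltW c0) (le_trans xR X1).
  have e : c' * R1 = 2 * C2 + c' * N + c' by rewrite /R1; field; rewrite lt0r_neq0.
  rewrite e in h2; rewrite /r; lra.
have h1 : enorm (T x) ^+ 2 - enorm x ^+ 2 <= - (gam * (c' / 2 * r)).
  by have := TC x; have := ler_wpM2l (ltW g0) hX; lra.
apply: le_trans (ler_wpM2l (p0 _ (rN x)) h1) _; rewrite -/r.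
have -> : p r * - (gam * (c' / 2 * r)) = - (2 * e0) * gam.
  by rewrite /p /e0; field; rewrite lt0r_neq0.
exact: lexx.
Qed.

End lyapunov_functions.

(** * Uniform ergodicity of MYULA in the coercive and in the strongly convex case *)

Section myula_ergodicity.
Context {R : realType} {d : nat}.
Local Notation E := 'rV[R]_d.
Variables (L M RV U0 : R).
Hypotheses (L0 : 0 <= L) (M0 : 0 <= M) (RV0 : 0 <= RV).

Record myula_potentials (V U : E -> R) : Prop := MyulaPotentials {
  mp_diff : forall x, differentiable V x;
  mp_convV : mconvex 0 V;
  mp_convU : mconvex 0 U;
  mp_lipV : forall x y, enorm (grad V x - grad V y) <= L * enorm (x - y);
  mp_lipU : forall x y, `|U x - U y| <= M * enorm (x - y);
  mp_min : exists xs, (forall z, V xs <= V z) /\ enorm xs <= RV;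
  mp_U0 : U 0 <= U0 }.

Variables (kl ku gbar : R).
Hypotheses (ku1 : 1 < ku) (kl1 : kl <= 1) (kl2 : 1 / 2 < kl).
Hypotheses (gbar0 : 0 < gbar) (gL : gbar * L < 2 - kl^-1).

Let klV : 1 <= kl^-1 < 2.
Proof.
have := kl1; have := kl2 => h1 h2; rewrite invf_ge1 ?h2/=; last by lra.
by rewrite invf_plt ?posrE//; lra.
Qed.

Let gamL (gam : R) : gam <= gbar -> gam * L <= 2 - kl^-1.
Proof. by move=> gG; apply: le_trans (ltW gL); rewrite ler_wpM2r. Qed.

Let myula_nonexpansive V U kappa gam : myula_potentials V U ->
  kl <= kappa <= ku -> 0 < gam <= gbar -> forall x y,
  enorm (myula_mean V U kappa gam x - myula_mean V U kappa gam y) <= enorm (x - y).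
Proof.
move=> [dV cV cU LV LU _ _] /andP[klk kku] /andP[g0 gG] x y.
have := klV; have := kl2 => kl2' /andP[k1 k2].
have kappa0 : 0 < kappa by lra.
(* This split serves all kappa at once: it dominates [gam L], its complement to 2 is
   [kl^-1 >= kappa^-1], and it is positive because [kl > 1 / 2]. *)
apply: (@myula_mean_nonexpansive _ _ V U L M kappa gam _ _ _ _ _ _ _ _ _ (2 - kl^-1)) => //.
- by lra.
- exact: gamL.
- by rewrite opprB addrCA subrr addr0 lef_pV2 ?posrE//; lra.
Qed.

Lemma myula_ergodic_coercive (eta c alpha a : R) :
  0 < eta -> 0 <= c -> 0 <= U0 -> 0 < alpha -> alpha < eta / 8 -> 0 < a <= 1 ->
  exists A rho : R, [/\ 0 <= A, 0 < rho < 1 &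
  forall V U, myula_potentials V U -> (forall x, eta * enorm x - c <= U x) ->
  forall kappa gam : R, kl <= kappa <= ku -> 0 < gam <= gbar ->
  ergodic_bounds A rho gam (fun x => Walpha alpha x `^ a)
    (myula_op V U kappa gam)].
Proof.
move=> eta0 c0 U00 al0 al8 /andP[a0 a1].
pose C3 := L * (RV + gbar * M) ^+ 2 + gbar * M ^+ 2 + 2 * (eta * (gbar * ku * M) + c + U0).
have C30 : 0 <= C3.
  have ku0 : 0 <= ku by have := ku1; lra.
  by rewrite /C3 !addr_ge0// !mulr_ge0 ?sqr_ge0 ?addr_ge0 ?mulr_ge0// ltW.
have aal0 : 0 < a * alpha by rewrite mulr_gt0.
have aal8 : a * alpha < eta / 8.
  by apply: le_lt_trans al8; rewrite ler_piMl// ltW.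
have [A [rho [A0 rho01 H]]] := @gauss_ergodic_exp R d _ _ _ _ aal0 eta0 aal8 C30 gbar0.
exists A, rho; split=> // V U VU coU kappa gam kap gam01.
have -> : (fun x : E => Walpha alpha x `^ a) =
    (fun x => expR (a * alpha * Num.sqrt (1 + enorm x ^+ 2))).
  by apply/funext => x; rewrite /Walpha -expRM mulrC mulrA.
have /andP[g0 gG] := gam01; have /andP[klk kku] := kap.
apply: H => //; first exact: (myula_nonexpansive VU).
have [dV cV cU LV LU [xs [xmin xRV]] hU0] := VU => x.
have := kl2; have := klV => /andP[k1 k2] kl2'.
have kappa0 : 0 < kappa by lra.
apply: (@myula_mean_growth_coercive _ _ V U L M kappa gam _ _ _ _ _ _ _ _ _ RV xs) => //.
(* [gam L <= 2 - kl^-1 <= 1], the second inequality from [kl <= 1]. *)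
- by have := gamL gG; lra.
- exact: ltW.
Qed.

(** With [t = |x|^2]: [1 + t^q <= (1 + t)^q <= (N2 + t)^q <= N2^q (1 + t)^q <= (2 N2)^q (1 + t^q)],
    raised to the power [a]. *)
Lemma Wq_powR_equiv (q : nat) (a N2 : R) (x : E) : (0 < q)%N -> 0 < a -> 1 <= N2 ->
  Wq q x `^ a <= (N2 + enorm x ^+ 2) `^ (a * q%:R) <=
    (2 * N2) `^ (a * q%:R) * Wq q x `^ a.
Proof.
move=> q0 a0 N21; set t := enorm x ^+ 2.
have t0 : 0 <= t by exact: sqr_ge0.
have tq0 : 0 <= t ^+ q by exact: exprn_ge0.
have aq s : 0 <= s -> s `^ (a * q%:R) = (s ^+ q) `^ a.
  by move=> s0; rewrite mulrC powRrM powR_mulrn.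
have Wt : Wq q x = 1 + t ^+ q by rewrite /Wq exprM.
rewrite Wt !aq; try lra.
have pw u v : 0 <= u -> u <= v -> u `^ a <= v `^ a.
  by move=> u0 uv; rewrite ge0_ler_powR ?nnegrE ?(ltW a0)// (le_trans u0).
rewrite -powRM ?exprn_ge0 ?addr_ge0//; last by lra.
apply/andP; split; apply: pw.
- exact: addr_ge0.
- apply: (@le_trans _ _ ((1 + t) ^+ q)); last first.
    by rewrite ler_pXn2r// ?nnegrE; lra.
  elim: q q0 {aq Wt tq0} => // -[_ _|q ih _]; first by rewrite !expr1.
  have := ih isT; rewrite [(1 + t) ^+ _.+2]exprS [t ^+ _.+2]exprS => h.
  have tq1 : 0 <= t ^+ q.+1 by exact: exprn_ge0.
  have := ler_wpM2l (_ : 0 <= 1 + t) h; have -> : 0 <= 1 + t by lra.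
  by move=> /(_ isT); lra.
- by rewrite exprn_ge0//; lra.
have h1 : N2 + t <= N2 * (1 + t).
  have : 0 <= (N2 - 1) * t by rewrite mulr_ge0//; lra.
  lra.
apply: (@le_trans _ _ ((N2 * (1 + t)) ^+ q)).
  by rewrite ler_pXn2r// ?nnegrE; lra.
clearbody t; rewrite !exprMn -mulrA [leRHS]mulrCA ler_wpM2l ?exprn_ge0//; first by lra.
have q2 : 0 <= 2 ^+ q :> R by exact: exprn_ge0.
case: (leP t 1) => t1.
  apply: (@le_trans _ _ (2 ^+ q)); last by have := mulr_ge0 q2 tq0; lra.
  by rewrite ler_pXn2r// ?nnegrE; lra.
apply: (@le_trans _ _ ((2 * t) ^+ q)).
  by rewrite ler_pXn2r// ?nnegrE; lra.
by rewrite exprMn; lra.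
Qed.

Lemma myula_ergodic_strong (m a : R) (q : nat) :
  0 < m -> 0 < a -> (0 < q)%N ->
  exists A rho : R, [/\ 0 <= A, 0 < rho < 1 &
  forall V U, myula_potentials V U -> mconvex m V ->
  forall kappa gam : R, kl <= kappa <= ku -> 0 < gam <= gbar ->
  ergodic_bounds A rho gam (fun x => Wq q x `^ a) (myula_op V U kappa gam)].
Proof.
move=> m0 a0 q0.
pose C2 := m / 2 * RV ^+ 2 + 2 * (RV + gbar * M) * L * RV + gbar * M ^+ 2
             + 2 / m * (2 * (RV + gbar * M) * L + 2 * M) ^+ 2.
have C20 : 0 <= C2.
  have RM0 : 0 <= RV + gbar * M by rewrite addr_ge0// mulr_ge0// ltW.
  have m2 : 0 <= m / 2 by lra.
  have m2' : 0 <= 2 / m by rewrite divr_ge0// ltW.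
  rewrite /C2; apply: addr_ge0; last by rewrite mulr_ge0// sqr_ge0.
  apply: addr_ge0; last by rewrite mulr_ge0 ?sqr_ge0// ltW.
  apply: addr_ge0; first by rewrite mulr_ge0// sqr_ge0.
  by rewrite mulr_ge0// mulr_ge0// mulr_ge0.
have aq0 : 0 < a * q%:R by rewrite mulr_gt0// ltr0n.
have m8 : 0 < m / 8 by lra.
have [N2 [A [rho [N21 A0 rho01 H]]]] := @gauss_ergodic_poly R d _ _ _ _ aq0 m8 C20 gbar0.
exists (A * (2 * N2) `^ (a * q%:R)), rho; split=> //.
  by rewrite mulr_ge0// powR_ge0.
move=> V U VU sV kappa gam kap gam01.
have /andP[g0 gG] := gam01; have /andP[klk kku] := kap.
apply: (ergodic_bounds_equiv (W' := fun x => (N2 + enorm x ^+ 2) `^ (a * q%:R))) => //.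
- by move=> x; have /andP[] := Wq_powR_equiv x q0 a0 N21.
- by move=> x; have /andP[] := Wq_powR_equiv x q0 a0 N21.
apply: H => //; first exact: (myula_nonexpansive VU).
have [dV cV cU LV LU [xs [xmin xRV]] hU0] := VU => x.
have := kl2; have := klV => /andP[k1 k2] kl2'.
have kappa0 : 0 < kappa by lra.
apply: (@myula_mean_growth_strong _ _ V U L M kappa gam _ _ _ _ _ _ _ _ _ RV xs) => //.
by have := gamL gG; lra.
Qed.

End myula_ergodicity.

Lemma Wnorm_le {R : realType} {d : nat} (W : 'rV[R]_d -> R)
    (xi : ('rV[R]_d -> R) -> \bar R) (B : \bar R) :
  (forall f : 'rV[R]_d -> R, measurable_fun setT f -> (forall x, `|f x| <= W x) ->
     (`|xi f| <= B)%E) ->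
  (Wnorm W xi <= B)%E.
Proof. by move=> h; apply: ge_ereal_sup => _ [f [mf fW] <-]; exact: h. Qed.

Theorem theorem4 (R : realType) (d dT : nat) (hd : (0 < d)%N) (hdT : (0 < dT)%N)
  (Theta : set 'rV[R]_dT) (hTheta : Theta !=set0)
  (V Vb U Ub : 'rV[R]_dT -> 'rV[R]_d -> R)
  (L M m eta c : R)
  (* H1 *)
  (H1conv : forall th, Theta th ->
     [/\ mconvex 0 (V th), mconvex 0 (Vb th), mconvex 0 (U th) & mconvex 0 (Ub th)])
  (H1nonneg : forall th, Theta th -> forall x,
     [/\ 0 <= V th x, 0 <= Vb th x, 0 <= U th x & 0 <= Ub th x])
  (H1a_fin : forall th, Theta th ->
     (lebint (fun x => (expR (- V th x - U th x))%:E) < +oo)%E /\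
     (lebint (fun x => (expR (- Vb th x - Ub th x))%:E) < +oo)%E)
  (H1a_inf : (0 < ereal_inf [set lebint (fun x => (expR (- V th x - U th x))%:E)
                             | th in Theta])%E /\
             (0 < ereal_inf [set lebint (fun x => (expR (- Vb th x - Ub th x))%:E)
                             | th in Theta])%E)
  (H1b_C1 : forall th, Theta th ->
     (forall x, differentiable (V th) x /\ differentiable (Vb th) x) /\
     continuous (grad (V th)) /\ continuous (grad (Vb th)))
  (hL : 0 <= L)
  (H1b_Lip : forall th, Theta th -> forall x y,
     enorm (grad (V th) x - grad (V th) y) <= L * enorm (x - y) /\
     enorm (grad (Vb th) x - grad (Vb th) y) <= L * enorm (x - y))
  (H1b_min : exists RV1 RV2 : R, 0 <= RV1 /\ 0 <= RV2 /\
     forall th, Theta th ->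
       (exists xs, (forall z, V th xs <= V th z) /\
                   enorm xs <= RV1 /\ `|V th xs| <= RV2) /\
       (exists xs, (forall z, Vb th xs <= Vb th z) /\
                   enorm xs <= RV1 /\ `|Vb th xs| <= RV2))
  (hM : 0 <= M)
  (H1c_Lip : forall th, Theta th -> forall x y,
     `|U th x - U th y| <= M * enorm (x - y) /\
     `|Ub th x - Ub th y| <= M * enorm (x - y))
  (H1c_pt : exists RU1 RU2 : R, 0 <= RU1 /\ 0 <= RU2 /\
     forall th, Theta th ->
       (exists xs, enorm xs <= RU1 /\ `|U th xs| <= RU2) /\
       (exists xs, enorm xs <= RU1 /\ `|Ub th xs| <= RU2))
  (kl ku gbar : R) (W : 'rV[R]_d -> R)
  (hku : 1 < ku) (hkl1 : kl <= 1) (hkl2 : 1 / 2 < kl)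
  (* at least one of H2, H3, with the corresponding step bound and W *)
  (hcase :
     ((* H2 *) (0 < m /\ forall th, Theta th -> mconvex m (V th) /\ mconvex m (Vb th))
      /\ gbar * L < 2 - kl^-1 /\ gbar * (m + L) < 2
      /\ exists q : nat, (0 < q)%N /\ W = Wq q)
     \/
     ((* H3 *) (0 < eta /\ 0 <= c /\ forall th, Theta th -> forall x,
                  eta * enorm x - c <= Num.min (U th x) (Ub th x))
      /\ gbar * L < 2 - kl^-1 /\ 2 * M * L * gbar < eta
      /\ exists alpha : R, 0 < alpha /\ alpha < Num.min (kl * eta / 4) (eta / 8)
                         /\ W = Walpha alpha)) :
  forall a : R, 0 < a <= 1 ->
  exists A2 rho : R, 0 <= A2 /\ 0 < rho < 1 /\
  forall th, Theta th -> forall kappa, kl <= kappa <= ku ->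
  forall gamma, 0 < gamma <= gbar ->
  exists P Pb : probability 'rV[R]_d R,
    myula_invariant (V th) (U th) kappa gamma P /\
    myula_invariant (Vb th) (Ub th) kappa gamma Pb /\
    forall (x y : 'rV[R]_d) (n : nat),
      [/\ (Wnorm (fun z => (W z `^ a)%R)
             (fun f => myula_iter_int (V th) (U th) kappa gamma n f x
                       - \int[P]_z (f z)%:E)
           <= (A2 * rho `^ (gamma * n%:R) * W x `^ a)%:E)%E,
          (Wnorm (fun z => (W z `^ a)%R)
             (fun f => myula_iter_int (Vb th) (Ub th) kappa gamma n f x
                       - \int[Pb]_z (f z)%:E)
           <= (A2 * rho `^ (gamma * n%:R) * W x `^ a)%:E)%E,
          (Wnorm (fun z => (W z `^ a)%R)
             (fun f => myula_iter_int (V th) (U th) kappa gamma n f x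
                       - myula_iter_int (V th) (U th) kappa gamma n f y)
           <= (A2 * rho `^ (gamma * n%:R) * (W x `^ a + W y `^ a))%:E)%E &
          (Wnorm (fun z => (W z `^ a)%R)
             (fun f => myula_iter_int (Vb th) (Ub th) kappa gamma n f x
                       - myula_iter_int (Vb th) (Ub th) kappa gamma n f y)
           <= (A2 * rho `^ (gamma * n%:R) * (W x `^ a + W y `^ a))%:E)%E].
Proof.
move=> a a01; have /andP[a0 a1] := a01.
(* No step size is admissible when [gbar <= 0], so any constants do. *)
have [gbar0|gbar0] := leP gbar 0.
  exists 0, (1 / 2); split=> //; split; first by lra.
  move=> th _ kappa _ gam /andP[g0 gG].
  by have := lt_le_trans g0 (le_trans gG gbar0); rewrite ltxx.
have [RV1 [RV2 [RV0 [_ Hmin]]]] := H1b_min.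
have [RU1 [RU2 [RU10 [RU20 Hpt]]]] := H1c_pt.
(* A bound on [U] and [Ub] at 0, uniform in [th]: go from 0 to the reference point of norm at most
   [RU1] by the Lipschitz property. *)
pose U0 := RU2 + M * RU1.
have U00 : 0 <= U0 by rewrite addr_ge0// mulr_ge0.
have U0_le (f : 'rV[R]_d -> R) : (forall x y, `|f x - f y| <= M * enorm (x - y)) ->
    (exists xs, enorm xs <= RU1 /\ `|f xs| <= RU2) -> f 0 <= U0.
  move=> fM [xs [xs1 fxs]]; have := fM 0 xs; rewrite sub0r enormN => h.
  have := ler_wpM2l hM xs1; have := ler_norm (f xs); have := ler_norm (f 0 - f xs).
  by rewrite /U0; lra.
have pot th : Theta th -> myula_potentials L M RV1 U0 (V th) (U th) /\
    myula_potentials L M RV1 U0 (Vb th) (Ub th).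
  move=> hth; have [cV cVb cU cUb] := H1conv th hth.
  have [dV _] := H1b_C1 th hth.
  have [[xs [xmin [xR _]]] [xsb [xbmin [xbR _]]]] := Hmin th hth.
  have [pU pUb] := Hpt th hth.
  split; split=> //.
  - by move=> x; have [] := dV x.
  - by move=> x y; have [] := H1b_Lip th hth x y.
  - by move=> x y; have [] := H1c_Lip th hth x y.
  - by exists xs.
  - by apply: U0_le => // x y; have [] := H1c_Lip th hth x y.
  - by move=> x; have [] := dV x.
  - by move=> x y; have [] := H1b_Lip th hth x y.
  - by move=> x y; have [] := H1c_Lip th hth x y.
  - by exists xsb.
  - by apply: U0_le => // x y; have [] := H1c_Lip th hth x y.
(* Each case yields constants that depend only on the uniform bounds, hence common to all [th] and
   to both pairs of potentials. *)
have [A [rho [A0 rho01 H]]] : exists A rho : R, [/\ 0 <= A, 0 < rho < 1 &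
    forall th, Theta th -> forall kappa gam : R, kl <= kappa <= ku -> 0 < gam <= gbar ->
    ergodic_bounds A rho gam (fun z => W z `^ a) (myula_op (V th) (U th) kappa gam) /\
    ergodic_bounds A rho gam (fun z => W z `^ a) (myula_op (Vb th) (Ub th) kappa gam)].
  case: hcase => [[[m0 sV] [gL [_ [q [q0 ->]]]]]|
    [[eta0 [c0 coU]] [gL [_ [alpha [al0 [al8 ->]]]]]]].
  - have [A [rho [A0 rho01 H]]] :=
      @myula_ergodic_strong R d _ _ _ U0 hL hM RV0 _ ku _ hkl1 hkl2 gbar0 gL _ _ _ m0 a0 q0.
    exists A, rho; split=> // th hth kappa gam hk hg.
    by have [sVt sVbt] := sV th hth; have [p1 p2] := pot th hth; split; apply: H.
  have al8' : alpha < eta / 8 by move: al8; rewrite lt_min => /andP[].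
  have [A [rho [A0 rho01 H]]] :=
    @myula_ergodic_coercive R d _ _ _ _ hL hM RV0 _ _ _ hku hkl1 hkl2 gbar0 gL
      _ _ _ _ eta0 c0 U00 al0 al8' a01.
  exists A, rho; split=> // th hth kappa gam hk hg.
  have [p1 p2] := pot th hth; split; apply: H => // x;
    by have := coU th hth x; rewrite le_min => /andP[].
exists A, rho; split=> //; split=> // th hth kappa hk gam hg.
have [[P [invP HP]] [Pb [invPb HPb]]] := H th hth kappa gam hk hg.
exists P, Pb; split; first exact: invP.
split; first exact: invPb.
by move=> x y n; split; apply: Wnorm_le => f mf fW;
  [have [] := HP n x y f mf fW|have [] := HPb n x y f mf fW
  |have [] := HP n x y f mf fW|have [] := HPb n x y f mf fW].
Qed.
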